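(* Let $n\ge 1$. There is a unique continuous map $\psi\colon \mathrm{Sym}(n)\to \mathrm{SO}(n)$ with $\psi(0)=I$ such that the map $$\gamma\colon \mathrm{Sym}(n)\to \mathrm{Sym}^+(n),\qquad \gamma(A)=\exp\big(\psi(A)\,A\,\psi(A)^{-1}\big),$$ intertwines the Gelfand-Zeitlin maps $\lambda$ and $\mu$, i.e. $\mu\circ\gamma=\lambda$. In fact, $\psi$ is smooth and $\gamma$ is a diffeomorphism.
   Context: $\mathrm{Sym}(n)$ is the space of real symmetric $n\times n$ matrices and $\mathrm{Sym}^+(n)\subset\mathrm{Sym}(n)$ the subset of positive definite matrices. For $k\le n$ let $A^{(k)}$ denote the $k$th principal submatrix (upper left $k\times k$ corner) of $A$, and $\lambda^{(k)}_1(A)\le\cdots\le\lambda^{(k)}_k(A)$ its ordered eigenvalues. The Gelfand-Zeitlin map $\lambda\colon \mathrm{Sym}(n)\to\mathbb{R}^{n(n+1)/2}$ takes $A$ to the collection $(\lambda^{(k)}_i(A))_{1\le i\le k\le n}$. The logarithmic Gelfand-Zeitlin map $\mu\colon\mathrm{Sym}^+(n)\to\mathbb{R}^{n(n+1)/2}$ takes $A$ to the collection $\mu^{(k)}_i(A)=\log(\lambda^{(k)}_i(A))$, $1\le i\le k\le n$. *)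

(* Defs.v *)
From mathcomp Require Import all_boot all_order all_algebra.
From mathcomp Require Import all_classical all_reals all_analysis.

Set Implicit Arguments.
Unset Strict Implicit.
Unset Printing Implicit Defensive.

Import Order.TTheory GRing.Theory Num.Theory.
Import numFieldNormedType.Exports.

Local Open Scope classical_set_scope.
Local Open Scope ring_scope.

(* Maps on Sym(n), Sym^+(n), SO(n) are represented by total functions on
   'M[R]_n, of which only the values on the relevant set matter. *)

Definition Sym (R : realType) (n : nat) : set 'M[R]_n :=
  [set A | A \is symmetricmx].

Definition SymPos (R : realType) (n : nat) : set 'M[R]_n :=
  [set A | Sym A /\ forall x : 'rV[R]_n, x != 0 -> 0 < (x *m A *m x^T) 0 0].

Definition SO (R : realType) (n : nat) : set 'M[R]_n :=
  [set Q | Q *m Q^T = 1%:M /\ \det Q = 1].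

Definition expmx (R : realType) (n : nat) (A : 'M[R]_n) : 'M[R]_n :=
  limn (series (fun k : nat => (k`!%:R)^-1 *: A ^+ k)).

(* The nondecreasing sequence of the eigenvalues of A, repeated according to
   their multiplicity as roots of the characteristic polynomial. The default
   value [::] is irrelevant for symmetric A, whose characteristic polynomial
   splits over R. *)
Definition ordered_eigenvalues (R : realType) (n : nat) (A : 'M[R]_n) : seq R :=
  xget [::] [set s : seq R | sorted <=%R s /\
                             char_poly A = \prod_(x <- s) ('X - x%:P)].

(* For k : 'I_n this is the upper left corner of size k + 1. *)
Definition principal_submx (R : realType) (n : nat) (k : 'I_n) (A : 'M[R]_n) :
    'M[R]_k.+1 :=
  mxsub (widen_ord (ltn_ord k)) (widen_ord (ltn_ord k)) A.

(* Index set of the pairs (k, i) with 1 <= i <= k <= n, both shifted by 1;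
   it has n(n+1)/2 elements. *)
Definition GZ_index (n : nat) : finType := {k : 'I_n & 'I_k.+1}.

Definition GZ (R : realType) (n : nat) (A : 'M[R]_n) : {ffun GZ_index n -> R} :=
  [ffun p : GZ_index n =>
     nth 0 (ordered_eigenvalues (principal_submx (tag p) A))
           (tagged p : 'I_(tag p).+1)].

Definition logGZ (R : realType) (n : nat) (A : 'M[R]_n) :
    {ffun GZ_index n -> R} :=
  [ffun p => ln (GZ A p)].

(* C^k maps on a relatively open subset U of a linear subspace V of E (finite
   dimensional in the applications): all iterated directional derivatives of
   order <= k, in directions of V, exist and are continuous on U. For x in U
   and v in V, the points x + h v lie in U for small h, so that these
   derivatives only depend on the restriction of f to U. *)
Fixpoint Ck_on (R : realType) (E F : normedModType R) (k : nat) (V U : set E)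
    (f : E -> F) : Prop :=
  {within U, continuous f} /\
  if k is k'.+1 then
    forall v, V v -> (forall x, U x -> derivable f x v) /\
                     Ck_on k' V U (fun x => 'D_v f x)
  else True.

Definition smooth_on (R : realType) (E F : normedModType R) (V U : set E)
    (f : E -> F) : Prop :=
  forall k : nat, Ck_on k V U f.

(* Diffeomorphism between relatively open subsets U and W of V. *)
Definition diffeomorphism_on (R : realType) (E : normedModType R)
    (V U W : set E) (f : E -> E) : Prop :=
  [/\ set_bij U W f, smooth_on V U f &
      exists2 g : E -> E, (forall x, U x -> g (f x) = x) & smooth_on V W g].

Definition gamma (R : realType) (n : nat) (psi : 'M[R]_n -> 'M[R]_n)
    (A : 'M[R]_n) : 'M[R]_n :=
  expmx (psi A *m A *m invmx (psi A)).

Definition intertwining_twist (R : realType) (n : nat)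
    (psi : 'M[R]_n -> 'M[R]_n) : Prop :=
  [/\ forall A, Sym A -> SO (psi A),
      {within @Sym R n, continuous psi},
      psi 0 = 1%:M &
      forall A, Sym A -> logGZ (gamma psi A) = GZ A].

(* Main.v *)
Require Import Defs.
From mathcomp Require Import all_boot all_order all_algebra.
From mathcomp Require Import all_classical all_reals all_analysis.
From mathcomp Require Import ring lra zify spectral.
From mathcomp.real_closed Require complex.
From mathcomp.real_closed Require Import mxtens.

(** The twist is built by induction on the size. Write A as a bordered matrix with
    corner A', border column b and last entry c. The aim is a rotation Q(A),
    depending smoothly on A, such that Q(A) exp(A) Q(A)^T has corner exp(A').
    Given the twist psi of the smaller size, the next one is then
    (psi(A') + 1) Q(A), where + is the block diagonal sum: the corner of its
    twisted exponential is the twisted exponential of A', so that all corner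
    spectra are the exponentials of those of A.

    Existence of Q(A). Let a_i be the eigenvalues of A' and l_j those of A, and
    let b_i and w_j be the coordinates of b and of the last basis vector in the
    two eigenbases. The change of basis is an orthogonal Cauchy matrix, with
    entries b_i w_j / (l_j - a_i) and last row w_j. By Lagrange interpolation a
    Cauchy matrix is orthogonal exactly when b_i^2 and w_j^2 are given by certain
    products of differences of the a_i and l_j (cauchy_squares_orthonormal and
    its converse). Passing from eigenvalues to their exponentials multiplies each
    difference x - y by f(x, y) = (exp x - exp y) / (x - y) > 0. Hence a second
    orthogonal Cauchy matrix, with nodes exp a_i and exp l_j, arises from the
    factors h_i and k_j for b_i and w_j that are square roots of products of
    values of f (cauchy_transfer). In invariant terms Q(A) is a product of
    functions of A and A' (Qmx): the h_i and k_j become exponentials of partial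
    traces of log f(A', A), with f(A', A) acting on the tensor product, and the
    denominators the inverse of f(A', A). As f never vanishes, nothing is divided
    by a difference of eigenvalues, so Q is smooth on all symmetric matrices. It
    is orthogonal when A and A' share no eigenvalue, hence always by density, and
    of determinant 1 by continuity along the ray from 0. Moreover
    Q(A) exp(A) Q(A)^T has corner exp(A') and border h b (Qmx_conj).

    Smoothness. The difference of two exponentials is a block of the exponential
    of a matrix of twice the size (expmxB). The derivative of exp is therefore
    again an exponential, and exp is C^k for all k by induction on k, for all sizes
    at once. The logarithm is treated in the same way, with f(X, Y) inverted.

    Inverse. From B = exp(psi(A) A psi(A)^T) one recovers A' from the corner of B
    by induction, then psi(A'), then b = h^-1 d for the border d of the untwisted
    B: indeed h depends on A only through A' and the spectrum of A, which is that
    of log B (hexp_char_poly). The trace gives the last entry. This defines a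
    smooth map on all of Sym^+, and it is a right inverse too: the recovered
    matrix has the spectrum of log B, by the transfer of Cauchy matrices read
    backwards when B and its corner share no eigenvalue, and by density in general
    (inv_border_char_poly).

    Uniqueness. Let A be generic, that is, consecutive corners share no
    eigenvalue, and put Z(t) = psi(t A) A psi(t A)^T. The path
    (exp(t Z(t)) - 1) / t, equal to A at t = 0, has the same corner spectra for
    any two twists. These spectra determine each border up to the signs of its
    coordinates, which are not zero and cannot jump along a path; so the two
    paths agree (path_unique), and so do the two paths Z(t). Then psi(t A)^T
    psi'(t A) commutes with A, whose spectrum is simple. It is therefore diagonal
    with entries 1 or -1 in an eigenbasis of A, and it is 1 at t = 0, hence at
    t = 1. Continuity and density of the generic matrices give the rest. *)

Set Implicit Arguments.
Unset Strict Implicit.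
Unset Printing Implicit Defensive.

Import Order.TTheory GRing.Theory Num.Theory.
Import numFieldNormedType.Exports.
Local Open Scope classical_set_scope.
Local Open Scope ring_scope.

(** * Limits of matrices and the exponential *)

Section MatrixLimits.
Variables (R : realType) (T : Type) (F : set_system T).
Context {FF : Filter F}.

Lemma cvg_mxP m n (f : T -> 'M[R]_(m, n)) (M : 'M[R]_(m, n)) :
  f @ F --> M <-> forall i j, (fun x => f x i j) @ F --> M i j.
Proof.
split=> [fM i j|fM].
  exact: (@cvg_comp _ _ _ f (fun N : 'M[R]_(m, n) => N i j) _ _ _ fM
    (@coord_continuous R m n i j M)).
apply/cvgrPdist_le => /= e e0; near=> x.
rewrite /Num.Def.normr/= mx_normrE (bigmax_le _ (ltW e0))//= => i _.
rewrite !mxE/=; move: i; near: x; apply: filter_forall => /= i.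
exact: ((cvgrPdist_le _ _).1 (fM i.1 i.2)).
Unshelve. all: by end_near. Qed.

Lemma cvg_big_sum (V : normedModType R) (I : Type) (r : seq I) (P : pred I)
    (f : I -> T -> V) (l : I -> V) :
  (forall i, P i -> f i @ F --> l i) ->
  (fun x => \sum_(i <- r | P i) f i x) @ F --> \sum_(i <- r | P i) l i.
Proof.
move=> fl; elim: r => [|i r IH].
  by rewrite big_nil; under eq_fun do rewrite big_nil; exact: cvg_cst.
rewrite big_cons; under eq_fun do rewrite big_cons.
by case: ifPn => // Pi; apply: cvgD => //; exact: fl.
Qed.

Lemma cvg_big_prod (I : Type) (r : seq I) (P : pred I)
    (f : I -> T -> R) (l : I -> R) :
  (forall i, P i -> f i @ F --> l i) ->
  (fun x => \prod_(i <- r | P i) f i x) @ F --> \prod_(i <- r | P i) l i.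
Proof.
move=> fl; elim: r => [|i r IH].
  by rewrite big_nil; under eq_fun do rewrite big_nil; exact: cvg_cst.
rewrite big_cons; under eq_fun do rewrite big_cons.
by case: ifPn => // Pi; apply: cvgM => //; exact: fl.
Qed.

Lemma cvg_mulmx m n p (f : T -> 'M[R]_(m, n)) (g : T -> 'M[R]_(n, p))
    (A : 'M[R]_(m, n)) (B : 'M[R]_(n, p)) :
  f @ F --> A -> g @ F --> B -> (fun x => f x *m g x) @ F --> A *m B.
Proof.
move=> /cvg_mxP fA /cvg_mxP gB; apply/cvg_mxP => i j; rewrite mxE.
under eq_fun do rewrite mxE.
by apply: cvg_big_sum => k _; apply: cvgM.
Qed.

Lemma cvg_trmx m n (f : T -> 'M[R]_(m, n)) (A : 'M[R]_(m, n)) :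
  f @ F --> A -> (fun x => (f x)^T) @ F --> A^T.
Proof.
move=> /cvg_mxP fA; apply/cvg_mxP => i j; rewrite mxE.
by under eq_fun do rewrite mxE; exact: fA.
Qed.

Lemma cvg_det n (f : T -> 'M[R]_n) (A : 'M[R]_n) :
  f @ F --> A -> (fun x => \det (f x)) @ F --> \det A.
Proof.
move=> /cvg_mxP fA; apply: cvg_big_sum => s _; apply: cvgM; first exact: cvg_cst.
exact: cvg_big_prod.
Qed.

End MatrixLimits.

Section Exponential.
Variable R : realType.

Lemma mx_norm_entry m n (A : 'M[R]_(m, n)) i j : `|A i j| <= `|A|.
Proof.
rewrite [leRHS]/Num.Def.normr/= mx_normrE.
exact: (le_bigmax _ (fun ij => `|A ij.1 ij.2|) (i, j)).
Qed.

Lemma mx_norm_leP m n (A : 'M[R]_(m, n)) (c : R) :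
  0 <= c -> (forall i j, `|A i j| <= c) -> `|A| <= c.
Proof.
move=> c0 Ac; rewrite [leLHS]/Num.Def.normr/= mx_normrE.
by apply: bigmax_le => //= -[i j] _.
Qed.

(** The norm is the largest absolute value of an entry, hence the factor n. *)
Lemma mx_norm_mul m n p (A : 'M[R]_(m, n)) (B : 'M[R]_(n, p)) :
  `|A *m B| <= n%:R * `|A| * `|B|.
Proof.
apply: mx_norm_leP => [|i j]; first by rewrite !mulr_ge0.
rewrite mxE; apply: le_trans (ler_norm_sum _ _ _) _.
rewrite -mulrA mulr_natl.
apply: le_trans (_ : \sum_(k < n) (`|A| * `|B|) <= _).
  by apply: ler_sum => k _; rewrite normrM ler_pM ?mx_norm_entry.
by rewrite sumr_const card_ord.
Qed.

Lemma mx_norm_exp n (A : 'M[R]_n) (r : R) k :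
  n.+1%:R * `|A| <= r -> `|A ^+ k| <= r ^+ k.
Proof.
move=> Ar; have r0 : 0 <= r by apply: le_trans Ar; rewrite mulr_ge0.
elim: k => [|k IH].
  rewrite !expr0; apply: mx_norm_leP => // i j; rewrite mxE.
  by case: eqP => _; rewrite ?normr1 ?normr0.
rewrite !exprS; apply: le_trans (mx_norm_mul _ _) _.
apply: ler_pM => //.
by apply: le_trans Ar; rewrite ler_wpM2r // ler_nat.
Qed.

(** The factor 2 ^+ k bounds the number k of terms of the telescoping sum. *)
Lemma mx_norm_expB n (A B : 'M[R]_n) (r : R) k :
  1 <= r -> n.+1%:R * `|A| <= r -> n.+1%:R * `|B| <= r ->
  `|A ^+ k - B ^+ k| <= n.+1%:R * `|A - B| * (2 * r) ^+ k.
Proof.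
move=> r1 Ar Br; have r0 : 0 <= r by apply: le_trans r1.
elim: k => [|k IH].
  by rewrite !expr0 subrr normr0 mulr1 mulr_ge0.
set c := _ * `|A - B| in IH *.
have -> : A ^+ k.+1 - B ^+ k.+1 = A *m (A ^+ k - B ^+ k) + (A - B) *m B ^+ k.
  by rewrite !exprS mulmxBr mulmxBl addrA subrK.
apply: le_trans (ler_normD _ _) _.
apply: le_trans (_ : r * (c * (2 * r) ^+ k) + c * r ^+ k <= _).
  apply: lerD; apply: le_trans (mx_norm_mul _ _) _.
    apply: ler_pM => //.
    by apply: le_trans Ar; rewrite ler_wpM2r // ler_nat.
  apply: ler_pM => //; rewrite ?mulr_ge0 ?mx_norm_exp //.
  by rewrite /c ler_wpM2r // ler_nat.
have -> : c * (2 * r) ^+ k.+1 = r * (c * (2 * r) ^+ k) + r * (c * (2 * r) ^+ k).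
  by rewrite exprS; ring.
rewrite lerD2l mulrCA ler_wpM2l ?mulr_ge0 //.
apply: le_trans (_ : 1 * (2 * r) ^+ k <= _); last by rewrite ler_wpM2r ?exprn_ge0 ?mulr_ge0.
by rewrite mul1r lerXn2r ?nnegrE ?mulr_ge0 // ler_peMl // ler1n.
Qed.

Local Notation expcoef A := (fun k : nat => (k`!%:R)^-1 *: A ^+ k).

(** Entrywise comparison with the scalar exponential series at n.+1%:R * `|A|. *)
Lemma expmx_cvg n (A : 'M[R]_n) : series (expcoef A) @ \oo --> expmx A.
Proof.
suff cvgA : cvgn (series (expcoef A)) by exact: cvgA.
have ij_cvg i j : cvgn (series (fun k => (expcoef A k) i j)).
  apply: (@normed_cvg R R).
  apply: (@series_le_cvg _ _ (exp_coeff (n.+1%:R * `|A|))) => [k|k|k|] //.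
  - exact: normr_ge0.
  - by apply: exp_coeff_ge0; rewrite mulr_ge0.
  - rewrite /= mxE normrM ger0_norm ?invr_ge0 // exp_coeffE.
    rewrite ler_wpM2l ?invr_ge0 //.
    by apply: le_trans (mx_norm_entry _ _ _) _; exact: mx_norm_exp.
  - exact: is_cvg_series_exp_coeff.
apply/cvg_ex; exists (\matrix_(i, j) limn (series (fun k => (expcoef A k) i j))).
apply/cvg_mxP => i j; rewrite mxE.
under eq_fun do rewrite /series /= summxE.
exact: ij_cvg.
Qed.

Lemma expmx_lipschitz n (A B : 'M[R]_n) (r : R) :
  1 <= r -> n.+1%:R * `|A| <= r -> n.+1%:R * `|B| <= r ->
  `|expmx A - expmx B| <= n.+1%:R * `|A - B| * expR (2 * r).
Proof.
move=> r1 Ar Br; have r0 : 0 <= r by apply: le_trans r1.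
have cvgE : (fun k => series (expcoef A) k - series (expcoef B) k) @ \oo -->
    expmx A - expmx B by apply: cvgB; exact: expmx_cvg.
apply: (cvgr_to_le (cvg_norm cvgE)); near=> k.
rewrite /= /series /= -sumrB; apply: le_trans (ler_norm_sum _ _ _) _.
apply: le_trans (_ : n.+1%:R * `|A - B| * series (exp_coeff (2 * r)) k <= _).
  rewrite mulr_sumr; apply: ler_sum => i _.
  rewrite -scalerBr normrZ ger0_norm ?invr_ge0 // exp_coeffE [leRHS]mulrCA.
  by rewrite ler_wpM2l ?invr_ge0 // mx_norm_expB.
rewrite ler_wpM2l ?mulr_ge0 //; apply: nondecreasing_cvgn_le.
  by apply: nondecreasing_series => i _ _; rewrite exp_coeff_ge0 ?mulr_ge0.
exact: is_cvg_series_exp_coeff.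
Unshelve. all: by end_near. Qed.

Lemma cvg_expmx (T : Type) (F : set_system T) {FF : Filter F} n
    (f : T -> 'M[R]_n) (A : 'M[R]_n) :
  f @ F --> A -> (fun x => expmx (f x)) @ F --> expmx A.
Proof.
move=> fA; set r : R := 1 + n.+1%:R * (`|A| + 1).
have r1 : 1 <= r by rewrite lerDl mulr_ge0 ?addr_ge0.
set C := n.+1%:R * expR (2 * r).
have C0 : 0 < C by rewrite mulr_gt0 ?expR_gt0.
apply/cvgrPdist_le => e e0; near=> x.
have dx : `|A - f x| <= Num.min 1 (e / C).
  near: x; move/cvgrPdist_le: fA; apply.
  by rewrite lt_min ltr01 divr_gt0.
apply: le_trans (@expmx_lipschitz n _ _ r r1 _ _) _.
- by rewrite /r -[leLHS]add0r lerD // ler_wpM2l // lerDl.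
- rewrite /r -[leLHS]add0r lerD // ler_wpM2l //.
  rewrite -[f x](subrK A) addrC; apply: le_trans (ler_normD _ _) _.
  by rewrite lerD2l distrC; apply: le_trans dx _; rewrite ge_min lexx.
rewrite mulrAC -/C mulrC -ler_pdivlMr //.
by apply: le_trans dx _; rewrite ge_min lexx orbT.
Unshelve. all: by end_near. Qed.

(** Every identity for exponentials below is an instance with suitable block
    matrices A, B and T. *)
Lemma expmx_intertwine m n (A : 'M[R]_m) (B : 'M[R]_n) (T : 'M[R]_(m, n)) :
  A *m T = T *m B -> expmx A *m T = T *m expmx B.
Proof.
move=> AT.
have ATk k : A ^+ k *m T = T *m B ^+ k.
  elim: k => [|k IH]; first by rewrite !expr0 mul1mx mulmx1.
  by rewrite !exprS -mulmxA IH mulmxA AT -mulmxA.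
have l1 : (fun k => series (expcoef A) k *m T) @ \oo --> expmx A *m T.
  by apply: cvg_mulmx; [exact: expmx_cvg | exact: cvg_cst].
have l2 : (fun k => T *m series (expcoef B) k) @ \oo --> T *m expmx B.
  by apply: cvg_mulmx; [exact: cvg_cst | exact: expmx_cvg].
have e : (fun k => series (expcoef A) k *m T)
       = (fun k => T *m series (expcoef B) k).
  apply/funext => k; rewrite /series /= mulmx_suml mulmx_sumr.
  by apply: eq_bigr => i _; rewrite -scalemxAl -scalemxAr ATk.
by rewrite e in l1; exact: (cvg_unique _ l1 l2).
Qed.
End Exponential.

(** * Calculus of C^k maps along a subspace *)

(** The part of relative openness that directional derivatives see. *)
Definition open_along (R : realType) (E : normedModType R) (V U : set E) : Prop :=
  forall x v, U x -> V v -> \forall h \near (0 : R), U (h *: v + x).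

Lemma is_derive_quotientP (R : realType) (E F : normedModType R) (f : E -> F)
    (x v : E) (df : F) :
  is_derive x v f df <->
  (fun h : R => h^-1 *: (f (h *: v + x) - f x)) @ 0^' --> df.
Proof.
split=> [[dv <-]|l]; first exact: dv.
by split; [apply: cvgP l | apply: cvg_lim l].
Qed.

Section CkCalculus.
Variables (R : realType) (E : normedModType R) (V U : set E).
Hypothesis oU : open_along V U.

Lemma cvg_along x v : U x -> V v ->
  (fun h : R => h *: v + x) @ 0^' --> within U (nbhs x).
Proof.
move=> Ux Vv.
have lx : (fun h : R => h *: v + x) @ 0^' --> x.
  rewrite -[X in _ --> X]add0r -(scale0r v); apply: cvgD; last exact: cvg_cst.
  by apply: cvgZr_tmp; exact: nbhs_dnbhs.
move=> A xA; suff : \forall h \near (0 : R)^', A (h *: v + x) by [].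
near=> h.
have Uh : U (h *: v + x) by near: h; exact: (nbhs_dnbhs (oU Ux Vv)).
suff : U (h *: v + x) -> A (h *: v + x) by exact.
by near: h; exact: (lx _ xA).
Unshelve. all: by end_near. Qed.

Lemma Ck_on_continuous k (F : normedModType R) (f : E -> F) x :
  Ck_on k V U f -> U x -> f @ within U (nbhs x) --> f x.
Proof. by case: k => [|k] [/subspace_continuousP fc _] Ux; exact: fc. Qed.

Lemma Ck_on_cvg_along k (F : normedModType R) (f : E -> F) x v :
  Ck_on k V U f -> U x -> V v -> (fun h : R => f (h *: v + x)) @ 0^' --> f x.
Proof.
move=> fC Ux Vv.
exact: (@cvg_comp _ _ _ (fun h : R => h *: v + x) f _ _ _ (cvg_along Ux Vv)
  (Ck_on_continuous fC Ux)).
Qed.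

Lemma Ck_onW k (F : normedModType R) (f : E -> F) :
  Ck_on k.+1 V U f -> Ck_on k V U f.
Proof.
elim: k f => [|k IH] f; first by case.
by case=> fc fd; split=> // v /fd[fdv /IH].
Qed.

(** A derivative at a point of U in a direction of V only sees the points
    h *: v + x, which lie in U for small h. *)
Lemma eq_Ck_on k (F : normedModType R) (f g : E -> F) :
  (forall x, U x -> f x = g x) -> Ck_on k V U f -> Ck_on k V U g.
Proof.
elim: k f g => [|k IH] f g fg [fc fd]; split.
- by apply: subspace_eq_continuous fc => x; rewrite inE; exact: fg.
- by [].
- by apply: subspace_eq_continuous fc => x; rewrite inE; exact: fg.
move=> v Vv; have [fdv fdC] := fd v Vv.
have gd x : U x -> is_derive x v g ('D_v f x).
  move=> Ux; apply/is_derive_quotientP.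
  have /is_derive_quotientP := derivableP (fdv x Ux).
  apply: cvg_trans; apply: near_eq_cvg.
  have := nbhs_dnbhs (oU Ux Vv); apply: filterS => h Uh.
  by rewrite !fg.
split=> [x /gd[]//|]; apply: IH fdC => x /gd gx.
by rewrite derive_val.
Qed.

(** With an arbitrary candidate df for the derivative, only its values on U have
    to be identified with those of 'D_v f. *)
Lemma Ck_onS k (F : normedModType R) (f : E -> F) :
  Ck_on 0 V U f ->
  (forall v, V v -> exists df : E -> F,
     (forall x, U x -> is_derive x v f (df x)) /\ Ck_on k V U df) ->
  Ck_on k.+1 V U f.
Proof.
case=> fc _ fd; split=> // v /fd[df [fdf dfC]]; split.
  by move=> x /fdf[].
by apply: eq_Ck_on dfC => x /fdf h; rewrite derive_val.
Qed.

Lemma Ck_on0 (F : normedModType R) (f : E -> F) :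
  (forall x, U x -> f @ within U (nbhs x) --> f x) -> Ck_on 0 V U f.
Proof. by move=> fc; split=> //; apply/subspace_continuousP. Qed.

Lemma Ck_onD1 k (F : normedModType R) (f : E -> F) v :
  Ck_on k.+1 V U f -> V v ->
  (forall x, U x -> is_derive x v f ('D_v f x)) /\ Ck_on k V U (fun x => 'D_v f x).
Proof. by case=> _ fd /fd[fdv ?]; split=> // x /fdv /derivableP. Qed.

Lemma Ck_on_cst k (F : normedModType R) (c : F) : Ck_on k V U (fun=> c).
Proof.
elim: k c => [|k IH] c; first by apply: Ck_on0 => x _; exact: cvg_cst.
apply: Ck_onS => [|v Vv]; first by apply: Ck_on0 => x _; exact: cvg_cst.
by exists (fun=> 0); split=> // x _; exact: is_derive_cst.
Qed.

Lemma Ck_onD k (F : normedModType R) (f g : E -> F) :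
  Ck_on k V U f -> Ck_on k V U g -> Ck_on k V U (fun x => f x + g x).
Proof.
have C0 f' g' : Ck_on 0 V U f' -> Ck_on 0 V U g' ->
    Ck_on 0 V U (fun x => f' x + g' x :> F).
  move=> fC gC; apply: Ck_on0 => x Ux; apply: cvgD; first exact: (Ck_on_continuous fC Ux).
  exact: (Ck_on_continuous gC Ux).
have Cle n (h : E -> F) : Ck_on n V U h -> Ck_on 0 V U h by case: n => // n [hc _]; split.
elim: k f g => [|k IH] f g fC gC; first exact: C0.
apply: Ck_onS => [|v Vv]; first by apply: C0; [exact: Cle fC | exact: Cle gC].
have [fd fdC] := Ck_onD1 fC Vv; have [gd gdC] := Ck_onD1 gC Vv.
exists (fun x => 'D_v f x + 'D_v g x); split; last exact: IH.
by move=> x Ux; apply: is_deriveD; [exact: fd | exact: gd].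
Qed.

Lemma Ck_onM k (f g : E -> R) :
  Ck_on k V U f -> Ck_on k V U g -> Ck_on k V U (fun x => f x * g x).
Proof.
have C0 (f' g' : E -> R) : Ck_on 0 V U f' -> Ck_on 0 V U g' ->
    Ck_on 0 V U (fun x => f' x * g' x :> R).
  move=> fC gC; apply: Ck_on0 => x Ux; apply: cvgM; first exact: (Ck_on_continuous fC Ux).
  exact: (Ck_on_continuous gC Ux).
have Cle n (h : E -> R) : Ck_on n V U h -> Ck_on 0 V U h by case: n => // n [hc _]; split.
elim: k f g => [|k IH] f g fC gC; first exact: C0.
apply: Ck_onS => [|v Vv]; first by apply: C0; [exact: Cle fC | exact: Cle gC].
have [fd fdC] := Ck_onD1 fC Vv; have [gd gdC] := Ck_onD1 gC Vv.
exists (fun x => f x * 'D_v g x + g x * 'D_v f x); split.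
  by move=> x Ux; apply: is_deriveM; [exact: fd | exact: gd].
by apply: Ck_onD; apply: IH => //; exact: Ck_onW.
Qed.

Lemma Ck_on_sum k (F : normedModType R) (I : Type) (r : seq I) (f : I -> E -> F) :
  (forall i, Ck_on k V U (f i)) -> Ck_on k V U (fun x => \sum_(i <- r) f i x).
Proof.
move=> fC; elim: r => [|i r IH].
  by under eq_fun do rewrite big_nil; exact: Ck_on_cst.
by under eq_fun do rewrite big_cons; exact: Ck_onD.
Qed.

Lemma Ck_on_mxP k m n (f : E -> 'M[R]_(m, n)) :
  Ck_on k V U f <-> forall i j, Ck_on k V U (fun x => f x i j).
Proof.
have C0 f' : Ck_on 0 V U f' <->
    forall i j, Ck_on 0 V U (fun x => (f' x : 'M[R]_(m, n)) i j).
  split=> [fC i j|fC].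
    by apply: Ck_on0 => x /(Ck_on_continuous fC)/cvg_mxP; exact.
  apply: Ck_on0 => x Ux; apply/cvg_mxP => i j.
  exact: (Ck_on_continuous (fC i j) Ux).
elim: k f => [|k IH] f; first exact: C0.
split=> [fC i j|fC].
  apply: Ck_onS => [|v Vv].
    by apply: (C0 f).1; case: fC => fc _; split.
  have [fd fdC] := Ck_onD1 fC Vv.
  exists (fun x => 'D_v f x i j); split; last by move/IH: fdC; exact.
  move=> x Ux; have /is_derive_quotientP/cvg_mxP/(_ i j) := fd x Ux.
  move=> l; apply/is_derive_quotientP; apply: cvg_trans l.
  by apply: near_eq_cvg; near=> h; rewrite !mxE.
apply: Ck_onS => [|v Vv].
  by apply/C0 => i j; case: (fC i j) => fc _; split.
exists (fun x => \matrix_(i, j) 'D_v (fun y => f y i j) x); split.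
  move=> x Ux; apply/is_derive_quotientP; apply/cvg_mxP => i j; rewrite mxE.
  have [fd _] := Ck_onD1 (fC i j) Vv.
  have /is_derive_quotientP l := fd x Ux; apply: cvg_trans l.
  by apply: near_eq_cvg; near=> h; rewrite !mxE.
apply/IH => i j; have [_ fdC] := Ck_onD1 (fC i j) Vv.
by apply: eq_Ck_on fdC => x _; rewrite mxE.
Unshelve. all: by end_near. Qed.

Lemma Ck_on_mulmx k m n p (f : E -> 'M[R]_(m, n)) (g : E -> 'M[R]_(n, p)) :
  Ck_on k V U f -> Ck_on k V U g -> Ck_on k V U (fun x => f x *m g x).
Proof.
move=> /Ck_on_mxP fC /Ck_on_mxP gC; apply/Ck_on_mxP => i j.
under eq_fun do rewrite mxE.
by apply: Ck_on_sum => l; exact: Ck_onM.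
Qed.

Lemma Ck_on_trmx k m n (f : E -> 'M[R]_(m, n)) :
  Ck_on k V U f -> Ck_on k V U (fun x => (f x)^T).
Proof.
move=> /Ck_on_mxP fC; apply/Ck_on_mxP => i j.
under eq_fun do rewrite mxE; exact: fC.
Qed.

Lemma Ck_on_scalemx k m n (c : R) (f : E -> 'M[R]_(m, n)) :
  Ck_on k V U f -> Ck_on k V U (fun x => c *: f x).
Proof.
move=> /Ck_on_mxP fC; apply/Ck_on_mxP => i j.
by under eq_fun do rewrite mxE; apply: Ck_onM => //; exact: Ck_on_cst.
Qed.

Lemma Ck_on_oppmx k m n (f : E -> 'M[R]_(m, n)) :
  Ck_on k V U f -> Ck_on k V U (fun x => - f x).
Proof. by under eq_fun do rewrite -scaleN1r; exact: Ck_on_scalemx. Qed.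

Lemma Ck_on_trace k n (f : E -> 'M[R]_n) :
  Ck_on k V U f -> Ck_on k V U (fun x => (\tr (f x))%:M : 'M[R]_1).
Proof.
move=> /Ck_on_mxP fC; apply/Ck_on_mxP => i j.
rewrite (ord1 i) (ord1 j); under eq_fun do rewrite mxE eqxx mulr1n.
by apply: Ck_on_sum => l; exact: fC.
Qed.

Lemma Ck_on_block_mx k m1 m2 n1 n2 (a : E -> 'M[R]_(m1, n1))
    (b : E -> 'M[R]_(m1, n2)) (c : E -> 'M[R]_(m2, n1)) (d : E -> 'M[R]_(m2, n2)) :
  Ck_on k V U a -> Ck_on k V U b -> Ck_on k V U c -> Ck_on k V U d ->
  Ck_on k V U (fun x => block_mx (a x) (b x) (c x) (d x)).
Proof.
move=> /Ck_on_mxP aC /Ck_on_mxP bC /Ck_on_mxP cC /Ck_on_mxP dC.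
apply/Ck_on_mxP => i j.
rewrite -[i]splitK -[j]splitK; case: (fintype.split i) => i'; case: (fintype.split j) => j' /=.
- by under eq_fun do rewrite block_mxEul.
- by under eq_fun do rewrite block_mxEur.
- by under eq_fun do rewrite block_mxEdl.
- by under eq_fun do rewrite block_mxEdr.
Qed.

End CkCalculus.

(** * The spectral theorem for real symmetric matrices *)

Section Spectral.
Variable R : realType.

Lemma SymE n (A : 'M[R]_n) : Sym A <-> A^T = A.
Proof.
rewrite /Sym /=; split=> [/is_hermitianmxP|At].
  by rewrite expr0 scale1r map_mx_id.
by apply/is_hermitianmxP; rewrite expr0 scale1r map_mx_id.
Qed.

Section RealEigenvalue.
Import complex.
Local Notation toC := (real_complex R).

(** Over the complex numbers A is Hermitian, so that its eigenvalues exist and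
    are real. *)
Lemma sym_eigenvalue n (A : 'M[R]_n.+1) : A^T = A -> exists a : R, eigenvalue A a.
Proof.
move=> At; set B : 'M[R[i]%C]_n.+1 := map_mx toC A.
have Bh : B \is hermsymmx.
  apply: realsym_hermsym.
    apply/is_hermitianmxP; rewrite expr0 scale1r map_mx_id //.
    by rewrite /B map_trmx At.
  by apply/mxOverP => i j; rewrite mxE; apply/complex_realP; exists (A i j).
have dr := hermitian_spectral_diag_real Bh.
have /hermitian_normalmx/orthomx_spectralP Bsp := Bh.
have : eigenvalue B (spectral_diag B 0 0).
  apply/eigenvalueP; exists (row 0 (spectralmx B)); last first.
    apply/eqP => r0; have := spectral_unit B.
    rewrite -row_free_unit => /row_freeP[C PC].
    have := congr1 (row 0) PC; rewrite row_mul r0 mul0mx => /rowP/(_ 0).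
    by rewrite !mxE eqxx => /eqP; rewrite eq_sym oner_eq0.
  rewrite {2}Bsp -row_mul !mulmxA mulmxV ?spectral_unit // mul1mx.
  apply/rowP => j; rewrite !mxE (bigD1 0) //= big1 ?addr0.
    by rewrite !mxE eqxx mulr1n.
  by move=> i i0; rewrite !mxE eq_sym (negbTE i0) mulr0n mul0r.
have /mxOverP/(_ 0 0) := dr.
move: (spectral_diag B 0 0) => z zr.
rewrite eigenvalue_root_char -map_char_poly => rz.
exists (Re z); rewrite eigenvalue_root_char -(fmorph_root toC).
by rewrite /= RRe_real.
Qed.
End RealEigenvalue.

Lemma sqnormE n (v : 'rV[R]_n) : (v *m v^T) 0 0 = \sum_i v 0 i ^+ 2.
Proof. by rewrite mxE; apply: eq_bigr => i _; rewrite mxE expr2. Qed.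

Lemma sqnorm_eq0 n (v : 'rV[R]_n) : (v *m v^T) 0 0 = 0 -> v = 0.
Proof.
move/eqP; rewrite sqnormE psumr_eq0 => [/allP vi|i _]; last exact: sqr_ge0.
apply/rowP => i; apply/eqP; have := vi i (mem_index_enum _).
by rewrite sqrf_eq0 [in X in _ -> X]mxE.
Qed.

Lemma sqnorm_gt0 n (v : 'rV[R]_n) : v != 0 -> 0 < (v *m v^T) 0 0.
Proof.
move=> v0; rewrite lt_def; apply/andP; split.
  by apply: contra v0 => /eqP/sqnorm_eq0 ->.
by rewrite sqnormE sumr_ge0 // => i _; exact: sqr_ge0.
Qed.

(** The reflection that exchanges u and the first basis vector. It serves to move
    an eigenvector of a symmetric matrix to the first coordinate axis. *)
Lemma householder n (u : 'rV[R]_n.+1) : u *m u^T = 1%:M ->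
  exists H : 'M[R]_n.+1, [/\ H^T = H, H *m H = 1%:M & delta_mx 0 0 *m H = u].
Proof.
move=> u1; set e := delta_mx 0 0 : 'rV[R]_n.+1.
have [w wE] : exists w, w = u - e by exists (u - e).
have e1 : e *m e^T = 1%:M.
  rewrite /e trmx_delta mul_delta_mx; apply/matrixP => i j.
  by rewrite !mxE !ord1.
have eu : e *m u^T = (u 0 0)%:M.
  by apply/matrixP => i j; rewrite !ord1 -rowE !mxE eqxx mulr1n.
have ue : u *m e^T = (u 0 0)%:M.
  by rewrite -[LHS]trmxK trmx_mul trmxK eu tr_scalar_mx.
set q : R := 2 - 2 * u 0 0.
have ww : w *m w^T = q%:M.
  rewrite wE linearB /= mulmxBl !mulmxBr u1 e1 ue eu -!raddfB /=.
  by congr (_%:M); rewrite /q; ring.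
have ew : e *m w^T = (- (q / 2))%:M.
  rewrite wE linearB /= mulmxBr e1 eu -!raddfB /=.
  by congr (_%:M); rewrite /q; field.
have [q0|q0] := eqVneq q 0.
  exists 1%:M; split; rewrite ?trmx1 ?mulmx1 //.
  suff : w = 0 by rewrite wE => /eqP; rewrite subr_eq0 => /eqP.
  by apply: sqnorm_eq0; rewrite ww q0 mxE.
(* With q the squared norm of w = u - e, this is the reflection along w. *)
exists (1%:M - (2 / q) *: (w^T *m w)); split.
- by rewrite linearB /= trmx1 linearZ /= trmx_mul trmxK.
- have XX : (w^T *m w) *m (w^T *m w) = q *: (w^T *m w).
    by rewrite mulmxA -[w^T *m w *m _]mulmxA ww mul_mx_scalar -scalemxAl.
  rewrite mulmxBl mul1mx mulmxBr mulmx1 -scalemxAl -!scalemxAr XX.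
  move: (w^T *m w) => X; apply/matrixP => i j; rewrite !mxE.
  by field.
rewrite mulmxBr mulmx1 -scalemxAr mulmxA ew mul_scalar_mx scalerA.
rewrite (_ : _ * _ = -1) ?scaleN1r ?opprK; last by field.
by rewrite wE addrC subrK.
Qed.

(** Deflation: once an eigenvector is the first basis vector, symmetry makes the
    matrix block diagonal. *)
Theorem sym_spectral n (A : 'M[R]_n) : A^T = A ->
  exists (V : 'M[R]_n) (d : 'rV[R]_n),
    V *m V^T = 1%:M /\ A = V^T *m diag_mx d *m V.
Proof.
elim: n A => [|n IH] A At.
  by exists 1%:M, 0; split; apply/matrixP => -[].
have [a /eigenvalueP[v va v0]] := sym_eigenvalue At.
have vv : 0 < (v *m v^T) 0 0 := sqnorm_gt0 v0.
set c := (Num.sqrt ((v *m v^T) 0 0))^-1; pose u := c *: v.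
have u1 : u *m u^T = 1%:M.
  rewrite /u linearZ /= -scalemxAl -scalemxAr scalerA.
  apply/matrixP => i j; rewrite !ord1 mxE /c -expr2 exprVn sqr_sqrtr ?ltW //.
  by rewrite mulVf ?gt_eqF // mxE.
have ua : u *m A = a *: u by rewrite /u -scalemxAl va !scalerA mulrC.
have [H [Ht HH eH]] := householder u1.
have uH : u *m H = delta_mx 0 0 by rewrite -eH -mulmxA HH mulmx1.
have [B BE] : exists B : 'M[R]_(1 + n), B = H *m A *m H by exists (H *m A *m H).
have Bt : B^T = B by rewrite BE !trmx_mul Ht At mulmxA.
have B0 : usubmx B = row_mx a%:M 0.
  have -> : usubmx B = delta_mx 0 0 *m B.
    apply/matrixP => i j; rewrite -rowE !mxE; congr (B _ _).
    by apply/val_inj; rewrite /= !ord1.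
  rewrite BE !mulmxA eH ua -scalemxAl uH.
  apply/rowP => j; rewrite !mxE; case: splitP => k jk.
    have -> : j = 0 by apply/val_inj; rewrite /= jk ord1.
    by rewrite !mxE !ord1 eqxx /= mulr1 mulr1n.
  have -> : (j == 0) = false by apply/negbTE/eqP => j0; rewrite j0 in jk.
  by rewrite mxE andbF mulr0.
have Bul : ulsubmx B = a%:M by rewrite /ulsubmx B0 row_mxKl.
have Bur : ursubmx B = 0 by rewrite /ursubmx B0 row_mxKr.
have Bdl : dlsubmx B = 0 by rewrite -Bt -trmx_ursub Bur trmx0.
have [V [d [VV Bd]]] : exists (V : 'M[R]_n) (d : 'rV[R]_n),
    V *m V^T = 1%:M /\ drsubmx B = V^T *m diag_mx d *m V.
  by apply: IH; rewrite trmx_drsub Bt.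
have [W [D [WW WB]]] : exists (W : 'M[R]_(1 + n)) (D : 'rV[R]_(1 + n)),
    W *m W^T = 1%:M /\ B = W^T *m diag_mx D *m W.
  exists (block_mx 1%:M 0 0 V), (row_mx a%:M d); split.
    rewrite tr_block_mx mulmx_block.
    rewrite !(trmx0, trmx1, mul0mx, mulmx0, addr0, add0r, mulmx1) VV.
    by rewrite -scalar_mx_block.
  have -> : diag_mx (row_mx a%:M d) = block_mx a%:M 0 0 (diag_mx d).
    rewrite diag_mx_row; congr block_mx.
    by apply/matrixP => i j; rewrite !mxE !ord1.
  rewrite -[B]submxK Bul Bur Bdl Bd tr_block_mx !mulmx_block.
  by rewrite !(trmx0, trmx1, mul0mx, mulmx0, addr0, add0r, mulmx1, mul1mx).
have AB : A = H *m B *m H by rewrite BE !mulmxA HH mul1mx -mulmxA HH mulmx1.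
exists ((W : 'M[R]_n.+1) *m H), D; split.
  by rewrite trmx_mul Ht mulmxA -[_ *m H *m H]mulmxA HH mulmx1.
by rewrite AB WB trmx_mul Ht !mulmxA.
Qed.

End Spectral.

(** * Smoothness of the exponential *)

Section ExpBlocks.
Variable R : realType.

Lemma cvg_block_mx (T : Type) (F : set_system T) {FF : Filter F} m1 m2 n1 n2
    (a : T -> 'M[R]_(m1, n1)) (b : T -> 'M[R]_(m1, n2))
    (c : T -> 'M[R]_(m2, n1)) (d : T -> 'M[R]_(m2, n2))
    (A : 'M[R]_(m1, n1)) (B : 'M[R]_(m1, n2))
    (C : 'M[R]_(m2, n1)) (D : 'M[R]_(m2, n2)) :
  a @ F --> A -> b @ F --> B -> c @ F --> C -> d @ F --> D ->
  (fun x => block_mx (a x) (b x) (c x) (d x)) @ F --> block_mx A B C D.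
Proof.
move=> /cvg_mxP aA /cvg_mxP bB /cvg_mxP cC /cvg_mxP dD.
apply/cvg_mxP => i j; rewrite -[i]splitK -[j]splitK.
case: (fintype.split i) => i'; case: (fintype.split j) => j' /=.
- by rewrite block_mxEul; under eq_fun do rewrite block_mxEul; exact: aA.
- by rewrite block_mxEur; under eq_fun do rewrite block_mxEur; exact: bB.
- by rewrite block_mxEdl; under eq_fun do rewrite block_mxEdl; exact: cC.
- by rewrite block_mxEdr; under eq_fun do rewrite block_mxEdr; exact: dD.
Qed.

Lemma cvg_ursubmx (T : Type) (F : set_system T) {FF : Filter F} m1 m2 n1 n2
    (f : T -> 'M[R]_(m1 + m2, n1 + n2)) (A : 'M[R]_(m1 + m2, n1 + n2)) :
  f @ F --> A -> (fun x => ursubmx (f x)) @ F --> ursubmx A.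
Proof.
move=> /cvg_mxP fA; apply/cvg_mxP => i j; rewrite !mxE.
by under eq_fun do rewrite !mxE; exact: fA.
Qed.

(** The upper right block is the sum of the X^p Z Y^q / (p + q + 1)!, that is, the
    divided difference of exp at X and Y applied to Z. *)
Definition divdiff_exp m n (X : 'M[R]_m) (Z : 'M[R]_(m, n)) (Y : 'M[R]_n) :=
  ursubmx (expmx (block_mx X Z 0 Y)).

(** The diagonal blocks come from the intertwiners (0 1) and its transpose (1 0). *)
Lemma expmx_block m n (X : 'M[R]_m) (Z : 'M[R]_(m, n)) (Y : 'M[R]_n) :
  expmx (block_mx X Z 0 Y) = block_mx (expmx X) (divdiff_exp X Z Y) 0 (expmx Y).
Proof.
set E := expmx (block_mx X Z 0 Y).
have := @expmx_intertwine R _ _ Y (block_mx X Z 0 Y) (row_mx 0 1%:M).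
rewrite mul_row_block !mul_mx_row !(mulmx0, mul0mx, mul1mx, mulmx1, addr0, add0r).
move=> /(_ erefl); rewrite -/E -[E]submxK mul_row_block.
rewrite !(mul0mx, mul1mx, add0r) => /eq_row_mx[dl dr].
have := @expmx_intertwine R _ _ (block_mx X Z 0 Y) X (col_mx 1%:M 0).
rewrite mul_block_col !mul_col_mx !(mulmx0, mul0mx, mul1mx, mulmx1, addr0, add0r).
move=> /(_ erefl); rewrite -/E -[E in E *m _]submxK mul_block_col.
rewrite !(mulmx0, mulmx1, addr0) => /eq_col_mx[ul _].
by rewrite ul -dl -dr.
Qed.

(** The row (1 1) intertwines X with the block matrix of diagonal X, Y and upper
    right block X - Y. *)
Lemma expmxB n (X Y : 'M[R]_n) : expmx X - expmx Y = divdiff_exp X (X - Y) Y.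
Proof.
have := @expmx_intertwine R _ _ X (block_mx X (X - Y) 0 Y) (row_mx 1%:M 1%:M).
rewrite mul_row_block !mul_mx_row !(mulmx0, mul0mx, mul1mx, mulmx1, addr0, add0r).
rewrite subrK => /(_ erefl); rewrite expmx_block mul_row_block.
by rewrite !(mul1mx, addr0) => /eq_row_mx[_ ->]; rewrite addrK.
Qed.

(** By the intertwiner with diagonal blocks c and 1. *)
Lemma divdiff_expZ m n (X : 'M[R]_m) (Z : 'M[R]_(m, n)) (Y : 'M[R]_n) (c : R) :
  divdiff_exp X (c *: Z) Y = c *: divdiff_exp X Z Y.
Proof.
have := @expmx_intertwine R _ _ (block_mx X (c *: Z) 0 Y) (block_mx X Z 0 Y)
  (block_mx c%:M 0 0 1%:M).
rewrite !mulmx_block !(mulmx0, mul0mx, mul1mx, mulmx1, addr0, add0r).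
rewrite mul_mx_scalar !mul_scalar_mx => /(_ erefl).
rewrite !expmx_block !mulmx_block !(mulmx0, mul0mx, mul1mx, mulmx1, addr0, add0r).
by rewrite !mul_scalar_mx => /eq_block_mx[_ ->].
Qed.

Lemma cvg_divdiff_exp (T : Type) (F : set_system T) {FF : Filter F} m n
    (f : T -> 'M[R]_m) (g : T -> 'M[R]_(m, n)) (h : T -> 'M[R]_n)
    (X : 'M[R]_m) (Z : 'M[R]_(m, n)) (Y : 'M[R]_n) :
  f @ F --> X -> g @ F --> Z -> h @ F --> Y ->
  (fun x => divdiff_exp (f x) (g x) (h x)) @ F --> divdiff_exp X Z Y.
Proof.
move=> fX gZ hY; apply: cvg_ursubmx; apply: cvg_expmx.
by apply: cvg_block_mx => //; exact: cvg_cst.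
Qed.

Section Ck.
Variables (E : normedModType R) (V U : set E).
Hypothesis oU : open_along V U.

Lemma Ck_on_ursubmx k m1 m2 n1 n2 (f : E -> 'M[R]_(m1 + m2, n1 + n2)) :
  Ck_on k V U f -> Ck_on k V U (fun x => ursubmx (f x)).
Proof.
move=> /(Ck_on_mxP oU) fC; apply/(Ck_on_mxP oU) => i j.
by under eq_fun do rewrite !mxE; exact: fC.
Qed.

(** By expmxB the difference quotient of exp is a divided difference, which is
    continuous. The derivative is a block of the exponential of a larger matrix,
    so the induction on k covers all sizes at once. *)
Lemma Ck_on_expmx k n (f : E -> 'M[R]_n) :
  Ck_on k V U f -> Ck_on k V U (fun x => expmx (f x)).
Proof.
have C0 m (g : E -> 'M[R]_m) : Ck_on 0 V U g -> Ck_on 0 V U (fun x => expmx (g x)).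
  by move=> gC; apply: Ck_on0 => x Ux; apply: cvg_expmx; exact: (Ck_on_continuous gC).
elim: k n f => [|k IH] n f fC; first exact: C0.
apply: (Ck_onS oU) => [|v Vv]; first by apply: C0; case: fC => fc _; split.
have [fd fdC] := Ck_onD1 fC Vv.
exists (fun x => divdiff_exp (f x) ('D_v f x) (f x)); split.
  move=> x Ux; apply/is_derive_quotientP.
  under eq_fun do rewrite expmxB -divdiff_expZ.
  apply: cvg_divdiff_exp; [exact: (Ck_on_cvg_along oU fC)| |exact: cvg_cst].
  exact/is_derive_quotientP/fd.
apply: Ck_on_ursubmx; apply: IH; have fCk := Ck_onW fC.
by apply: (Ck_on_block_mx oU) => //; exact: (Ck_on_cst oU).
Qed.

End Ck.
End ExpBlocks.

(** * Functions of symmetric matrices in spectral form *)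

Section SpectralForm.
Variable R : realType.

(** For orthogonal V, the rows of V are eigenvectors with eigenvalues d; all
    functions of symmetric matrices are computed in this form. *)
Definition spmx n (V : 'M[R]_n) (d : 'rV[R]_n) : 'M[R]_n :=
  V^T *m diag_mx d *m V.

Lemma spmx_tr n (V : 'M[R]_n) d : (spmx V d)^T = spmx V d.
Proof. by rewrite /spmx !trmx_mul trmxK tr_diag_mx mulmxA. Qed.

Lemma spmxD n (V : 'M[R]_n) d e : spmx V d + spmx V e = spmx V (d + e).
Proof. by rewrite /spmx linearD /= mulmxDr mulmxDl. Qed.

Lemma spmxZ n (V : 'M[R]_n) c d : c *: spmx V d = spmx V (c *: d).
Proof. by rewrite /spmx linearZ /= -scalemxAr -scalemxAl. Qed.

Lemma spmxN n (V : 'M[R]_n) d : - spmx V d = spmx V (- d).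
Proof. by rewrite -scaleN1r spmxZ scaleN1r. Qed.

Section Orthogonal.
Variables (n : nat) (V : 'M[R]_n).
Hypothesis VV : V *m V^T = 1%:M.

Let VtV : V^T *m V = 1%:M. Proof. exact: mulmx1C. Qed.

Lemma mul_spmx d : V *m spmx V d = diag_mx d *m V.
Proof. by rewrite /spmx !mulmxA VV mul1mx. Qed.

Lemma spmxM d e : spmx V d *m spmx V e = spmx V (\row_i (d 0 i * e 0 i)).
Proof.
rewrite {1}/spmx -mulmxA mul_spmx /spmx !mulmxA; congr (_ *m _).
by rewrite -mulmxA mulmx_diag.
Qed.

Lemma spmx_cst c : spmx V (const_mx c) = c%:M.
Proof. by rewrite /spmx diag_const_mx mul_mx_scalar -scalemxAl VtV scalemx1. Qed.

Lemma char_poly_spmx d : char_poly (spmx V d) = \prod_i ('X - (d 0 i)%:P).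
Proof.
rewrite /char_poly; set P := map_mx polyC V.
have PP : P *m P^T = 1%:M by rewrite /P map_trmx -map_mxM VV map_mx1.
have -> : char_poly_mx (spmx V d) = P^T *m char_poly_mx (diag_mx d) *m P.
  rewrite /char_poly_mx mulmxBr mulmxBl mul_mx_scalar -scalemxAl.
  by rewrite (mulmx1C PP) scalemx1 /spmx !map_mxM -map_trmx.
rewrite !det_mulmx mulrAC -det_mulmx (mulmx1C PP) det1 mul1r.
have -> : char_poly_mx (diag_mx d) = diag_mx (\row_i ('X - (d 0 i)%:P)).
  apply/matrixP => i j; rewrite !mxE; case: eqP => _; rewrite ?mulr1n //.
  by rewrite !mulr0n polyC0 subrr.
by rewrite det_diag; apply: eq_bigr => i _; rewrite mxE.
Qed.

Lemma quad_spmx d (x : 'rV[R]_n) :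
  (x *m spmx V d *m x^T) 0 0 = \sum_i d 0 i * ((x *m V^T) 0 i) ^+ 2.
Proof.
have -> : x *m spmx V d *m x^T = (x *m V^T) *m diag_mx d *m (x *m V^T)^T.
  by rewrite /spmx trmx_mul trmxK !mulmxA.
move: (x *m V^T) => y; rewrite mul_mx_diag mxE; apply: eq_bigr => i _.
by rewrite !mxE; ring.
Qed.

(** The rows of V realize the eigenvalues as values of the quadratic form. *)
Lemma SymPos_spmx d : SymPos (spmx V d) <-> forall i, 0 < d 0 i.
Proof.
split=> [[_ pos] i|pos].
  have := pos (row i V); rewrite quad_spmx.
  have rV : row i V *m V^T = delta_mx 0 i.
    by rewrite -row_mul VV; apply/rowP => j; rewrite !mxE eqxx eq_sym.
  rewrite rV (bigD1 i) //= big1 ?addr0 => [|j ji].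
    rewrite !mxE !eqxx expr1n mulr1; apply; apply/eqP => r0.
    by move/rowP/(_ i): rV; rewrite r0 mul0mx !mxE !eqxx => /eqP; rewrite eq_sym oner_eq0.
  by rewrite !mxE (negbTE ji) expr0n mulr0.
split; first exact/SymE/spmx_tr.
move=> x x0; rewrite quad_spmx.
have y0 : x *m V^T != 0.
  by apply: contra x0 => /eqP y0; rewrite -[x]mulmx1 -VtV mulmxA y0 mul0mx.
have s0 i : 0 <= d 0 i * ((x *m V^T) 0 i) ^+ 2 by rewrite mulr_ge0 ?sqr_ge0 ?ltW.
rewrite lt_def sumr_ge0 // andbT; apply: contra y0; rewrite psumr_eq0 //.
move=> /allP h; apply/eqP/rowP => i; apply/eqP; have := h i (mem_index_enum _).
by rewrite mulf_eq0 gt_eqF //= sqrf_eq0 => /eqP ->; rewrite [X in _ == X]mxE.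
Qed.

End Orthogonal.

(** In eigenbases the Sylvester operator is entrywise multiplication by the
    differences of the eigenvalues. *)
Lemma spmx_diff m (V : 'M[R]_m) n (W : 'M[R]_n) d e (Z : 'M[R]_(m, n)) i j :
  V *m V^T = 1%:M -> W *m W^T = 1%:M ->
  (V *m (spmx V d *m Z - Z *m spmx W e) *m W^T) i j
  = (d 0 i - e 0 j) * (V *m Z *m W^T) i j.
Proof.
move=> VV WW; rewrite mulmxBr mulmxBl.
have -> : V *m (spmx V d *m Z) *m W^T = diag_mx d *m (V *m Z *m W^T).
  by rewrite mulmxA mul_spmx // !mulmxA.
have -> : V *m (Z *m spmx W e) *m W^T = (V *m Z *m W^T) *m diag_mx e.
  by rewrite /spmx -!mulmxA WW mulmx1.
by move: (V *m Z *m W^T) => M; rewrite mul_diag_mx mul_mx_diag !mxE; ring.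
Qed.

Lemma spmx_diff1 n (V W : 'M[R]_n) (d e : 'rV[R]_n) i j :
  V *m V^T = 1%:M -> W *m W^T = 1%:M ->
  (V *m (spmx V d - spmx W e) *m W^T) i j = (d 0 i - e 0 j) * (V *m W^T) i j.
Proof.
by move=> VV WW; have := @spmx_diff n V n W d e 1%:M i j VV WW; rewrite !mulmx1 mul1mx.
Qed.

(** Since the intertwiners may be rectangular, such a family acts on spectral forms
    through its 1 x 1 case; see natural_spmx. *)
Definition natural_mx (F : forall n, 'M[R]_n -> 'M[R]_n) : Prop :=
  forall m n (A : 'M[R]_m) (B : 'M[R]_n) (T : 'M[R]_(m, n)),
    A *m T = T *m B -> F m A *m T = T *m F n B.

(** The row delta_mx 0 i intertwines a 1 x 1 matrix with a diagonal one. *)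
Lemma natural_mx_diag F n (d : 'rV[R]_n) : natural_mx F ->
  F n (diag_mx d) = diag_mx (\row_i F 1%N (d 0 i)%:M 0 0).
Proof.
move=> nat; apply/row_matrixP => i.
have := nat 1%N n (d 0 i)%:M (diag_mx d) (delta_mx 0 i).
rewrite mul_scalar_mx -rowE row_diag_mx => /(_ erefl).
rewrite -rowE => <-; rewrite row_diag_mx mxE.
by rewrite -mul_scalar_mx -mx11_scalar.
Qed.

Lemma natural_spmx F n (V : 'M[R]_n) d : natural_mx F -> V *m V^T = 1%:M ->
  F n (spmx V d) = spmx V (\row_i F 1%N (d 0 i)%:M 0 0).
Proof.
move=> nat VV; have := nat n n (diag_mx d) (spmx V d) V.
rewrite mul_spmx // => /(_ erefl); rewrite natural_mx_diag // => e.
by rewrite [RHS]/spmx -mulmxA e mulmxA (mulmx1C VV) mul1mx.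
Qed.

Lemma expmx_natural : natural_mx (@expmx R).
Proof. by move=> m n A B T; exact: expmx_intertwine. Qed.

Lemma expmx11 (a : R) : expmx (a%:M : 'M[R]_1) 0 0 = expR a.
Proof.
have /cvg_mxP/(_ 0 0) := @expmx_cvg R 1 a%:M.
have ce : series (exp_coeff a) @ \oo --> expR a := @is_cvg_series_exp_coeff R a.
suff -> : (fun x => series (fun k : nat => k`!%:R^-1 *: (a%:M : 'M[R]_1) ^+ k) x 0 0)
    = series (exp_coeff a) by move=> h; exact: (cvg_unique _ h ce).
apply/funext => k; rewrite /series /= summxE; apply: eq_bigr => i _.
rewrite exp_coeffE mxE; congr (_ * _).
elim: i => [|i IH]; first by rewrite !expr0 mxE eqxx.
by rewrite !exprS mxE big_ord1 IH mxE eqxx mulr1n.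
Qed.

Lemma expmx_spmx n (V : 'M[R]_n) d : V *m V^T = 1%:M ->
  expmx (spmx V d) = spmx V (map_mx expR d).
Proof.
move=> VV; rewrite (@natural_spmx (@expmx R) _ _ _ expmx_natural VV).
by apply: (congr1 (spmx V)); apply/rowP => i; rewrite [RHS]mxE [LHS]mxE expmx11.
Qed.

Lemma expmx0 n : expmx (0 : 'M[R]_n) = 1%:M.
Proof.
have V1 : (1%:M : 'M[R]_n) *m 1%:M^T = 1%:M by rewrite trmx1 mulmx1.
have <- : spmx (1%:M : 'M[R]_n) (const_mx 0) = 0 by rewrite spmx_cst // raddf0.
rewrite expmx_spmx // -[RHS](spmx_cst V1 1); congr (spmx _ _); apply/rowP => i.
by rewrite !mxE expR0.
Qed.

(** The entire function (exp z - 1) / z of a matrix. *)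
Definition phimx n (Z : 'M[R]_n) : 'M[R]_n := divdiff_exp Z 1%:M 0.

Lemma phimx_natural : natural_mx phimx.
Proof.
move=> m n A B T AT.
have := @expmx_intertwine R _ _ (block_mx A 1%:M 0 0) (block_mx B 1%:M 0 0)
  (block_mx T 0 0 T).
rewrite !mulmx_block !(mulmx0, mul0mx, mul1mx, mulmx1, addr0, add0r) AT.
move=> /(_ erefl); rewrite !expmx_block !mulmx_block.
by rewrite !(mulmx0, mul0mx, mul1mx, mulmx1, addr0, add0r) => /eq_block_mx[].
Qed.

Lemma phimxM n (Z : 'M[R]_n) : phimx Z *m Z = expmx Z - 1%:M.
Proof.
rewrite -(expmx0 n) expmxB subr0.
have := @expmx_intertwine R _ _ (block_mx Z 1%:M 0 0) (block_mx Z Z 0 0)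
  (block_mx 1%:M 0 0 Z).
rewrite !mulmx_block !(mulmx0, mul0mx, mul1mx, mulmx1, addr0, add0r).
move=> /(_ erefl); rewrite !expmx_block !mulmx_block.
by rewrite !(mulmx0, mul0mx, mul1mx, mulmx1, addr0, add0r) => /eq_block_mx[].
Qed.

Definition phi (z : R) : R := phimx (z%:M : 'M[R]_1) 0 0.

Lemma phiM z : phi z * z = expR z - 1.
Proof.
have /matrixP/(_ 0 0) := phimxM (z%:M : 'M[R]_1).
rewrite mul_mx_scalar mxE mulrC -/(phi z) => ->.
by rewrite mxE expmx11 !mxE eqxx.
Qed.

(** The value at 0 is the limit of (exp h - 1) / h, by continuity of phimx. *)
Lemma phi0 : phi 0 = 1.
Proof.
have l1 : (fun h : R => phi h) @ 0^' --> phi 0.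
  have fc : (fun h : R => h%:M : 'M[R]_1) @ 0^' --> (0%:M : 'M[R]_1).
    apply/cvg_mxP => i j; rewrite !ord1 mxE eqxx mulr1n.
    by under eq_fun do rewrite mxE eqxx mulr1n; exact: nbhs_dnbhs.
  have : (fun h : R => phimx (h%:M : 'M[R]_1)) @ 0^' --> phimx (0%:M : 'M[R]_1).
    by apply: cvg_divdiff_exp; [exact: fc|exact: cvg_cst|exact: cvg_cst].
  by move=> /cvg_mxP; exact.
have l2 : (fun h : R => phi h) @ 0^' --> (1 : R).
  have /is_derive_quotientP := @is_derive_expR R 0.
  rewrite expR0; apply: cvg_trans; apply: near_eq_cvg.
  near=> h; rewrite addr0 /GRing.scale /= mulr1 -phiM mulrC mulfK //.
  by near: h; exact: nbhs_dnbhs_neq.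
exact: (cvg_unique _ l1 l2).
Unshelve. all: by end_near. Qed.

Lemma phi_gt0 z : 0 < phi z.
Proof.
have [->|z0] := eqVneq z 0; first by rewrite phi0.
have -> : phi z = (expR z - 1) / z by rewrite -phiM mulfK.
have [zp|zn] := ltP 0 z; first by rewrite divr_gt0 // subr_gt0 expR_gt1.
have zl : z < 0 by rewrite lt_neqAle z0.
by rewrite -[_ / _]mulrNN -invrN mulr_gt0 ?invr_gt0 ?oppr_gt0 // subr_lt0 expR_lt1.
Qed.

(** The divided difference (exp x - exp y) / (x - y), with value exp x on the
    diagonal. *)
Definition expdd (x y : R) : R := expR y * phi (x - y).

Lemma expddM x y : expdd x y * (x - y) = expR x - expR y.
Proof. by rewrite /expdd -mulrA phiM mulrBr -expRD mulr1 [y + _]addrC subrK. Qed.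

Lemma expdd_gt0 x y : 0 < expdd x y.
Proof. by rewrite mulr_gt0 ?expR_gt0 ?phi_gt0. Qed.

Lemma expddxx x : expdd x x = expR x.
Proof. by rewrite /expdd subrr phi0 mulr1. Qed.

Lemma expdd_neq x y : x != y -> expdd x y = (expR x - expR y) / (x - y).
Proof. by move=> xy; rewrite -expddM mulfK // subr_eq0. Qed.

Lemma expddC x y : expdd x y = expdd y x.
Proof.
have [->//|xy] := eqVneq x y.
rewrite !expdd_neq // 1?eq_sym // -[in LHS](opprB y x) -(opprB (expR y)).
by rewrite invrN mulrNN.
Qed.

Lemma phimx_spmx n (V : 'M[R]_n) d : V *m V^T = 1%:M ->
  phimx (spmx V d) = spmx V (map_mx phi d).
Proof.
move=> VV; rewrite (@natural_spmx (@phimx) _ _ _ phimx_natural VV).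
by apply: (congr1 (spmx V)); apply/rowP => i; rewrite [RHS]mxE [LHS]mxE.
Qed.

Lemma sym_spmxP n (A : 'M[R]_n) : A^T = A ->
  exists V d, V *m V^T = 1%:M /\ A = spmx V d.
Proof. exact: sym_spectral. Qed.

Lemma SymPos_spmxP n (A : 'M[R]_n) : SymPos A ->
  exists V d, [/\ V *m V^T = 1%:M, A = spmx V d & forall i, 0 < d 0 i].
Proof.
move=> Apos; have [/SymE/sym_spmxP[V [d [VV Ad]]] _] := Apos.
by exists V, d; split=> //; apply/(SymPos_spmx VV); rewrite -Ad.
Qed.

Lemma expmx_sym n (A : 'M[R]_n) : A^T = A -> (expmx A)^T = expmx A.
Proof.
by move=> /sym_spmxP[V [d [VV ->]]]; rewrite expmx_spmx // spmx_tr.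
Qed.

Lemma SymPos_expmx n (A : 'M[R]_n) : A^T = A -> SymPos (expmx A).
Proof.
move=> /sym_spmxP[V [d [VV ->]]]; rewrite expmx_spmx //.
by apply/(SymPos_spmx VV) => i; rewrite mxE expR_gt0.
Qed.

Lemma orthJ_eq0 m n (V : 'M[R]_m) (W : 'M[R]_n) (Z : 'M[R]_(m, n)) :
  V *m V^T = 1%:M -> W *m W^T = 1%:M -> V *m Z *m W^T = 0 -> Z = 0.
Proof.
move=> VV WW e; have := congr1 (fun X => V^T *m X *m W) e => /=.
by rewrite !mulmxA (mulmx1C VV) mul1mx -mulmxA (mulmx1C WW) mulmx1 mulmx0 mul0mx.
Qed.

(** In eigenbases of A and B, the entries of A - B and of exp A - exp B vanish
    together because the scalar exponential is injective. *)
Lemma expmx_sym_inj n (A B : 'M[R]_n) : A^T = A -> B^T = B ->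
  expmx A = expmx B -> A = B.
Proof.
move=> /sym_spmxP[V [d [VV Ad]]] /sym_spmxP[W [e [WW Be]]] eAB.
apply/eqP; rewrite -subr_eq0; apply/eqP; apply: (orthJ_eq0 VV WW).
apply/matrixP => i j; rewrite [RHS]mxE.
have /matrixP/(_ i j) : V *m (expmx A - expmx B) *m W^T = 0.
  by rewrite eAB subrr mulmx0 mul0mx.
rewrite Ad Be !expmx_spmx // !spmx_diff1 // [RHS]mxE => /eqP.
rewrite [map_mx _ d 0 i]mxE [map_mx _ e 0 j]mxE mulf_eq0 subr_eq0 (inj_eq (@expR_inj R)).
by case/orP=> /eqP ->; rewrite ?subrr ?mul0r ?mulr0.
Qed.

(** On positive definite matrices the choice is unique by expmx_sym_inj; the
    value 0 elsewhere is a default. *)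
Definition logmx n (M : 'M[R]_n) : 'M[R]_n :=
  xget 0 [set L | L^T = L /\ expmx L = M].

Lemma logmxK n (M : 'M[R]_n) : SymPos M ->
  (logmx M)^T = logmx M /\ expmx (logmx M) = M.
Proof.
move=> /SymPos_spmxP[V [d [VV Md d0]]].
rewrite /logmx; apply: (@xgetPex _ 0 [set L | L^T = L /\ expmx L = M]).
exists (spmx V (map_mx (@ln R) d)); split; first exact: spmx_tr.
rewrite expmx_spmx // Md; congr spmx; apply/rowP => i.
by rewrite !mxE lnK // posrE.
Qed.

Lemma expmxK n (A : 'M[R]_n) : A^T = A -> logmx (expmx A) = A.
Proof.
move=> At; have [lt le] := logmxK (SymPos_expmx At).
exact: expmx_sym_inj le.
Qed.

Lemma logmx_spmx n (V : 'M[R]_n) (d : 'rV[R]_n) : V *m V^T = 1%:M -> (forall i, 0 < d 0 i) ->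
  logmx (spmx V d) = spmx V (map_mx (@ln R) d).
Proof.
move=> VV d0; rewrite -[RHS]expmxK ?spmx_tr // expmx_spmx //; congr (logmx (spmx _ _)).
by apply/rowP => i; rewrite !mxE lnK // posrE.
Qed.

End SpectralForm.

(** * Continuity of the logarithm *)

Section LogContinuity.
Variable R : realType.

Lemma orth_row n (V : 'M[R]_n) i : V *m V^T = 1%:M ->
  \sum_j V i j ^+ 2 = 1.
Proof.
move=> /matrixP/(_ i i); rewrite mxE [RHS]mxE eqxx mulr1n => <-.
by apply: eq_bigr => j _; rewrite mxE expr2.
Qed.

Lemma orth_entry_le1 n (V : 'M[R]_n) i j : V *m V^T = 1%:M -> `|V i j| <= 1.
Proof.
move=> VV; rewrite -(@expr_le1 _ 2) // -normrX ger0_norm ?sqr_ge0 //.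
rewrite -(orth_row i VV) (bigD1 j) //=.
by rewrite lerDl sumr_ge0 // => k _; exact: sqr_ge0.
Qed.

Lemma orth_norm_le1 n (V : 'M[R]_n) : V *m V^T = 1%:M -> `|V| <= 1.
Proof. by move=> VV; apply: mx_norm_leP => // i j; exact: orth_entry_le1. Qed.

Lemma orth_norm_le n (V W Z : 'M[R]_n) :
  V *m V^T = 1%:M -> W *m W^T = 1%:M -> `|V *m Z *m W^T| <= (n * n)%:R * `|Z|.
Proof.
move=> VV WW; apply: le_trans (mx_norm_mul _ _) _.
have W1 : `|W^T| <= 1 by apply: orth_norm_le1; rewrite trmxK; exact: mulmx1C.
apply: le_trans (_ : n%:R * `|V *m Z| * 1 <= _); first by rewrite ler_wpM2l ?mulr_ge0.
rewrite mulr1 natrM -mulrA ler_wpM2l //; apply: le_trans (mx_norm_mul _ _) _.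
by rewrite -mulrA ler_wpM2l // ler_piMl // orth_norm_le1.
Qed.

(** A lower bound for the spectrum that holds near M: an eigenvalue of N is the
    value of the quadratic form of N at a unit vector. *)
Lemma SymPos_eigen_lb n (M : 'M[R]_n) : SymPos M ->
  exists2 c : R, 0 < c & forall V d, V *m V^T = 1%:M ->
    (n * n)%:R * `|spmx V d - M| <= c -> forall i, c <= d 0 i.
Proof.
move=> /SymPos_spmxP[W [b [WW Mb b0]]].
have [c c0 cb] : exists2 c : R, 0 < c & forall j, 2 * c <= b 0 j.
  exists ((\big[Num.min/1]_j b 0 j) / 2).
    rewrite divr_gt0 //; elim/big_ind: _ => // x y x0 y0; by rewrite lt_min x0 y0.
  by move=> j; rewrite mulrC divfK //; exact: bigmin_le.
(* Here 2 * c bounds the spectrum of M below, and the perturbation costs c. *)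
exists c => // V d VV dM i.
have rV : row i V *m V^T = delta_mx 0 i.
  by rewrite -row_mul VV; apply/rowP => j; rewrite !mxE eqxx eq_sym.
have dE : d 0 i = (row i V *m M *m (row i V)^T) 0 0
    + (V *m (spmx V d - M) *m V^T) i i.
  have -> : (V *m (spmx V d - M) *m V^T) i i
      = (row i V *m (spmx V d - M) *m (row i V)^T) 0 0.
    rewrite -row_mul; move: (V *m _) => X; rewrite mxE [RHS]mxE.
    by apply: eq_bigr => j _; rewrite !mxE.
  have e1 : (row i V *m spmx V d *m (row i V)^T) 0 0 = d 0 i.
    rewrite quad_spmx // rV (bigD1 i) //= big1 ?addr0 => [|j ji].
      by rewrite !mxE !eqxx expr1n mulr1.
    by rewrite !mxE (negbTE ji) expr0n mulr0.
  rewrite -[LHS]e1 -{1}[spmx V d](subrK M) [_ - M + M]addrC.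
  by rewrite mulmxDr mulmxDl [LHS]mxE.
have h1 : 2 * c <= (row i V *m M *m (row i V)^T) 0 0.
  rewrite Mb quad_spmx //.
  have -> : 2 * c = \sum_j 2 * c * ((row i V *m W^T) 0 j) ^+ 2.
    rewrite -mulr_sumr -sqnormE trmx_mul trmxK mulmxA -[_ *m _ *m W]mulmxA.
    rewrite (mulmx1C WW) mulmx1 sqnormE.
    under eq_bigr do rewrite mxE.
    by rewrite orth_row // mulr1.
  by apply: ler_sum => j _; rewrite ler_wpM2r ?sqr_ge0.
have h2 : `|(V *m (spmx V d - M) *m V^T) i i| <= c.
  apply: le_trans (mx_norm_entry _ _ _) _; apply: le_trans dM.
  exact: orth_norm_le.
rewrite dE; move: h1 h2; move: (_ i i) => x; rewrite ler_norml => h1 /andP[h2 _].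
lra.
Qed.

Lemma SymPos_open n (M : 'M[R]_n) : SymPos M ->
  \forall N \near M, N^T = N -> SymPos N.
Proof.
move=> /SymPos_eigen_lb[c c0 lb].
have e0 : 0 < c / ((n * n).+1)%:R by rewrite divr_gt0.
have /cvgrPdist_le/(_ _ e0) := @cvg_id _ (nbhs M).
apply: filterS => N MN /sym_spmxP[V [d [VV Nd]]]; rewrite Nd.
apply/(SymPos_spmx VV) => i.
apply: lt_le_trans c0 (lb V d VV _ i); rewrite -Nd.
apply: le_trans (_ : ((n * n).+1)%:R * `|N - M| <= _).
  by rewrite ler_wpM2r // ler_nat.
by rewrite mulrC -ler_pdivlMr // distrC.
Qed.

(** From ln u <= u - 1 at u = x / y. *)
Lemma ln_lipschitz (c x y : R) : 0 < c -> c <= x -> c <= y ->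
  c * `|ln x - ln y| <= `|x - y|.
Proof.
move=> c0; wlog xy : x y / y <= x => [hw cx cy|cx cy].
  have [/hw|/ltW/hw] := leP y x; first exact.
  by move=> h; rewrite distrC [`|x - y|]distrC; exact: h.
have [x0 y0] : 0 < x /\ 0 < y by split; apply: lt_le_trans c0 _.
have lxy : ln y <= ln x by rewrite ler_ln // posrE.
rewrite !ger0_norm ?subr_ge0 // -ln_div ?posrE //.
have : ln (x / y) <= x / y - 1.
  have := @expR_ge1Dx R (ln (x / y)).
  by rewrite lnK ?posrE ?divr_gt0 // lerBrDl.
move=> h; apply: le_trans (_ : y * (x / y - 1) <= _); last first.
  by rewrite mulrBr mulrC divfK ?gt_eqF // mulr1.
apply: ler_pM => //; first exact: ltW.
by rewrite ln_ge0 // ler_pdivlMr // mul1r.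
Qed.

(** In eigenbases of f x and M, the entries of the difference of the logarithms
    are at most c^-1 times those of f x - M, where c bounds both spectra below.
    So the logarithm is continuous although eigenbases are not. *)
Lemma cvg_logmx (T : Type) (F : set_system T) {FF : Filter F} n
    (f : T -> 'M[R]_n) (M : 'M[R]_n) :
  f @ F --> M -> SymPos M -> (\forall x \near F, SymPos (f x)) ->
  (fun x => logmx (f x)) @ F --> logmx M.
Proof.
move=> fM Mpos fpos.
have [c c0 lb] := SymPos_eigen_lb Mpos.
have [W [b [WW Mb b0]]] := SymPos_spmxP Mpos.
have cb j : c <= b 0 j.
  by apply: (lb W b WW) => //; rewrite -Mb subrr normr0 mulr0 ltW.
set K : R := (n * n).+1%:R; have K0 : 0 < K by [].
have K1 : (n * n)%:R <= K by rewrite ler_nat.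
apply/cvgrPdist_le => e e0; near=> x.
have [V [d [VV fd d0]]] : exists V d, [/\ V *m V^T = 1%:M, f x = spmx V d & forall i, 0 < d 0 i].
  by apply: SymPos_spmxP; near: x.
have dist : `|M - f x| <= Num.min (c / K) (e * c / (K * K)).
  near: x; move/cvgrPdist_le: fM; apply.
  by rewrite lt_min !divr_gt0 ?mulr_gt0.
have cd i : c <= d 0 i.
  apply: (lb V d VV); rewrite -fd distrC.
  apply: le_trans (_ : K * `|M - f x| <= _); first by rewrite ler_wpM2r.
  rewrite mulrC -ler_pdivlMr //; apply: le_trans dist _.
  by rewrite ge_min lexx.
rewrite distrC; set D := logmx (f x) - logmx M.
have -> : D = V^T *m (V *m D *m W^T) *m W^T^T.
  by rewrite trmxK !mulmxA (mulmx1C VV) mul1mx -mulmxA (mulmx1C WW) mulmx1.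
have VtV : V^T *m V^T^T = 1%:M by rewrite trmxK; exact: mulmx1C.
have WtW : W^T *m W^T^T = 1%:M by rewrite trmxK; exact: mulmx1C.
apply: le_trans (orth_norm_le _ VtV WtW) _.
apply: le_trans (_ : K * (c^-1 * (K * `|M - f x|)) <= _).
  apply: ler_pM => //; apply: mx_norm_leP => [|i j].
    by apply: mulr_ge0; [rewrite invr_ge0 ltW | apply: mulr_ge0; first exact: ltW].
  rewrite ler_pdivlMl //.
  apply: le_trans (_ : `|(V *m (f x - M) *m W^T) i j| <= _).
    rewrite /D fd Mb !logmx_spmx // !spmx_diff1 // !normrM mulrA.
    by rewrite ler_wpM2r // [map_mx _ d 0 i]mxE [map_mx _ b 0 j]mxE ln_lipschitz.
  apply: le_trans (mx_norm_entry _ _ _) _.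
  apply: le_trans (orth_norm_le _ VV WW) _.
  by rewrite distrC ler_wpM2r.
have -> : K * (c^-1 * (K * `|M - f x|)) = `|M - f x| * (K * K) / c by field; rewrite gt_eqF.
rewrite ler_pdivrMr // -ler_pdivlMr ?mulr_gt0 //.
by apply: le_trans dist _; rewrite ge_min lexx orbT.
Unshelve. all: by end_near. Qed.

End LogContinuity.

(** * The divided difference of exp as a matrix, and smoothness of the logarithm *)

Local Notation "A *t B" := (tensmx A B)
  (at level 40, left associativity, format "A  *t  B").

Section Tensor.
Variable R : realType.

Lemma mxtens_index_bij m n : bijective (@mxtens_index m n).
Proof. by exists (@mxtens_unindex m n); [exact: mxtens_indexK | exact: mxtens_unindexK]. Qed.

Lemma big_mxtens (m n : nat) (f : 'I_(m * n) -> R) :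
  \sum_k f k = \sum_i \sum_j f (mxtens_index (i, j)).
Proof.
rewrite (reindex _ (onW_bij _ (@mxtens_index_bij m n))) /= pair_bigA /=.
by apply: eq_bigr => -[].
Qed.

Lemma tensmx11 m n : (1%:M : 'M[R]_m) *t (1%:M : 'M[R]_n) = 1%:M.
Proof.
apply/matrixP => a b; case: (mxtens_indexP a) => i j; case: (mxtens_indexP b) => k l.
rewrite tensmxE !mxE -natrM mulnb; congr ((nat_of_bool _)%:R).
by rewrite (can_eq (@mxtens_indexK m n)) xpair_eqE.
Qed.

Lemma tens_orth m n (V : 'M[R]_m) (W : 'M[R]_n) :
  V *m V^T = 1%:M -> W *m W^T = 1%:M -> (V *t W) *m (V *t W)^T = 1%:M.
Proof. by move=> VV WW; rewrite trmx_tens tensmx_mul VV WW tensmx11. Qed.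

Lemma tens_spmx m n (V : 'M[R]_m) (W : 'M[R]_n) d e :
  spmx V d *t spmx W e = spmx (V *t W)
    (\row_k (d 0 (mxtens_unindex k).1 * e 0 (mxtens_unindex k).2)).
Proof.
rewrite /spmx trmx_tens -!tensmx_mul; congr (_ *m _ *m _).
apply/matrixP => a b; case: (mxtens_indexP a) => i j; case: (mxtens_indexP b) => k l.
rewrite tensmxE !mxE (can_eq (@mxtens_indexK m n)) xpair_eqE mxtens_indexK /=.
by case: eqP => _; case: eqP => _ /=; rewrite ?mulr1n ?mulr0n ?mul0r ?mulr0.
Qed.

(** The row-major vectorization, for which multiplication by a tensor product is
    tvec_tens. *)
Definition tvec m n (Z : 'M[R]_(m, n)) : 'rV[R]_(m * n) :=
  \row_k Z (mxtens_unindex k).1 (mxtens_unindex k).2.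

Definition untvec m n (v : 'rV[R]_(m * n)) : 'M[R]_(m, n) :=
  \matrix_(i, j) v 0 (mxtens_index (i, j)).

Lemma tvecK m n (Z : 'M[R]_(m, n)) : untvec (tvec Z) = Z.
Proof. by apply/matrixP => i j; rewrite !mxE mxtens_indexK. Qed.

Lemma untvecZ m n c (v : 'rV[R]_(m * n)) : untvec (c *: v) = c *: untvec v.
Proof. by apply/matrixP => i j; rewrite !mxE. Qed.

Lemma tvecZ m n c (Z : 'M[R]_(m, n)) : tvec (c *: Z) = c *: tvec Z.
Proof. by apply/rowP => k; rewrite !mxE. Qed.

Lemma tvec_tens m n p q (A : 'M[R]_(m, p)) (B : 'M[R]_(n, q)) (Z : 'M[R]_(m, n)) :
  tvec Z *m (A *t B) = tvec (A^T *m Z *m B).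
Proof.
apply/rowP => b; case: (mxtens_indexP b) => k l.
rewrite !mxE mxtens_indexK /= big_mxtens exchange_big /=; apply: eq_bigr => j _.
rewrite mxE mulr_suml; apply: eq_bigr => i _.
by rewrite !mxE !mxtens_indexK /=; ring.
Qed.

Lemma tvec_spmx m n (V : 'M[R]_m) (W : 'M[R]_n) c (Z : 'M[R]_(m, n)) :
  tvec Z *m spmx (V *t W) c =
  tvec (V^T *m (\matrix_(i, j) (c 0 (mxtens_index (i, j)) * (V *m Z *m W^T) i j)) *m W).
Proof.
rewrite /spmx trmx_tens !mulmxA tvec_tens trmxK -[RHS]tvec_tens.
congr (_ *m _); rewrite mul_mx_diag; apply/rowP => k; rewrite [LHS]mxE [RHS]mxE.
case: (mxtens_indexP k) => i j; rewrite mxE mxtens_indexK /= [RHS]mxE.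
by rewrite mulrC.
Qed.

(** For symmetric X, the matrix of Z |-> sum of the X^p Z Y^q / (p + q + 1)!, the
    divided difference of exp. As exp (1 x Y) and a function phi of the difference
    of the two commuting actions, it is a smooth function of X and Y. *)
Definition ddmx m n (X : 'M[R]_m) (Y : 'M[R]_n) : 'M[R]_(m * n) :=
  expmx (1%:M *t Y) *m phimx (X *t 1%:M - 1%:M *t Y).

Lemma ddmx_spmx m n (V : 'M[R]_m) (W : 'M[R]_n) (d : 'rV[R]_m) (e : 'rV[R]_n) :
  V *m V^T = 1%:M -> W *m W^T = 1%:M ->
  ddmx (spmx V d) (spmx W e) = spmx (V *t W)
    (\row_k expdd (d 0 (mxtens_unindex k).1) (e 0 (mxtens_unindex k).2)).
Proof.
move=> VV WW; have GG := tens_orth VV WW.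
rewrite /ddmx -(spmx_cst VV 1) -(spmx_cst WW 1) !tens_spmx spmxN spmxD.
rewrite expmx_spmx // phimx_spmx // spmxM //.
apply: (congr1 (spmx _)); apply/rowP => k; case: (mxtens_indexP k) => i j.
by rewrite !mxE !mxtens_indexK /= mul1r mulr1 /expdd.
Qed.

(** Its eigenvalues expdd x y are positive; this is what makes the logarithm and
    the rotation Q(A) smooth across coinciding eigenvalues. *)
Lemma SymPos_ddmx m n (X : 'M[R]_m) (Y : 'M[R]_n) :
  X^T = X -> Y^T = Y -> SymPos (ddmx X Y).
Proof.
move=> /sym_spmxP[V [d [VV ->]]] /sym_spmxP[W [e [WW ->]]].
rewrite ddmx_spmx //; apply/(SymPos_spmx (tens_orth VV WW)) => k.
by rewrite mxE expdd_gt0.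
Qed.

Lemma ddmxM n (X Y : 'M[R]_n) : X^T = X -> Y^T = Y ->
  tvec (X - Y) *m ddmx X Y = tvec (expmx X - expmx Y).
Proof.
move=> /sym_spmxP[V [d [VV ->]]] /sym_spmxP[W [e [WW ->]]].
rewrite ddmx_spmx // tvec_spmx; congr tvec.
set E := expmx _ - _; have -> : E = V^T *m (V *m E *m W^T) *m W.
  by rewrite !mulmxA (mulmx1C VV) mul1mx -mulmxA (mulmx1C WW) mulmx1.
congr (_ *m _ *m _); apply/matrixP => i j; rewrite [LHS]mxE spmx_diff1 //.
rewrite /E !expmx_spmx // spmx_diff1 // [X in X * _]mxE mxtens_indexK /= mulrA expddM.
by rewrite [map_mx _ d 0 i]mxE [map_mx _ e 0 j]mxE.
Qed.

Lemma expmxNK n (A : 'M[R]_n) : A^T = A -> expmx A *m expmx (- A) = 1%:M.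
Proof.
move=> /sym_spmxP[V [d [VV ->]]]; rewrite spmxN !expmx_spmx // spmxM //.
rewrite -(spmx_cst VV 1); apply: (congr1 (spmx V)); apply/rowP => i.
by rewrite !mxE expRxMexpNx_1.
Qed.

(** The inverse, written with exp and log to inherit their smoothness. *)
Definition invddmx m n (X : 'M[R]_m) (Y : 'M[R]_n) : 'M[R]_(m * n) :=
  expmx (- logmx (ddmx X Y)).

Lemma ddmxK m n (X : 'M[R]_m) (Y : 'M[R]_n) :
  X^T = X -> Y^T = Y -> ddmx X Y *m invddmx X Y = 1%:M.
Proof.
move=> Xt Yt; have [lt le] := logmxK (SymPos_ddmx Xt Yt).
by rewrite /invddmx -{1}le expmxNK.
Qed.

(** The finite increment formula for the logarithm, inverse to ddmxM. *)
Lemma logmxB n (M N : 'M[R]_n) : SymPos M -> SymPos N ->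
  logmx M - logmx N =
  untvec (tvec (M - N) *m invddmx (logmx M) (logmx N)).
Proof.
move=> Mpos Npos; have [Mt Me] := logmxK Mpos; have [Nt Ne] := logmxK Npos.
by rewrite -{2}Me -{2}Ne -ddmxM // -mulmxA ddmxK // mulmx1 tvecK.
Qed.

Lemma cvg_untvec (T : Type) (F : set_system T) {FF : Filter F} m n
    (f : T -> 'rV[R]_(m * n)) (v : 'rV[R]_(m * n)) :
  f @ F --> v -> (fun x => untvec (f x)) @ F --> untvec v.
Proof.
move=> /cvg_mxP fv; apply/cvg_mxP => i j; rewrite mxE.
by under eq_fun do rewrite mxE; exact: fv.
Qed.

Lemma cvg_ddmx (T : Type) (F : set_system T) {FF : Filter F} m n
    (f : T -> 'M[R]_m) (g : T -> 'M[R]_n) (X : 'M[R]_m) (Y : 'M[R]_n) :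
  f @ F --> X -> g @ F --> Y ->
  (fun x => ddmx (f x) (g x)) @ F --> ddmx X Y.
Proof.
move=> /cvg_mxP fX /cvg_mxP gY.
have c1 : (fun x => (1%:M : 'M[R]_m) *t g x) @ F --> (1%:M : 'M[R]_m) *t Y.
  apply/cvg_mxP => i j; rewrite mxE; under eq_fun do rewrite mxE.
  by apply: cvgM; [exact: cvg_cst | exact: gY].
have c2 : (fun x => f x *t (1%:M : 'M[R]_n)) @ F --> X *t (1%:M : 'M[R]_n).
  apply/cvg_mxP => i j; rewrite mxE; under eq_fun do rewrite mxE.
  by apply: cvgM; [exact: fX | exact: cvg_cst].
apply: cvg_mulmx; first exact: cvg_expmx.
apply: cvg_divdiff_exp; [exact: cvgB | exact: cvg_cst | exact: cvg_cst].
Qed.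

Section Ck.
Variables (E : normedModType R) (V U : set E).
Hypothesis oU : open_along V U.

Lemma Ck_on_tensmx k m n p q (f : E -> 'M[R]_(m, n)) (g : E -> 'M[R]_(p, q)) :
  Ck_on k V U f -> Ck_on k V U g -> Ck_on k V U (fun x => f x *t g x).
Proof.
move=> /(Ck_on_mxP oU) fC /(Ck_on_mxP oU) gC; apply/(Ck_on_mxP oU) => i j.
by under eq_fun do rewrite mxE; exact: (Ck_onM oU).
Qed.

Lemma Ck_on_tvec k m n (f : E -> 'M[R]_(m, n)) :
  Ck_on k V U f -> Ck_on k V U (fun x => tvec (f x)).
Proof.
move=> /(Ck_on_mxP oU) fC; apply/(Ck_on_mxP oU) => i j.
by under eq_fun do rewrite mxE; exact: fC.
Qed.

Lemma Ck_on_untvec k m n (f : E -> 'rV[R]_(m * n)) :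
  Ck_on k V U f -> Ck_on k V U (fun x => untvec (f x)).
Proof.
move=> /(Ck_on_mxP oU) fC; apply/(Ck_on_mxP oU) => i j.
by under eq_fun do rewrite mxE; exact: fC.
Qed.

Lemma Ck_on_ddmx k m n (f : E -> 'M[R]_m) (g : E -> 'M[R]_n) :
  Ck_on k V U f -> Ck_on k V U g -> Ck_on k V U (fun x => ddmx (f x) (g x)).
Proof.
move=> fC gC; have cC N (A : 'M[R]_N) : Ck_on k V U (fun=> A).
  exact: (Ck_on_cst oU).
have t1 : Ck_on k V U (fun x => (1%:M : 'M[R]_m) *t g x) by exact: Ck_on_tensmx.
apply: (Ck_on_mulmx oU); first exact: (Ck_on_expmx oU).
apply: (Ck_on_ursubmx oU); apply: (Ck_on_expmx oU).
apply: (Ck_on_block_mx oU) => //; apply: (Ck_onD oU); first exact: Ck_on_tensmx.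
exact: (Ck_on_oppmx oU).
Qed.

(** By logmxB the difference quotient of log is invddmx applied to that of f. The
    derivative involves the logarithm of a matrix of the size of the tensor
    square, so the induction on k covers all sizes at once. *)
Lemma Ck_on_logmx k n (f : E -> 'M[R]_n) :
  Ck_on k V U f -> (forall x, U x -> SymPos (f x)) ->
  Ck_on k V U (fun x => logmx (f x)).
Proof.
have C0 m (g : E -> 'M[R]_m) : Ck_on 0 V U g -> (forall x, U x -> SymPos (g x)) ->
    Ck_on 0 V U (fun x => logmx (g x)).
  move=> gC gpos; apply: Ck_on0 => x Ux.
  apply: cvg_logmx; [exact: (Ck_on_continuous gC)|exact: gpos|].
  by apply: filterS (@withinT _ (nbhs x) U _) => y; exact: gpos.
elim: k n f => [|k IH] n f fC fpos; first exact: C0.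
have ft x : U x -> (logmx (f x))^T = logmx (f x) by move=> /fpos/logmxK[].
have lC : Ck_on k V U (fun x => logmx (f x)) by apply: IH => //; exact: (Ck_onW fC).
have dpos x : U x -> SymPos (ddmx (logmx (f x)) (logmx (f x))).
  by move=> Ux; apply: SymPos_ddmx; exact: ft.
apply: (Ck_onS oU) => [|v Vv]; first by apply: C0 => //; case: fC => fc _; split.
have [fd fdC] := Ck_onD1 fC Vv.
exists (fun x => untvec (tvec ('D_v f x) *m invddmx (logmx (f x)) (logmx (f x)))).
split; last first.
  apply: Ck_on_untvec; apply: (Ck_on_mulmx oU); first exact: Ck_on_tvec.
  apply: (Ck_on_expmx oU); apply: (Ck_on_oppmx oU); apply: IH => //.
  exact: Ck_on_ddmx.
move=> x Ux; apply/is_derive_quotientP.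
have Uh : \forall h \near (0 : R)^', U (h *: v + x).
  exact: (nbhs_dnbhs (oU Ux Vv)).
have cl : (fun h : R => untvec (tvec (h^-1 *: (f (h *: v + x) - f x)) *m
      invddmx (logmx (f (h *: v + x))) (logmx (f x)))) @ 0^' -->
    untvec (tvec ('D_v f x) *m invddmx (logmx (f x)) (logmx (f x))).
  have c1 : (fun h : R => tvec (h^-1 *: (f (h *: v + x) - f x)) *m
      invddmx (logmx (f (h *: v + x))) (logmx (f x))) @ 0^' -->
      tvec ('D_v f x) *m invddmx (logmx (f x)) (logmx (f x)).
    apply: cvg_mulmx.
      have /is_derive_quotientP/cvg_mxP l := fd x Ux.
      by apply/cvg_mxP => i j; rewrite mxE; under eq_fun do rewrite mxE; exact: l.
    apply: cvg_expmx; apply: cvgN; apply: cvg_logmx; [|exact: dpos|].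
      apply: cvg_ddmx; last exact: cvg_cst.
      exact: (Ck_on_cvg_along oU lC).
    by apply: filterS Uh => h Uh; apply: SymPos_ddmx; exact: ft.
  exact: cvg_untvec c1.
apply: cvg_trans cl; apply: near_eq_cvg; apply: filterS Uh => h Uh.
rewrite /= logmxB; [|exact: fpos|exact: fpos].
by rewrite tvecZ -scalemxAl untvecZ.
Qed.

Lemma Ck_on_invddmx k m n (f : E -> 'M[R]_m) (g : E -> 'M[R]_n) :
  Ck_on k V U f -> Ck_on k V U g ->
  (forall x, U x -> (f x)^T = f x) -> (forall x, U x -> (g x)^T = g x) ->
  Ck_on k V U (fun x => invddmx (f x) (g x)).
Proof.
move=> fC gC ft gt; apply: (Ck_on_expmx oU); apply: (Ck_on_oppmx oU).
apply: Ck_on_logmx; first exact: Ck_on_ddmx.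
by move=> x Ux; apply: SymPos_ddmx; [exact: ft | exact: gt].
Qed.

End Ck.
End Tensor.

(** * Orthogonal Cauchy matrices *)

Section Cauchy.
Variables (F : fieldType) (n : nat) (a : 'I_n -> F) (l : 'I_(n + 1) -> F).
Hypotheses (ainj : injective a) (linj : injective l).
Hypothesis dis : forall i j, l j != a i.

(** The numerators of Lagrange interpolation at the points x. *)
Definition nodal (m : nat) (x : 'I_m -> F) (j : 'I_m) : {poly F} :=
  \prod_(j' | j' != j) ('X - (x j')%:P).

Lemma size_nodal m (x : 'I_m -> F) j : size (nodal x j) = m.
Proof.
rewrite /nodal -big_filter size_prod_XsubC.
rewrite size_filter -sum1_count sum1_card cardC1 card_ord prednK //.
exact: leq_ltn_trans (ltn_ord j).
Qed.

Lemma horner_nodal m (x : 'I_m -> F) j y :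
  (nodal x j).[y] = \prod_(j' | j' != j) (y - x j').
Proof. by rewrite horner_prod; apply: eq_bigr => i _; rewrite !hornerE. Qed.

Lemma horner_nodal_neq m (x : 'I_m -> F) j j' : j' != j -> (nodal x j).[x j'] = 0.
Proof. by move=> jj'; rewrite horner_nodal (bigD1 j') //= subrr mul0r. Qed.

Lemma horner_nodal_eq m (x : 'I_m -> F) j : injective x -> (nodal x j).[x j] != 0.
Proof.
move=> xinj; rewrite horner_nodal; apply/prodf_neq0 => i ij.
by rewrite subr_eq0 (inj_eq xinj) eq_sym.
Qed.

Lemma lagrange_interp (q : {poly F}) : (size q <= n + 1)%N ->
  q = \sum_j (q.[l j] / (nodal l j).[l j]) *: nodal l j.
Proof.
move=> sq; apply/eqP; rewrite -subr_eq0; apply/eqP.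
apply: (@roots_geq_poly_eq0 _ _ (codom l)).
- apply/allP => _ /codomP[j ->]; rewrite rootE !hornerE horner_sum (bigD1 j) //=.
  rewrite hornerZ divfK ?horner_nodal_eq // big1 ?addr0 ?subrr // => i ij.
  by rewrite hornerZ (@horner_nodal_neq _ l i j) ?mulr0 1?eq_sym.
- by apply/injectiveP.
rewrite size_codom card_ord; apply: leq_trans (size_polyD _ _) _.
rewrite geq_max sq size_polyN; apply: leq_trans (size_sum _ _ _) _.
apply/bigmax_leqP => j _; apply: leq_trans (size_scale_leq _ _) _.
by rewrite size_nodal.
Qed.

Lemma coef_nodal m (x : 'I_(m + 1) -> F) j : (nodal x j)`_m = 1.
Proof.
have : lead_coef (nodal x j) = 1 by apply/eqP; exact: monic_prod_XsubC.
have e : (size (nodal x j)).-1 = m by rewrite size_nodal addn1.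
by rewrite lead_coefE e.
Qed.

(** The leading coefficients in Lagrange interpolation at the points l. *)
Lemma lagrange_coef (q : {poly F}) : (size q <= n + 1)%N ->
  \sum_j q.[l j] / (nodal l j).[l j] = q`_n.
Proof.
move=> sq; rewrite {2}(lagrange_interp sq) coef_sum; apply: eq_bigr => j _.
by rewrite coefZ coef_nodal mulr1.
Qed.

(** The partial fraction expansion of q / \prod_j ('X - l j). *)
Lemma lagrange_frac (q : {poly F}) y : (size q <= n + 1)%N ->
  (forall j, l j != y) ->
  \sum_j q.[l j] / (nodal l j).[l j] / (l j - y) = - q.[y] / \prod_j (y - l j).
Proof.
move=> sq ly; rewrite {2}(lagrange_interp sq) horner_sum mulNr mulr_suml -sumrN.
apply: eq_bigr => j _; rewrite hornerZ [\prod_(i < _) _](bigD1 j) //= -horner_nodal.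
set P := (nodal l j).[y]; set c := _ / (nodal l j).[l j].
have P0 : P != 0.
  by rewrite /P horner_nodal; apply/prodf_neq0 => i _; rewrite subr_eq0 eq_sym.
have yl : y - l j != 0 by rewrite subr_eq0 eq_sym.
have ly' : l j - y != 0 by rewrite subr_eq0.
by field; rewrite P0 yl ly'.
Qed.

(** The bordering vectors of an orthogonal Cauchy matrix, up to signs. *)
Definition cauchy_squares (b : 'I_n -> F) (w : 'I_(n + 1) -> F) : Prop :=
  (forall j, w j ^+ 2 = \prod_i (l j - a i) / \prod_(j' | j' != j) (l j - l j')) /\
  (forall i, b i ^+ 2 = - \prod_j (a i - l j) / \prod_(i' | i' != i) (a i - a i')).

(** The rows are those of the Cauchy matrix, completed by the row w. *)
Definition cauchy_orthonormal (b : 'I_n -> F) (w : 'I_(n + 1) -> F) : Prop :=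
  [/\ forall i i', \sum_j (b i * w j / (l j - a i)) * (b i' * w j / (l j - a i'))
        = (i == i')%:R,
      forall i, \sum_j (b i * w j / (l j - a i)) * w j = 0 &
      \sum_j w j * w j = 1].

Let N : {poly F} := \prod_i ('X - (a i)%:P).

Let sizeN : size N = (n + 1)%N.
Proof. by rewrite size_prod_XsubC [index_enum _]unlock -enumT size_enum_ord addn1. Qed.

Let hornerN y : N.[y] = \prod_i (y - a i).
Proof. by rewrite horner_prod; apply: eq_bigr => i _; rewrite !hornerE. Qed.

(** As w j ^+ 2 = N.[l j] / (nodal l j).[l j], the sums are Lagrange sums: the
    partial fraction expansions of nodal a i at a i' and of N at its root a i, and
    the leading coefficient of N. *)
Let sums (w : 'I_(n + 1) -> F) :
  (forall j, w j ^+ 2 = \prod_i (l j - a i) / \prod_(j' | j' != j) (l j - l j')) ->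
  [/\ forall i i', \sum_j w j ^+ 2 / (l j - a i) / (l j - a i')
        = - \prod_(i0 | i0 != i) (a i' - a i0) / \prod_j (a i' - l j),
      forall i, \sum_j w j ^+ 2 / (l j - a i) = 0 &
      \sum_j w j ^+ 2 = 1].
Proof.
move=> wE.
have wN j : w j ^+ 2 = N.[l j] / (nodal l j).[l j].
  by rewrite wE hornerN horner_nodal.
split=> [i i'|i|].
- rewrite -horner_nodal -lagrange_frac //; last by rewrite size_nodal addn1.
  apply: eq_bigr => j _; congr (_ / _); rewrite wN.
  have -> : N.[l j] = (l j - a i) * (nodal a i).[l j].
    by rewrite hornerN horner_nodal (bigD1 i).
  have d0 : (nodal l j).[l j] != 0 by exact: horner_nodal_eq.
  by field; rewrite d0 subr_eq0 dis.
- have -> : \sum_j w j ^+ 2 / (l j - a i) = - N.[a i] / \prod_j (a i - l j).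
    rewrite -lagrange_frac ?sizeN //.
    by apply: eq_bigr => j _; rewrite wN.
  by rewrite hornerN (bigD1 i) //= subrr mul0r oppr0 mul0r.
- under eq_bigr do rewrite wN.
  rewrite lagrange_coef ?sizeN //.
  have : lead_coef N = 1 by apply/eqP; exact: monic_prod_XsubC.
  by rewrite lead_coefE sizeN addn1.
Qed.

Lemma cauchy_squares_orthonormal b w :
  cauchy_squares b w -> cauchy_orthonormal b w.
Proof.
move=> [wE bE]; have [s1 s2 s3] := sums wE; split=> [i i'|i|].
- have -> : \sum_j b i * w j / (l j - a i) * (b i' * w j / (l j - a i'))
      = b i * b i' * \sum_j w j ^+ 2 / (l j - a i) / (l j - a i').
    rewrite mulr_sumr; apply: eq_bigr => j _.
    by field; rewrite !subr_eq0 !dis.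
  rewrite s1; have [<-|ii'] := eqVneq i i'; last first.
    by rewrite (bigD1 i') 1?eq_sym //= subrr mul0r oppr0 mul0r mulr0.
  rewrite -expr2 bE; set P := \prod_(_ < _) _; set Q := \prod_(_ | _) _.
  have P0 : P != 0 by apply/prodf_neq0 => j _; rewrite subr_eq0 eq_sym.
  have Q0 : Q != 0.
    by apply/prodf_neq0 => j ji; rewrite subr_eq0 (inj_eq ainj) eq_sym.
  by rewrite [RHS]/=; field; rewrite P0 Q0.
- have -> : \sum_j b i * w j / (l j - a i) * w j
      = b i * \sum_j w j ^+ 2 / (l j - a i).
    by rewrite mulr_sumr; apply: eq_bigr => j _; ring.
  by rewrite s2 mulr0.
- by rewrite -[RHS]s3; apply: eq_bigr => j _; rewrite expr2.
Qed.

(** The polynomial \sum_j w j ^+ 2 *: nodal l j is monic because w is a unit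
    vector, and it vanishes at each a i because w is orthogonal to the other rows;
    so it is \prod_i ('X - (a i)%:P). Its values at the points l j are the formula
    for w, and the norms of the other rows give the one for b. *)
Lemma cauchy_orthonormal_squares b w :
  cauchy_orthonormal b w -> cauchy_squares b w.
Proof.
move=> [orth1 o2 o3].
have b0 i : b i != 0.
  apply/eqP => bi; have := orth1 i i; rewrite big1 ?eqxx => [/eqP|j _].
    by rewrite eq_sym oner_eq0.
  by rewrite bi !mul0r.
pose P := \sum_j w j ^+ 2 *: nodal l j.
have Pl j : P.[l j] = w j ^+ 2 * (nodal l j).[l j].
  rewrite /P horner_sum (bigD1 j) //= hornerZ big1 ?addr0 // => i ij.
  by rewrite hornerZ (@horner_nodal_neq _ l i j) ?mulr0 1?eq_sym.
have sP : (size P <= n + 1)%N.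
  apply: leq_trans (size_sum _ _ _) _; apply/bigmax_leqP => j _.
  by apply: leq_trans (size_scale_leq _ _) _; rewrite size_nodal.
have Pn : P`_n = 1.
  rewrite /P coef_sum -[RHS]o3; apply: eq_bigr => j _.
  by rewrite coefZ coef_nodal mulr1 expr2.
have sP' : size P = (n + 1)%N.
  apply/eqP; rewrite eqn_leq sP addn1 ltnNge; apply/negP => h.
  by have := nth_default 0 h => /eqP; rewrite Pn oner_eq0.
have Pa i : P.[a i] = 0.
  have := lagrange_frac sP (dis i).
  have -> : \sum_j P.[l j] / (nodal l j).[l j] / (l j - a i)
      = \sum_j w j ^+ 2 / (l j - a i).
    apply: eq_bigr => j _; rewrite Pl mulfK //; exact: horner_nodal_eq.
  have -> : \sum_j w j ^+ 2 / (l j - a i) = 0.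
    apply: (mulfI (b0 i)); rewrite mulr0 -[RHS](o2 i) mulr_sumr.
    by apply: eq_bigr => j _; ring.
  move/esym/eqP; rewrite mulf_eq0 oppr_eq0 invr_eq0 => /orP[/eqP //|].
  by case/prodf_eq0 => j _; rewrite subr_eq0 eq_sym (negbTE (dis i j)).
have PN : P = N.
  have := @all_roots_prod_XsubC _ P [seq a i | i <- enum 'I_n].
  rewrite sP' size_map -cardT card_ord addn1 => /(_ erefl).
  rewrite big_map big_enum /= -/N lead_coefE sP' addn1 Pn scale1r; apply.
    by apply/allP => _ /mapP[i _ ->]; rewrite rootE Pa.
  by rewrite uniq_rootsE map_inj_uniq ?enum_uniq.
have wE j : w j ^+ 2 = \prod_i (l j - a i) / \prod_(j' | j' != j) (l j - l j').
  rewrite -hornerN -horner_nodal -PN Pl mulfK //; exact: horner_nodal_eq.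
split=> // i; have [s1 _ _] := sums wE.
have := orth1 i i; rewrite eqxx.
have -> : \sum_j b i * w j / (l j - a i) * (b i * w j / (l j - a i))
      = b i ^+ 2 * \sum_j w j ^+ 2 / (l j - a i) / (l j - a i).
  rewrite mulr_sumr; apply: eq_bigr => j _.
  by field; rewrite !subr_eq0 !dis.
rewrite s1; set A := \prod_(_ < _) _; set Q := \prod_(_ | _) _.
have A0 : A != 0 by apply/prodf_neq0 => j _; rewrite subr_eq0 eq_sym.
have Q0 : Q != 0.
  by apply/prodf_neq0 => j ji; rewrite subr_eq0 (inj_eq ainj) eq_sym.
move=> e; apply: (mulIf (_ : - Q / A != 0)).
  by rewrite mulf_neq0 ?invr_eq0 ?oppr_eq0.
by rewrite e /=; field; rewrite A0 Q0.
Qed.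

End Cauchy.

#[local] Opaque expmx phimx logmx phi expdd ln expR.

(** * The rotation Q(A) *)

Section Weights.
Variable R : realType.

Lemma spmxE n (V : 'M[R]_n) d i j : spmx V d i j = \sum_k V k i * d 0 k * V k j.
Proof.
by rewrite /spmx mul_mx_diag mxE; apply: eq_bigr => k _; rewrite !mxE.
Qed.

(** The partial trace over the second tensor factor. *)
Definition ptrace m n (K : 'M[R]_(m * n)) : 'M[R]_m :=
  \matrix_(i, i') \sum_j K (mxtens_index (i, j)) (mxtens_index (i', j)).

Lemma ptrace_spmx m n (V : 'M[R]_m) (W : 'M[R]_n) c : W *m W^T = 1%:M ->
  ptrace (spmx (V *t W) c) = spmx V (\row_i \sum_j c 0 (mxtens_index (i, j))).
Proof.
move=> WW; apply/matrixP => i i'; rewrite mxE spmxE.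
under eq_bigr do rewrite spmxE big_mxtens.
rewrite exchange_big /=; apply: eq_bigr => p _.
rewrite exchange_big mxE mulr_sumr mulr_suml /=; apply: eq_bigr => q _.
under eq_bigr do rewrite !tensmxE.
transitivity (V p i * c 0 (mxtens_index (p, q)) * V p i' * \sum_j W q j ^+ 2).
  by rewrite mulr_sumr; apply: eq_bigr => j _; ring.
by rewrite orth_row // mulr1.
Qed.

(** The function hval of X, for d and e the eigenvalues of X and Y. *)
Definition hexp m n (X : 'M[R]_m) (Y : 'M[R]_n) : 'M[R]_m :=
  2^-1 *: (X + ptrace (logmx (ddmx X Y)) - ptrace (logmx (ddmx X X))).

Definition hmx m n (X : 'M[R]_m) (Y : 'M[R]_n) : 'M[R]_m := expmx (hexp X Y).

(** Half the logarithm of the factor by which the right hand sides of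
    cauchy_squares are multiplied when all points are replaced by their
    exponentials; see hval_sqr and hval_prod. *)
Definition hval m n (d : 'rV[R]_m) (e : 'rV[R]_n) (x : R) : R :=
  2^-1 * (x + \sum_j ln (expdd x (e 0 j)) - \sum_i ln (expdd x (d 0 i))).

Lemma ptrace_log_spmx m n (V : 'M[R]_m) (W : 'M[R]_n) (d : 'rV[R]_m) (e : 'rV[R]_n) :
  V *m V^T = 1%:M -> W *m W^T = 1%:M ->
  ptrace (logmx (ddmx (spmx V d) (spmx W e))) =
  spmx V (\row_i \sum_j ln (expdd (d 0 i) (e 0 j))).
Proof.
move=> VV WW; rewrite ddmx_spmx // logmx_spmx ?tens_orth // => [|k]; last first.
  by rewrite mxE expdd_gt0.
rewrite ptrace_spmx //; apply: (congr1 (spmx V)); apply/rowP => i.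
rewrite [LHS]mxE [RHS]mxE; apply: eq_bigr => j _.
by rewrite [LHS]mxE [X in ln X]mxE mxtens_indexK.
Qed.

Lemma hexp_spmx m n (V : 'M[R]_m) (W : 'M[R]_n) (d : 'rV[R]_m) (e : 'rV[R]_n) :
  V *m V^T = 1%:M -> W *m W^T = 1%:M ->
  hexp (spmx V d) (spmx W e) = spmx V (\row_i hval d e (d 0 i)).
Proof.
move=> VV WW; rewrite /hexp !ptrace_log_spmx // spmxN !spmxD spmxZ.
by apply: (congr1 (spmx V)); apply/rowP => i; rewrite !mxE.
Qed.

Lemma hmx_spmx m n (V : 'M[R]_m) (W : 'M[R]_n) (d : 'rV[R]_m) (e : 'rV[R]_n) :
  V *m V^T = 1%:M -> W *m W^T = 1%:M ->
  hmx (spmx V d) (spmx W e) = spmx V (\row_i expR (hval d e (d 0 i))).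
Proof.
move=> VV WW; rewrite /hmx hexp_spmx // expmx_spmx //.
by apply: (congr1 (spmx V)); apply/rowP => i; rewrite !mxE.
Qed.

Lemma hval_sqr m n (d : 'rV[R]_m) (e : 'rV[R]_n) x :
  expR (hval d e x) ^+ 2 =
  expR x * (\prod_j expdd x (e 0 j)) / \prod_i expdd x (d 0 i).
Proof.
rewrite -expRM_natl /hval mulrA divff // mul1r expRB expRD !expR_sum.
by congr (_ * _ / _); apply: eq_bigr => i _; rewrite lnK // posrE expdd_gt0.
Qed.

Lemma hexp_sym m n (X : 'M[R]_m) (Y : 'M[R]_n) : X^T = X -> Y^T = Y ->
  (hexp X Y)^T = hexp X Y.
Proof.
move=> /sym_spmxP[V [d [VV ->]]] /sym_spmxP[W [e [WW ->]]].
by rewrite hexp_spmx // spmx_tr.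
Qed.

Definition invhmx m n (X : 'M[R]_m) (Y : 'M[R]_n) : 'M[R]_m := expmx (- hexp X Y).

Lemma hmxV m n (X : 'M[R]_m) (Y : 'M[R]_n) : X^T = X -> Y^T = Y ->
  hmx X Y *m invhmx X Y = 1%:M.
Proof. by move=> Xt Yt; rewrite expmxNK // hexp_sym. Qed.

(** This is what allows to compute hmx (ulsubmx A) A from the corner of A and the
    spectrum of A, without knowing A. *)
Lemma hexp_char_poly m n (X : 'M[R]_m) (Y Y' : 'M[R]_n) :
  X^T = X -> Y^T = Y -> Y'^T = Y' -> char_poly Y = char_poly Y' ->
  hexp X Y = hexp X Y'.
Proof.
move=> /sym_spmxP[V [d [VV ->]]] /sym_spmxP[W [e [WW ->]]].
move=> /sym_spmxP[W' [e' [WW' ->]]]; rewrite (char_poly_spmx WW) (char_poly_spmx WW') => ee'.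
have pe : perm_eq [seq e 0 i | i : 'I_n] [seq e' 0 i | i : 'I_n].
  by apply: prod_XsubC_eq; rewrite !big_image.
have eh x : hval d e x = hval d e' x.
  have es : \sum_j ln (expdd x (e 0 j)) = \sum_j ln (expdd x (e' 0 j)).
    transitivity (\sum_(y <- [seq e 0 i | i : 'I_n]) ln (expdd x y)).
      by rewrite big_image.
    by rewrite (perm_big _ pe) big_image.
  exact: (congr1 (fun s => 2^-1 * (x + s - _)) es).
rewrite (hexp_spmx _ _ VV WW) (hexp_spmx _ _ VV WW').
by apply: (congr1 (spmx V)); apply/rowP => i; rewrite [LHS]mxE [RHS]mxE eh.
Qed.

Lemma block1_orth n (P : 'M[R]_n) : P *m P^T = 1%:M ->
  block_mx P 0 0 1%:M *m (block_mx P 0 0 1%:M : 'M[R]_(n + 1))^T = 1%:M.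
Proof.
move=> PP; rewrite tr_block_mx mulmx_block.
rewrite !(trmx0, trmx1, mul0mx, mulmx0, addr0, add0r, mulmx1) PP.
by rewrite -scalar_mx_block.
Qed.

Section Step.
Variable n : nat.
Implicit Type A : 'M[R]_(n + 1).

Definition incl : 'M[R]_(n, n + 1) := row_mx 1%:M 0.
Definition last_row : 'rV[R]_(n + 1) := row_mx 0 1%:M.

(** In eigenbases, and where l j != a i, the entries are those of a Cauchy matrix,
    (b i * w j) / (exp (l j) - exp (a i)); see core_spmx and border_eigen. *)
Definition core A : 'M[R]_(n, n + 1) :=
  untvec (tvec incl *m invddmx (ulsubmx A) A).

Definition Qtop A : 'M[R]_(n, n + 1) :=
  hmx (ulsubmx A) A *m core A *m hmx A (ulsubmx A).

Definition Qbot A : 'rV[R]_(n + 1) := last_row *m hmx A (ulsubmx A).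

(** When A and ulsubmx A share no eigenvalue, this is the orthogonal Cauchy matrix
    with nodes the exponentials of their eigenvalues, read in the standard bases. *)
Definition Qmx A : 'M[R]_(n + 1) := col_mx (Qtop A) (Qbot A).

Lemma sym_ulsubmx A : A^T = A -> (ulsubmx A)^T = ulsubmx A.
Proof. by move=> At; rewrite trmx_ulsub At. Qed.

Lemma sym_dlsubmx A : A^T = A -> dlsubmx A = (ursubmx A)^T.
Proof. by move=> At; rewrite trmx_ursub At. Qed.

Lemma incl_mul A : incl *m A = ulsubmx A *m incl + ursubmx A *m last_row.
Proof.
rewrite /incl /last_row -{1}[A]submxK mul_row_block.
rewrite !mul_mx_row !(mul1mx, mul0mx, mulmx1, mulmx0, addr0, add0r) add_row_mx.
by rewrite addr0 add0r.
Qed.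

Lemma invddmx_spmx m p (V : 'M[R]_m) (W : 'M[R]_p) (d : 'rV[R]_m) (e : 'rV[R]_p) :
  V *m V^T = 1%:M -> W *m W^T = 1%:M ->
  invddmx (spmx V d) (spmx W e) = spmx (V *t W)
    (\row_k (expdd (d 0 (mxtens_unindex k).1) (e 0 (mxtens_unindex k).2))^-1).
Proof.
move=> VV WW; rewrite /invddmx ddmx_spmx // logmx_spmx ?tens_orth // => [|k]; last first.
  by rewrite mxE expdd_gt0.
rewrite spmxN expmx_spmx ?tens_orth //; apply: (congr1 (spmx _)); apply/rowP => k.
by rewrite [RHS]mxE 4!mxE expRN lnK // posrE expdd_gt0.
Qed.

Section Coordinates.
Variables (A : 'M[R]_(n + 1)) (V : 'M[R]_n) (a : 'rV[R]_n).
Variables (W : 'M[R]_(n + 1)) (l : 'rV[R]_(n + 1)).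
Hypotheses (VV : V *m V^T = 1%:M) (WW : W *m W^T = 1%:M).
Hypotheses (Aul : ulsubmx A = spmx V a) (AE : A = spmx W l).

Let T := V *m incl *m W^T.
Let w := last_row *m W^T.
Let b := V *m ursubmx A.

(** The relation incl_mul in eigenbases. *)
Lemma border_eigen i j : T i j * (l 0 j - a 0 i) = b i 0 * w 0 j.
Proof.
have := spmx_diff a l incl i j VV WW; rewrite -/T -Aul -AE incl_mul.
rewrite opprD addrA subrr add0r mulmxN mulNmx [LHS]mxE.
have -> : V *m (ursubmx A *m last_row) *m W^T = b *m w by rewrite !mulmxA.
rewrite [X in - X]mxE big_ord1 => e.
by rewrite -[RHS]opprK e; ring.
Qed.

Lemma border_orth : col_mx T w *m (col_mx T w)^T = 1%:M.
Proof.
have -> : col_mx T w = block_mx V 0 0 1%:M *m W^T.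
  rewrite -[W^T]vsubmxK mul_block_col /T /w /incl /last_row.
  rewrite -{1 2}[W^T]vsubmxK -!mulmxA !mul_row_col.
  by rewrite !(mul1mx, mul0mx, mulmx0, addr0, add0r).
rewrite trmx_mul trmxK mulmxA -[_ *m W^T *m W]mulmxA (mulmx1C WW) mulmx1.
rewrite tr_block_mx mulmx_block !(trmx0, trmx1, mul0mx, mulmx0, addr0, add0r, mulmx1) VV.
by rewrite -scalar_mx_block.
Qed.

Lemma core_spmx : V *m core A *m W^T =
  \matrix_(i, j) ((expdd (a 0 i) (l 0 j))^-1 * T i j).
Proof.
rewrite /core Aul {1}AE invddmx_spmx // tvec_spmx tvecK.
rewrite !mulmxA VV mul1mx -mulmxA WW mulmx1; apply/matrixP => i j.
by rewrite [LHS]mxE [RHS]mxE [X in X * _]mxE mxtens_indexK.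
Qed.

Lemma Qmx_spmx : block_mx V 0 0 1%:M *m Qmx A *m W^T =
  col_mx (\matrix_(i, j) (expR (hval a l (a 0 i)) * expR (hval l a (l 0 j))
             / expdd (a 0 i) (l 0 j) * T i j))
         (\row_j (expR (hval l a (l 0 j)) * w 0 j)).
Proof.
rewrite /Qmx mul_block_col !(mul0mx, addr0, add0r) mul1mx mul_col_mx.
have kW : hmx A (ulsubmx A) *m W^T
    = W^T *m diag_mx (\row_j expR (hval l a (l 0 j))).
  rewrite Aul {1}AE hmx_spmx // /spmx -!mulmxA WW mulmx1 //.
have hV : V *m hmx (ulsubmx A) A = diag_mx (\row_i expR (hval a l (a 0 i))) *m V.
  by rewrite Aul {1}AE hmx_spmx // mul_spmx.
congr col_mx.
  rewrite /Qtop !mulmxA hV -!mulmxA kW.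
  have -> : V *m (core A *m (W^T *m diag_mx (\row_j expR (hval l a (l 0 j)))))
      = (V *m core A *m W^T) *m diag_mx (\row_j expR (hval l a (l 0 j))).
    by rewrite !mulmxA.
  rewrite core_spmx; apply/matrixP => i j.
  rewrite mul_diag_mx [LHS]mxE mul_mx_diag [X in _ * X]mxE [RHS]mxE.
  rewrite [X in X * _]mxE [X in _ * (X * _)]mxE [X in _ * (_ * X)]mxE; ring.
rewrite /Qbot -mulmxA kW mulmxA -/w mul_mx_diag; apply/rowP => j.
by rewrite [LHS]mxE [RHS]mxE [X in _ * X]mxE mulrC.
Qed.

End Coordinates.
End Step.
End Weights.

(** * Orthogonality of Q(A) when A and its corner share no eigenvalue *)

Section Generic.
Variable R : realType.

Lemma root_char_poly_spmx n (V : 'M[R]_n) (d : 'rV[R]_n) x : V *m V^T = 1%:M ->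
  root (char_poly (spmx V d)) x <-> exists i, x = d 0 i.
Proof.
move=> VV; rewrite (char_poly_spmx VV).
have -> : \prod_i ('X - (d 0 i)%:P) = \prod_(y <- [seq d 0 i | i : 'I_n]) ('X - y%:P).
  by rewrite big_image.
rewrite root_prod_XsubC; split=> [/mapP[i _ ->]|[i ->]]; first by exists i.
by apply/mapP; exists i => //; rewrite mem_enum.
Qed.

(** Under this condition a symmetric A and its corner have simple spectra, and the
    border has no zero coordinate in an eigenbasis of the corner. *)
Definition disjoint_roots n (A : 'M[R]_(n + 1)) : Prop :=
  forall x, root (char_poly (ulsubmx A)) x -> root (char_poly A) x -> False.

Section Transfer.
Variables (m n : nat) (a : 'rV[R]_m) (l : 'rV[R]_n).

Lemma hval_prod (j : 'I_n) :
  expR (hval l a (l 0 j)) ^+ 2 =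
  \prod_i expdd (l 0 j) (a 0 i) / \prod_(j' | j' != j) expdd (l 0 j) (l 0 j').
Proof.
rewrite hval_sqr [X in _ / X](bigD1 j) //= expddxx.
set P := \prod_(i < m) _; set Q := \prod_(_ | _) _.
have Q0 : Q != 0 by apply/prodf_neq0 => i _; rewrite gt_eqF ?expdd_gt0.
have e0 : expR (l 0 j) != 0 by rewrite gt_eqF ?expR_gt0.
by field; rewrite Q0 e0.
Qed.

Lemma prod_expR_sub (I : finType) (P : pred I) (x : R) (y : I -> R) :
  \prod_(i | P i) (expR x - expR (y i)) =
  (\prod_(i | P i) expdd x (y i)) * \prod_(i | P i) (x - y i).
Proof. by rewrite -big_split /=; apply: eq_bigr => i _; rewrite -expddM. Qed.

(** A difference of exponentials is expdd times the difference, and the factors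
    expdd combine into hval_prod. The sign s is 1 for the l j and -1 for the a i. *)
Lemma transfer_sqr (c s : R) (j : 'I_n) : injective (l 0) ->
  c ^+ 2 = s * \prod_i (l 0 j - a 0 i) / \prod_(j' | j' != j) (l 0 j - l 0 j') <->
  (c * expR (hval l a (l 0 j))) ^+ 2 = s * \prod_i (expR (l 0 j) - expR (a 0 i)) /
    \prod_(j' | j' != j) (expR (l 0 j) - expR (l 0 j')).
Proof.
move=> linj; rewrite [in X in _ <-> X]exprMn hval_prod.
rewrite (@prod_expR_sub _ xpredT (l 0 j) (a 0)).
rewrite (@prod_expR_sub _ (fun j' => j' != j) (l 0 j) (l 0)).
have : \prod_i expdd (l 0 j) (a 0 i) != 0.
  by apply/prodf_neq0 => i _; rewrite gt_eqF ?expdd_gt0.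
have : \prod_(j' | j' != j) expdd (l 0 j) (l 0 j') != 0.
  by apply/prodf_neq0 => i _; rewrite gt_eqF ?expdd_gt0.
have : \prod_(j' | j' != j) (l 0 j - l 0 j') != 0.
  by apply/prodf_neq0 => i ij; rewrite subr_eq0 (inj_eq linj) eq_sym.
move: (\prod_i expdd _ _) (\prod_(_ | _) expdd _ _) => f1 f2.
move: (\prod_i (_ - _)) (\prod_(_ | _) (_ - _)) => g1 g2 g20 f20 f10.
have -> : s * (f1 * g1) / (f2 * g2) = (s * g1 / g2) * (f1 / f2).
  by field; rewrite f20 g20.
by split=> [->//|]; apply: mulIf; rewrite mulf_neq0 // invr_eq0.
Qed.

End Transfer.

Lemma cauchy_transfer n (a : 'rV[R]_n) (l : 'rV[R]_(n + 1))
    (b : 'I_n -> R) (w : 'I_(n + 1) -> R) :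
  injective (a 0) -> injective (l 0) ->
  cauchy_squares (a 0) (l 0) b w <->
  cauchy_squares (fun i => expR (a 0 i)) (fun j => expR (l 0 j))
    (fun i => b i * expR (hval a l (a 0 i)))
    (fun j => w j * expR (hval l a (l 0 j))).
Proof.
move=> ainj linj.
have wi j := @transfer_sqr _ _ a l (w j) 1 j linj.
have bi i := @transfer_sqr _ _ l a (b i) (-1) i ainj.
split=> -[hw hb]; split=> [j|i].
- by have := (wi j).1; rewrite !mul1r; apply.
- by have := (bi i).1; rewrite !mulN1r; apply.
- by have := (wi j).2; rewrite !mul1r; apply.
- by have := (bi i).2; rewrite !mulN1r; apply.
Qed.

Section CauchyMatrix.
Variables (n : nat) (a : 'rV[R]_n) (l : 'rV[R]_(n + 1)).
Hypothesis dis : forall i j, l 0 j != a 0 i.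

Definition cauchymx (b : 'I_n -> R) (w : 'I_(n + 1) -> R) : 'M[R]_(n + 1) :=
  col_mx (\matrix_(i, j) (b i * w j / (l 0 j - a 0 i))) (\row_j w j).

Lemma mulmx_trE m p q (A : 'M[R]_(m, p)) (B : 'M[R]_(q, p)) i j :
  (A *m B^T) i j = \sum_k A i k * B j k.
Proof. by rewrite mxE; apply: eq_bigr => k _; rewrite [_^T _ _]mxE. Qed.

Lemma col_mx_orthP (T : 'M[R]_(n, n + 1)) (w : 'rV[R]_(n + 1)) :
  col_mx T w *m (col_mx T w)^T = 1%:M <->
  [/\ forall i i', \sum_j T i j * T i' j = (i == i')%:R,
      forall i, \sum_j T i j * w 0 j = 0 & \sum_j w 0 j * w 0 j = 1].
Proof.
rewrite tr_col_mx mul_col_row (scalar_mx_block n 1 (1 : R)); split.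
  move=> /eq_block_mx[e1 e2 _ e3]; split=> [i i'|i|].
  - by rewrite -mulmx_trE e1 mxE.
  - by rewrite -mulmx_trE e2 mxE.
  - by rewrite -mulmx_trE e3 mxE.
move=> [e1 e2 e3]; have e2' : T *m w^T = 0.
  by apply/matrixP => i j; rewrite ord1 mulmx_trE e2 mxE.
congr block_mx => //.
- by apply/matrixP => i i'; rewrite mulmx_trE e1 mxE.
- by rewrite -[LHS]trmxK trmx_mul trmxK e2' trmx0.
- by apply/matrixP => i j; rewrite !ord1 mulmx_trE e3 mxE.
Qed.

Lemma cauchymx_orthP b w :
  cauchymx b w *m (cauchymx b w)^T = 1%:M <-> cauchy_orthonormal (a 0) (l 0) b w.
Proof.
rewrite /cauchymx col_mx_orthP.
split; case=> c1 c2 c3; split.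
- move=> i i'; rewrite -c1; apply: eq_bigr => j _.
  by rewrite !mxE.
- move=> i; rewrite -[RHS](c2 i); apply: eq_bigr => j _.
  by rewrite !mxE.
- by rewrite -[RHS]c3; apply: eq_bigr => j _; rewrite !mxE.
- move=> i i'; rewrite -c1; apply: eq_bigr => j _.
  by rewrite !mxE.
- move=> i; rewrite -[RHS](c2 i); apply: eq_bigr => j _.
  by rewrite !mxE.
- by rewrite -[RHS]c3; apply: eq_bigr => j _; rewrite !mxE.
Qed.

(** Two equal nodes would make two rows, or two columns, proportional. *)
Lemma cauchymx_inj b w : cauchymx b w *m (cauchymx b w)^T = 1%:M ->
  injective (a 0) /\ injective (l 0).
Proof.
move=> CC; have [c1 c2 c3] := (cauchymx_orthP b w).1 CC; split=> [i i' ii'|j j' jj'].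
  apply/eqP; apply: contraT => ne.
  have b0 k : b k != 0.
    apply/eqP => bk; have := c1 k k; rewrite eqxx big1 => [/eqP|j _].
      by rewrite eq_sym oner_eq0.
    by rewrite bk !mul0r.
  suff : b i' = 0 by move/eqP; rewrite (negbTE (b0 i')).
  have : b i' * (i == i)%:R = b i * (i == i')%:R.
    by rewrite -!c1 !mulr_sumr; apply: eq_bigr => j _; rewrite ii'; ring.
  by rewrite eqxx (negbTE ne) mulr1 mulr0.
have CC' := mulmx1C CC.
have colE k k' : \sum_i (b i * w k / (l 0 k - a 0 i)) * (b i * w k' / (l 0 k' - a 0 i))
    + w k * w k' = (k == k')%:R.
  have /matrixP/(_ k k') := CC'.
  rewrite /cauchymx tr_col_mx mul_row_col [1%:M _ _]mxE => <-.
  rewrite [in RHS]mxE; congr (_ + _).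
    rewrite [RHS]mxE; apply: eq_bigr => i _.
    by rewrite !mxE.
  by rewrite [RHS]mxE big_ord1 !mxE.
apply/eqP; apply: contraT => ne.
have w0 k : w k != 0.
  apply/eqP => wk; have := colE k k; rewrite eqxx wk mulr0 addr0 big1 => [/eqP|i _].
    by rewrite eq_sym oner_eq0.
  by rewrite mulr0 !mul0r.
suff : w j' = 0 by move/eqP; rewrite (negbTE (w0 j')).
have : w j' * (j == j)%:R = w j * (j == j')%:R.
  rewrite -!colE !mulrDr !mulr_sumr; congr (_ + _); last by ring.
  by apply: eq_bigr => i _; rewrite jj'; ring.
by rewrite eqxx (negbTE ne) mulr1 mulr0.
Qed.

End CauchyMatrix.

Lemma disjoint_roots_dis n (A : 'M[R]_(n + 1)) V a W l :
  V *m V^T = 1%:M -> W *m W^T = 1%:M -> ulsubmx A = spmx V a -> A = spmx W l ->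
  disjoint_roots A <-> forall i j, l 0 j != a 0 i.
Proof.
move=> VV WW Aul AE; split=> [dj i j|dis x].
  apply/eqP => e; apply: (dj (l 0 j)).
    by rewrite Aul; apply/(root_char_poly_spmx _ _ VV); exists i.
  by rewrite AE; apply/(root_char_poly_spmx _ _ WW); exists j.
rewrite Aul AE => /(root_char_poly_spmx _ _ VV)[i ->].
move=> /(root_char_poly_spmx _ _ WW)[j /esym/eqP].
by rewrite (negbTE (dis i j)).
Qed.

(** The eigenvalue relation border_eigen can be divided by l j - a i. *)
Lemma border_cauchymx n (A : 'M[R]_(n + 1)) V a W l :
  V *m V^T = 1%:M -> W *m W^T = 1%:M -> ulsubmx A = spmx V a -> A = spmx W l ->
  (forall i j, l 0 j != a 0 i) ->
  col_mx (V *m incl R n *m W^T) (last_row R n *m W^T) =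
  cauchymx a l (fun i => (V *m ursubmx A) i 0) (fun j => (last_row R n *m W^T) 0 j).
Proof.
move=> VV WW Aul AE dis; congr col_mx.
  apply/matrixP => i j; rewrite [RHS]mxE -(border_eigen VV WW Aul AE) mulfK //.
  by rewrite subr_eq0.
by apply/rowP => j; rewrite [RHS]mxE.
Qed.

(** The change of basis between the corner and A is an orthogonal Cauchy matrix;
    cauchy_transfer turns it into the one that represents Q(A). *)
Lemma Qmx_orth_generic n (A : 'M[R]_(n + 1)) : A^T = A -> disjoint_roots A ->
  Qmx A *m (Qmx A)^T = 1%:M.
Proof.
move=> At dj; have [W [l [WW AE]]] := sym_spmxP At.
have [V [a [VV Aul]]] := sym_spmxP (sym_ulsubmx At).
have dis := (disjoint_roots_dis VV WW Aul AE).1 dj.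
have BC := border_cauchymx VV WW Aul AE dis.
have CC := border_orth VV WW; rewrite BC in CC.
have [ainj linj] := cauchymx_inj CC.
have sq := cauchy_orthonormal_squares ainj linj dis ((cauchymx_orthP _ _ _ _).1 CC).
have {}sq := (cauchy_transfer _ _ ainj linj).1 sq.
pose ea := map_mx (@expR R) a; pose el := map_mx (@expR R) l.
have eaE i : ea 0 i = expR (a 0 i) by rewrite /ea mxE.
have elE j : el 0 j = expR (l 0 j) by rewrite /el mxE.
have edis i j : el 0 j != ea 0 i by rewrite eaE elE (inj_eq (@expR_inj R)).
have eainj : injective (ea 0).
  by move=> i i'; rewrite !eaE => /(@expR_inj R)/ainj.
have elinj : injective (el 0).
  by move=> i i'; rewrite !elE => /(@expR_inj R)/linj.
have eaf : ea 0 = (fun i => expR (a 0 i)) by apply/funext => i.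
have elf : el 0 = (fun i => expR (l 0 i)) by apply/funext => i.
rewrite -eaf -elf in sq.
have on := cauchy_squares_orthonormal eainj elinj edis sq.
have /(cauchymx_orthP ea el) {}on := on.
set B := block_mx V 0 0 1%:M : 'M[R]_(n + 1).
have BB : B *m B^T = 1%:M by exact: block1_orth.
have QE : B *m Qmx A *m W^T = cauchymx ea el
   (fun i => (V *m ursubmx A) i 0 * expR (hval a l (a 0 i)))
   (fun j => (last_row R n *m W^T) 0 j * expR (hval l a (l 0 j))).
  rewrite (Qmx_spmx VV WW Aul AE); congr col_mx.
    apply/matrixP => i j; rewrite [LHS]mxE [RHS]mxE eaE elE -expddM.
    have := border_eigen VV WW Aul AE i j.
    move: ((V *m incl R n *m W^T) i j) ((V *m ursubmx A) i 0) => t x.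
    move: ((last_row R n *m W^T) 0 j) => y e.
    rewrite expddC; have f0 : expdd (l 0 j) (a 0 i) != 0 by rewrite gt_eqF ?expdd_gt0.
    have d0 : l 0 j - a 0 i != 0 by rewrite subr_eq0.
    have -> : t = x * y / (l 0 j - a 0 i) by rewrite -e mulfK.
    by field; rewrite f0 d0.
  by apply/rowP => j; rewrite [LHS]mxE [RHS]mxE mulrC.
have -> : Qmx A = B^T *m (B *m Qmx A *m W^T) *m W.
  by rewrite !mulmxA (mulmx1C BB) mul1mx -mulmxA (mulmx1C WW) mulmx1.
rewrite QE; move: on; set C := cauchymx _ _ _ _ => on.
rewrite !trmx_mul trmxK !mulmxA -[_ *m W *m _]mulmxA WW mulmx1.
by rewrite -[_ *m C *m _]mulmxA on mulmx1; exact: mulmx1C.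
Qed.

End Generic.

(** * Conjugation of exp A by Q(A) *)

Section StepAlgebra.
Variables (R : realType) (n : nat).
Implicit Type A : 'M[R]_(n + 1).

Lemma hmx_comm m p (X : 'M[R]_m) (Y : 'M[R]_p) : X^T = X -> Y^T = Y ->
  hmx X Y *m expmx X = expmx X *m hmx X Y.
Proof.
move=> /sym_spmxP[V [d [VV ->]]] /sym_spmxP[W [e [WW ->]]].
rewrite (hmx_spmx _ _ VV WW) (expmx_spmx _ VV) !(spmxM VV).
by apply: (congr1 (spmx V)); apply/rowP => i; rewrite [LHS]mxE [RHS]mxE mulrC.
Qed.

(** In eigenbases, passing from A to exp A multiplies the Sylvester operator by
    expdd, which core divides out; what remains is incl_mul. *)
Lemma core_intertwine A : A^T = A ->
  core A *m expmx A = expmx (ulsubmx A) *m core A + ursubmx A *m last_row R n.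
Proof.
move=> At; have [W [l [WW AE]]] := sym_spmxP At.
have [V [a [VV Aul]]] := sym_spmxP (sym_ulsubmx At).
(* Both sides are Sylvester operators, to be compared in eigenbases. *)
suff e : expmx (ulsubmx A) *m core A - core A *m expmx A
    = ulsubmx A *m incl R n - incl R n *m A.
  rewrite -[LHS]opprK -[X in _ = X + _](subrK (core A *m expmx A)) e incl_mul.
  by rewrite opprD addrA subrr add0r opprK addrAC addNr add0r.
have cE i j : (V *m core A *m W^T) i j
    = (expdd (a 0 i) (l 0 j))^-1 * (V *m incl R n *m W^T) i j.
  by rewrite (core_spmx VV WW Aul AE) mxE.
have eA : expmx A = spmx W (map_mx (@expR R) l) by rewrite {1}AE expmx_spmx.
have eU : expmx (ulsubmx A) = spmx V (map_mx (@expR R) a).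
  by rewrite {1}Aul expmx_spmx.
apply/eqP; rewrite -subr_eq0; apply/eqP; apply: (orthJ_eq0 VV WW).
rewrite mulmxBr mulmxBl; apply/eqP; rewrite subr_eq0; apply/eqP/matrixP => i j.
rewrite eU eA (spmx_diff _ _ _ _ _ VV WW) cE.
have -> : ulsubmx A *m incl R n - incl R n *m A
    = spmx V a *m incl R n - incl R n *m spmx W l by rewrite -Aul -AE.
rewrite (spmx_diff _ _ _ _ _ VV WW) mulrA; congr (_ * _).
rewrite [map_mx _ a 0 i]mxE [map_mx _ l 0 j]mxE -expddM.
by rewrite mulrAC divff ?mul1r // gt_eqF // expdd_gt0.
Qed.

(** Multiplying core_intertwine by the functions hmx, which commute with the
    exponentials. *)
Lemma Qtop_intertwine A : A^T = A ->
  Qtop A *m expmx A = expmx (ulsubmx A) *m Qtop A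
     + hmx (ulsubmx A) A *m ursubmx A *m Qbot A.
Proof.
move=> At; have Ut := sym_ulsubmx At.
have s1 : Qtop A *m expmx A
    = hmx (ulsubmx A) A *m (core A *m expmx A) *m hmx A (ulsubmx A).
  by rewrite /Qtop -mulmxA (hmx_comm At Ut) !mulmxA.
have s2 : hmx (ulsubmx A) A *m (expmx (ulsubmx A) *m core A) *m hmx A (ulsubmx A)
    = expmx (ulsubmx A) *m Qtop A.
  by rewrite mulmxA (hmx_comm Ut At) /Qtop !mulmxA.
have s3 : hmx (ulsubmx A) A *m (ursubmx A *m last_row R n) *m hmx A (ulsubmx A)
    = hmx (ulsubmx A) A *m ursubmx A *m Qbot A.
  by rewrite /Qbot !mulmxA.
by rewrite s1 (core_intertwine At) mulmxDr mulmxDl s2 s3.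
Qed.

(** By Qtop_intertwine, since the rows of Q(A) are orthonormal. *)
Lemma Qmx_conj A : A^T = A -> Qmx A *m (Qmx A)^T = 1%:M ->
  let B := Qmx A *m expmx A *m (Qmx A)^T in
  ulsubmx B = expmx (ulsubmx A) /\ ursubmx B = hmx (ulsubmx A) A *m ursubmx A.
Proof.
move=> At QQ B; have := QQ; rewrite /Qmx tr_col_mx mul_col_row.
rewrite (scalar_mx_block n 1 (1 : R)) => /eq_block_mx[tt tb bt bb].
have -> : B = block_mx (Qtop A *m expmx A *m (Qtop A)^T)
   (Qtop A *m expmx A *m (Qbot A)^T) (Qbot A *m expmx A *m (Qtop A)^T)
   (Qbot A *m expmx A *m (Qbot A)^T).
  by rewrite /B /Qmx tr_col_mx mul_col_mx mul_col_row.
rewrite block_mxKul block_mxKur (Qtop_intertwine At) !mulmxDl.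
split.
  by rewrite -mulmxA tt mulmx1 -[X in _ + X]mulmxA bt mulmx0 addr0.
by rewrite -mulmxA tb mulmx0 add0r -[X in X = _]mulmxA bb mulmx1.
Qed.

End StepAlgebra.

(** * Smoothness of Q(A) *)

Section StepSmooth.
Variables (R : realType) (E : normedModType R) (V U : set E).
Hypothesis oU : open_along V U.

Lemma Ck_on_ptrace k m n (f : E -> 'M[R]_(m * n)) :
  Ck_on k V U f -> Ck_on k V U (fun x => ptrace (f x)).
Proof.
move=> /(Ck_on_mxP oU) fC; apply/(Ck_on_mxP oU) => i j.
by under eq_fun do rewrite mxE; apply: (Ck_on_sum oU) => p; exact: fC.
Qed.

Lemma Ck_on_hexp k m n (f : E -> 'M[R]_m) (g : E -> 'M[R]_n) :
  Ck_on k V U f -> Ck_on k V U g ->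
  (forall x, U x -> (f x)^T = f x) -> (forall x, U x -> (g x)^T = g x) ->
  Ck_on k V U (fun x => hexp (f x) (g x)).
Proof.
move=> fC gC ft gt; apply: (Ck_on_scalemx oU); apply: (Ck_onD oU).
  apply: (Ck_onD oU) => //; apply: Ck_on_ptrace; apply: (Ck_on_logmx oU).
    exact: (Ck_on_ddmx oU).
  by move=> x Ux; apply: SymPos_ddmx; [exact: ft | exact: gt].
apply: (Ck_on_oppmx oU); apply: Ck_on_ptrace; apply: (Ck_on_logmx oU).
  exact: (Ck_on_ddmx oU).
by move=> x Ux; apply: SymPos_ddmx; exact: ft.
Qed.

Lemma Ck_on_hmx k m n (f : E -> 'M[R]_m) (g : E -> 'M[R]_n) :
  Ck_on k V U f -> Ck_on k V U g ->
  (forall x, U x -> (f x)^T = f x) -> (forall x, U x -> (g x)^T = g x) ->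
  Ck_on k V U (fun x => hmx (f x) (g x)).
Proof. by move=> *; apply: (Ck_on_expmx oU); exact: Ck_on_hexp. Qed.

Lemma Ck_on_invhmx k m n (f : E -> 'M[R]_m) (g : E -> 'M[R]_n) :
  Ck_on k V U f -> Ck_on k V U g ->
  (forall x, U x -> (f x)^T = f x) -> (forall x, U x -> (g x)^T = g x) ->
  Ck_on k V U (fun x => invhmx (f x) (g x)).
Proof.
by move=> *; apply: (Ck_on_expmx oU); apply: (Ck_on_oppmx oU); exact: Ck_on_hexp.
Qed.

Lemma Ck_on_ulsubmx k m1 m2 n1 n2 (f : E -> 'M[R]_(m1 + m2, n1 + n2)) :
  Ck_on k V U f -> Ck_on k V U (fun x => ulsubmx (f x)).
Proof.
move=> /(Ck_on_mxP oU) fC; apply/(Ck_on_mxP oU) => i j.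
by under eq_fun do rewrite !mxE; exact: fC.
Qed.

Lemma Ck_on_col_mx k m1 m2 p (f : E -> 'M[R]_(m1, p)) (g : E -> 'M[R]_(m2, p)) :
  Ck_on k V U f -> Ck_on k V U g -> Ck_on k V U (fun x => col_mx (f x) (g x)).
Proof.
move=> /(Ck_on_mxP oU) fC /(Ck_on_mxP oU) gC; apply/(Ck_on_mxP oU) => i j.
rewrite -[i]splitK; case: (fintype.split i) => i' /=.
- by under eq_fun do rewrite col_mxEu; exact: fC.
- by under eq_fun do rewrite col_mxEd; exact: gC.
Qed.

Lemma Ck_on_Qmx k n (f : E -> 'M[R]_(n + 1)) :
  Ck_on k V U f -> (forall x, U x -> (f x)^T = f x) ->
  Ck_on k V U (fun x => Qmx (f x)).
Proof.
move=> fC ft; have uC := Ck_on_ulsubmx fC.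
have ut x : U x -> (ulsubmx (f x))^T = ulsubmx (f x).
  by move=> /ft/sym_ulsubmx.
have cC m p (M : 'M[R]_(m, p)) : Ck_on k V U (fun=> M) by exact: (Ck_on_cst oU).
have kC : Ck_on k V U (fun x => hmx (f x) (ulsubmx (f x))) by exact: Ck_on_hmx.
apply: Ck_on_col_mx; last exact: (Ck_on_mulmx oU).
apply: (Ck_on_mulmx oU) => //; apply: (Ck_on_mulmx oU); first exact: Ck_on_hmx.
apply: (Ck_on_untvec oU); apply: (Ck_on_mulmx oU) => //.
exact: (Ck_on_invddmx oU).
Qed.

End StepSmooth.

(** * Krylov matrices and common eigenvalues *)

Section Krylov.
Variable R : realType.

(** Its determinant is a polynomial in the entries, which detects cyclicity of d. *)
Definition krylov n (M : 'M[R]_n) (d : 'cV[R]_n) : 'M[R]_n :=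
  \matrix_(i, j) (M ^+ j *m d) i 0.

Lemma spmx_exp_mul n (V : 'M[R]_n) (a : 'rV[R]_n) (d : 'cV[R]_n) k i :
  V *m V^T = 1%:M -> (V *m (spmx V a ^+ k *m d)) i 0 = a 0 i ^+ k * (V *m d) i 0.
Proof.
move=> VV; elim: k i => [|k IH] i; first by rewrite !expr0 mul1mx mul1r.
have -> : spmx V a ^+ k.+1 *m d = spmx V a *m (spmx V a ^+ k *m d).
  by rewrite exprS -mulmxA.
rewrite mulmxA mul_spmx // -mulmxA mul_diag_mx mxE IH.
by rewrite exprS mulrA.
Qed.

(** In an eigenbasis a Krylov matrix is a Vandermonde matrix with rescaled rows. *)
Lemma krylov_spmx n (V : 'M[R]_n) (a : 'rV[R]_n) (d : 'cV[R]_n) :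
  V *m V^T = 1%:M ->
  V *m krylov (spmx V a) d = diag_mx (V *m d)^T *m (Vandermonde n a)^T.
Proof.
move=> VV; apply/matrixP => i j; rewrite mul_diag_mx [RHS]mxE.
have -> : (V *m krylov (spmx V a) d) i j = (V *m (spmx V a ^+ j *m d)) i 0.
  by rewrite mxE [RHS]mxE; apply: eq_bigr => k _; rewrite [X in _ * X]mxE.
rewrite spmx_exp_mul // mulrC; congr (_ * _); first by rewrite [RHS]mxE.
by rewrite [RHS]mxE [RHS]mxE.
Qed.

Lemma orth_det_neq0 n (V : 'M[R]_n) : V *m V^T = 1%:M -> \det V != 0.
Proof.
move=> VV; have := congr1 determinant VV; rewrite det_mulmx det_tr det1.
by move=> e; apply/eqP => d0; move: e; rewrite d0 mul0r => /eqP; rewrite eq_sym oner_eq0.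
Qed.

Lemma det_krylov n (V : 'M[R]_n) (a : 'rV[R]_n) (d : 'cV[R]_n) :
  V *m V^T = 1%:M ->
  (\det (krylov (spmx V a) d) != 0) <->
  (forall i, (V *m d) i 0 != 0) /\ injective (a 0).
Proof.
move=> VV; have := congr1 determinant (krylov_spmx a d VV).
rewrite !det_mulmx det_tr det_diag det_Vandermonde => e.
have -> : \det (krylov (spmx V a) d) != 0 = (\det V * \det (krylov (spmx V a) d) != 0).
  by rewrite mulf_eq0 (negbTE (orth_det_neq0 VV)).
rewrite e mulf_eq0 negb_or; split.
  case/andP=> /prodf_neq0 h1 /prodf_neq0 h2; split=> [i|i j aij].
    by have := h1 i isT; rewrite [_^T _ _]mxE.
  apply/eqP; apply: contraT => ij.
  wlog lij : i j aij ij / (i < j)%N.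
    move=> hw; have : (i < j)%N || (j < i)%N by rewrite -neq_ltn.
    case/orP; first exact: hw.
    by apply: hw => //; rewrite eq_sym.
  have := h2 i isT => /prodf_neq0/(_ j lij).
  by rewrite aij subrr eqxx.
case=> b0 ainj; apply/andP; split.
  by apply/prodf_neq0 => i _; rewrite [_^T _ _]mxE.
apply/prodf_neq0 => i _; apply/prodf_neq0 => j lij.
rewrite subr_eq0 (inj_eq ainj) eq_sym; apply/eqP => ij.
by rewrite ij ltnn in lij.
Qed.

(** A polynomial criterion for the absence of common eigenvalues: the border must
    be a cyclic vector for the corner. *)
Lemma disjoint_roots_krylov n (A : 'M[R]_(n + 1)) : A^T = A ->
  disjoint_roots A <-> \det (krylov (ulsubmx A) (ursubmx A)) != 0.
Proof.
move=> At; have [W [l [WW AE]]] := sym_spmxP At.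
have [V [a [VV Aul]]] := sym_spmxP (sym_ulsubmx At).
rewrite (disjoint_roots_dis VV WW Aul AE) Aul det_krylov //; split=> [dis|[b0 ainj]].
  have BC := border_cauchymx VV WW Aul AE dis.
  have CC := border_orth VV WW; rewrite BC in CC.
  have [ainj _] := cauchymx_inj CC; split=> // i.
  have [c1 _ _] := (cauchymx_orthP _ _ _ _).1 CC.
  apply/eqP => bi; have := c1 i i; rewrite eqxx bi big1 => [/eqP|j _].
    by rewrite eq_sym oner_eq0.
  by rewrite !mul0r.
(* If l j = a i, the j-th eigenvector of A has last coordinate w j = 0, so it is
   a multiple of the i-th eigenvector of the corner. It is also orthogonal to the
   border, whose i-th coordinate is not zero, hence it vanishes. *)
move=> i j; apply/eqP => lj.
have bT := border_eigen VV WW Aul AE.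
set T := V *m incl R n *m W^T in bT; set w := last_row R n *m W^T in bT.
have wj : w 0 j = 0.
  have := bT i j; rewrite lj subrr mulr0 => /esym/eqP.
  by rewrite mulf_eq0 (negbTE (b0 i)) /= => /eqP.
have Tj i' : i' != i -> T i' j = 0.
  move=> ii'; have := bT i' j; rewrite wj mulr0 => /eqP.
  by rewrite mulf_eq0 subr_eq0 lj (inj_eq ainj) [i == _]eq_sym (negbTE ii') orbF => /eqP.
have wA : w *m diag_mx l = (V *m ursubmx A)^T *m T + drsubmx A *m w.
  rewrite /w /T -mulmxA; have -> : W^T *m diag_mx l = A *m W^T.
    by rewrite {1}AE /spmx -!mulmxA WW mulmx1.
  have -> : last_row R n *m (A *m W^T)
      = (dlsubmx A *m incl R n + drsubmx A *m last_row R n) *m W^T.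
    rewrite mulmxA; congr (_ *m _); rewrite /incl /last_row -{1}[A]submxK mul_row_block.
    rewrite !mul_mx_row !(mul1mx, mul0mx, mulmx1, mulmx0, addr0, add0r) add_row_mx.
    by rewrite addr0 add0r.
  rewrite mulmxDl (sym_dlsubmx At) trmx_mul !mulmxA; congr (_ *m _ *m _ + _).
  by rewrite -mulmxA (mulmx1C VV) mulmx1.
have Tij : T i j = 0.
  have /matrixP/(_ 0 j) := wA; rewrite mul_mx_diag [LHS]mxE wj mul0r [RHS]mxE.
  rewrite [X in _ + X]mxE big_ord1 wj mulr0 addr0 [RHS]mxE (bigD1 i) //= big1.
    rewrite addr0 [_^T _ _]mxE => /esym/eqP.
    by rewrite mulf_eq0 (negbTE (b0 i)) /= => /eqP.
  by move=> i' ii'; rewrite Tj // mulr0.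
have /matrixP/(_ j j) := mulmx1C (border_orth VV WW (n:=n)).
rewrite tr_col_mx mul_row_col -/T -/w [LHS]mxE [X in X + _]mxE [X in _ + X]mxE.
rewrite big_ord1 wj mulr0 addr0 big1 => [|i' _].
  by rewrite [RHS]mxE eqxx => /eqP; rewrite eq_sym oner_eq0.
by have [->|ii'] := eqVneq i' i; rewrite ?Tij ?Tj // mulr0.
Qed.

End Krylov.

(** * Polynomial families of matrices *)

Section PolynomialPaths.
Variable R : realType.

Definition polyfun (f : R -> R) : Prop := exists p : {poly R}, forall t, f t = p.[t].

Lemma polyfun_cst c : polyfun (fun=> c).
Proof. by exists c%:P => t; rewrite hornerC. Qed.

Lemma polyfun_id : polyfun id.
Proof. by exists 'X => t; rewrite hornerX. Qed.

Lemma polyfunD f g : polyfun f -> polyfun g -> polyfun (fun t => f t + g t).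
Proof. by move=> [p pE] [q qE]; exists (p + q) => t; rewrite hornerD pE qE. Qed.

Lemma polyfunM f g : polyfun f -> polyfun g -> polyfun (fun t => f t * g t).
Proof. by move=> [p pE] [q qE]; exists (p * q) => t; rewrite hornerM pE qE. Qed.

Lemma polyfun_sum (I : Type) (r : seq I) (f : I -> R -> R) :
  (forall i, polyfun (f i)) -> polyfun (fun t => \sum_(i <- r) f i t).
Proof.
move=> fp; elim: r => [|i r IH].
  by under eq_fun do rewrite big_nil; exact: polyfun_cst.
by under eq_fun do rewrite big_cons; exact: polyfunD.
Qed.

Lemma polyfun_prod (I : Type) (r : seq I) (f : I -> R -> R) :
  (forall i, polyfun (f i)) -> polyfun (fun t => \prod_(i <- r) f i t).
Proof.
move=> fp; elim: r => [|i r IH].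
  by under eq_fun do rewrite big_nil; exact: polyfun_cst.
by under eq_fun do rewrite big_cons; exact: polyfunM.
Qed.

Definition polymx m n (f : R -> 'M[R]_(m, n)) : Prop :=
  forall i j, polyfun (fun t => f t i j).

Lemma polymx_mul m n p (f : R -> 'M[R]_(m, n)) (g : R -> 'M[R]_(n, p)) :
  polymx f -> polymx g -> polymx (fun t => f t *m g t).
Proof.
move=> fp gp i j; under eq_fun do rewrite mxE.
by apply: polyfun_sum => k; exact: polyfunM.
Qed.

Lemma polymx_exp n (f : R -> 'M[R]_n) k :
  polymx f -> polymx (fun t => f t ^+ k).
Proof.
move=> fp; elim: k => [|k IH].
  by under eq_fun do rewrite expr0; move=> i j; exact: polyfun_cst.
by under eq_fun do rewrite exprS; exact: polymx_mul.
Qed.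

Lemma polyfun_det n (f : R -> 'M[R]_n) : polymx f -> polyfun (fun t => \det (f t)).
Proof.
move=> fp; apply: polyfun_sum => s; apply: polyfunM; first exact: polyfun_cst.
by apply: polyfun_prod => i; exact: fp.
Qed.

Lemma polymx_krylov n (f : R -> 'M[R]_n) (d : R -> 'cV[R]_n) :
  polymx f -> polymx d -> polymx (fun t => krylov (f t) (d t)).
Proof.
move=> fp dp i j; under eq_fun do rewrite mxE.
by apply: polymx_mul; first exact: polymx_exp.
Qed.

Definition segment_mx n (A C : 'M[R]_n) (t : R) : 'M[R]_n := A + t *: (C - A).

Lemma segment_mx1 n (A C : 'M[R]_n) : segment_mx A C 1 = C.
Proof. by rewrite /segment_mx scale1r addrC subrK. Qed.

Lemma segment_mx_sym n (A C : 'M[R]_n) t : A^T = A -> C^T = C ->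
  (segment_mx A C t)^T = segment_mx A C t.
Proof. by move=> At Ct; rewrite /segment_mx linearD linearZ linearB /= At Ct. Qed.

Lemma polymx_segment n (A C : 'M[R]_n) : polymx (segment_mx A C).
Proof.
move=> i j; under eq_fun do rewrite mxE [X in _ + X]mxE.
apply: polyfunD; first exact: polyfun_cst.
by apply: polyfunM; [exact: polyfun_id | exact: polyfun_cst].
Qed.

Lemma ulsubmx_segment n (A C : 'M[R]_(n + 1)) t :
  ulsubmx (segment_mx A C t) = segment_mx (ulsubmx A) (ulsubmx C) t.
Proof. by apply/matrixP => i j; rewrite !mxE. Qed.

(** By dividing out the power of 'X - a%:P. *)
Lemma poly_neq0_near (p : {poly R}) (a : R) : p != 0 ->
  \forall t \near a^', p.[t] != 0.
Proof.
move=> p0; have [m [q]] := multiplicity_XsubC p a.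
rewrite p0 /= => qa pE.
have qc : \forall t \near a^', q.[t] != 0.
  apply: nbhs_dnbhs; have := @continuous_horner R q a.
  by move/cvgr_neq0; apply.
near=> t; rewrite pE hornerM mulf_neq0 //; first by near: t.
rewrite horner_exp expf_neq0 // !hornerE subr_eq0; near: t.
exact: nbhs_dnbhs_neq.
Unshelve. all: by end_near. Qed.

(** Along a segment the determinant of disjoint_roots_krylov is a polynomial,
    which does not vanish at the end C. *)
Lemma disjoint_roots_segment n (A C : 'M[R]_(n + 1)) : A^T = A -> C^T = C ->
  disjoint_roots C ->
  exists2 p : {poly R}, p != 0 & forall t, p.[t] != 0 ->
    disjoint_roots (segment_mx A C t).
Proof.
move=> At Ct dC; pose f t := \det (krylov (ulsubmx (segment_mx A C t))
  (ursubmx (segment_mx A C t))).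
have [p pE] : polyfun f.
  apply: polyfun_det; apply: polymx_krylov => i j.
    have -> : (fun t => ulsubmx (segment_mx A C t) i j)
        = (fun t => segment_mx A C t (lshift 1 i) (lshift 1 j)).
      by apply/funext => t; rewrite !mxE.
    exact: polymx_segment.
  have -> : (fun t => ursubmx (segment_mx A C t) i j)
      = (fun t => segment_mx A C t (lshift 1 i) (rshift n j)).
    by apply/funext => t; rewrite !mxE.
  exact: polymx_segment.
exists p => [|t]; last first.
  by rewrite -pE => ft; apply/disjoint_roots_krylov => //; exact: segment_mx_sym.
apply/eqP => p0; have := pE 1; rewrite p0 horner0 /f segment_mx1.
by apply/eqP; exact/(disjoint_roots_krylov Ct).
Qed.

End PolynomialPaths.

(** * Density of the generic matrices *)

Section Genericity.
Variable R : realType.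

Definition corner_char_poly n (A : 'M[R]_n) (k : 'I_n) : {poly R} :=
  char_poly (principal_submx k A).

Lemma char_poly_mxsub_id m n (f : 'I_m -> 'I_n) (A : 'M[R]_n) :
  m = n -> (forall i, f i = i :> nat) -> char_poly (mxsub f f A) = char_poly A.
Proof.
move=> e; case: _ / e A f => A f fi; congr char_poly; apply/matrixP => i j.
by rewrite mxE; congr (A _ _); apply/val_inj; rewrite /= fi.
Qed.

Lemma corner_char_poly_last n (A : 'M[R]_n) (k : 'I_n) : k.+1 = n ->
  corner_char_poly A k = char_poly A.
Proof. by move=> kn; apply: char_poly_mxsub_id. Qed.

Lemma corner_char_poly_ul n (A : 'M[R]_(n + 1)) (k : 'I_(n + 1)) (k' : 'I_n) :
  k = k' :> nat -> corner_char_poly A k = corner_char_poly (ulsubmx A) k'.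
Proof.
move=> kk'; rewrite /corner_char_poly /principal_submx.
set g := widen_ord (ltn_ord k').
have sk : k.+1 = k'.+1 by rewrite kk'.
rewrite -(@char_poly_mxsub_id _ _ (cast_ord sk) (mxsub g g (ulsubmx A))) //.
congr char_poly; apply/matrixP => i j; rewrite !mxE.
by congr (A _ _); apply/val_inj.
Qed.

(** The condition under which the corner spectra determine all borders up to the
    signs of their coordinates; it holds on a dense set. *)
Definition generic n (A : 'M[R]_n) : Prop :=
  forall k k' : 'I_n, k' = k.+1 :> nat -> forall x,
    root (corner_char_poly A k) x -> root (corner_char_poly A k') x -> False.

Lemma generic_ind n (A : 'M[R]_(n + 1)) :
  generic A <-> generic (ulsubmx A) /\ disjoint_roots A.
Proof.
split=> [gA|[gU dA] k k' kk' x].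
  split=> [k k' kk' x|x rU rA].
    rewrite -(@corner_char_poly_ul _ A (lshift 1 k)) //.
    by rewrite -(@corner_char_poly_ul _ A (lshift 1 k')) //; exact: gA.
  have [n0|n0] := posnP n.
    have := root_size_gt1 (monic_neq0 (char_poly_monic (ulsubmx A))) rU.
    by rewrite size_char_poly n0.
  have ln : (n.-1 < n)%N by rewrite prednK.
  apply: (gA (lshift 1 (Ordinal ln)) (rshift n 0) _ x).
  - by rewrite /= addn0 prednK.
  - by rewrite (@corner_char_poly_ul _ A _ (Ordinal ln)) // corner_char_poly_last //= prednK.
  - by rewrite corner_char_poly_last //= addn0 addn1.
have kn : (k < n)%N by have := ltn_ord k'; rewrite kk' -[X in (_ < X)%N]/(n + 1)%N; lia.
rewrite (@corner_char_poly_ul _ A k (Ordinal kn)) //.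
have [k'n|k'n] := ltnP k' n.
  by rewrite (@corner_char_poly_ul _ A k' (Ordinal k'n)) //; exact: gU.
have k'E : nat_of_ord k' = n.
  by have := ltn_ord k'; lia.
have kE : k.+1 = n by rewrite -kk'.
rewrite corner_char_poly_last // corner_char_poly_last ?k'E ?addn1 //.
exact: dA.
Qed.

Lemma generic0 (A : 'M[R]_0) : generic A.
Proof. by case. Qed.

Lemma disjoint_roots_simple n (A : 'M[R]_(n + 1)) W l : A^T = A ->
  disjoint_roots A -> W *m W^T = 1%:M -> A = spmx W l -> injective (l 0).
Proof.
move=> At dA WW AE; have [V [a [VV Aul]]] := sym_spmxP (sym_ulsubmx At).
have dis := (disjoint_roots_dis VV WW Aul AE).1 dA.
have CC := border_orth VV WW; rewrite (border_cauchymx VV WW Aul AE dis) in CC.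
by have [] := cauchymx_inj CC.
Qed.

Lemma block_mx_sym n (M : 'M[R]_n) (d : 'cV[R]_n) (c : 'M[R]_1) : M^T = M ->
  (block_mx M d d^T c)^T = block_mx M d d^T c.
Proof.
move=> Mt; rewrite tr_block_mx Mt trmxK; congr block_mx.
by apply/matrixP => i j; rewrite !ord1 mxE.
Qed.

(** A generic matrix with simple spectrum is bordered by a vector with no zero
    coordinate in its eigenbasis. *)
Lemma generic_exists n : exists2 C : 'M[R]_n, C^T = C & generic C /\
  forall W l, W *m W^T = 1%:M -> C = spmx W l -> injective (l 0).
Proof.
elim: n => [|n [C Ct [gC sC]]].
  by exists 0; [rewrite trmx0 | split=> [|W l _ _ []//]; exact: generic0].
rewrite -addn1.
have [V [a [VV CE]]] := sym_spmxP Ct.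
(* All coordinates of d in the eigenbasis V are 1. *)
pose d : 'cV[R]_n := V^T *m const_mx 1.
pose D := block_mx C d d^T (0 : 'M[R]_1).
have Dt : D^T = D by exact: block_mx_sym.
have dD : disjoint_roots D.
  apply/(disjoint_roots_krylov Dt); rewrite /D block_mxKul block_mxKur CE.
  apply/det_krylov => //; split; last exact: sC CE.
  by move=> i; rewrite /d mulmxA VV mul1mx mxE oner_neq0.
exists D => //; split; last by move=> W l; exact: disjoint_roots_simple.
by apply/generic_ind; split=> //; rewrite /D block_mxKul.
Qed.

(** By generic_ind the bad parameters are the roots of a product of polynomials. *)
Lemma generic_segment n (A C : 'M[R]_n) : A^T = A -> C^T = C -> generic C ->
  exists2 p : {poly R}, p != 0 & forall t, p.[t] != 0 -> generic (segment_mx A C t).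
Proof.
elim: n A C => [|n IH] A C.
  by move=> _ _ _; exists 1; [exact: oner_neq0 | move=> t _; exact: generic0].
move: A C; rewrite -addn1 => A C At Ct /generic_ind[gU dC].
have [p p0 pg] := IH _ _ (sym_ulsubmx At) (sym_ulsubmx Ct) gU.
have [q q0 qg] := disjoint_roots_segment At Ct dC.
exists (p * q); first by rewrite mulf_neq0.
move=> t; rewrite hornerM mulf_eq0 negb_or => /andP[pt qt].
by apply/generic_ind; split; [rewrite ulsubmx_segment; exact: pg | exact: qg].
Qed.

Lemma cvg_segment n (A C : 'M[R]_n) : segment_mx A C t @[t --> (0 : R)^'] --> A.
Proof.
rewrite -[X in _ --> X]addr0 -[X in A + X](scale0r (C - A)).
apply: cvgD; first exact: cvg_cst.
by apply: cvgZr_tmp; exact: nbhs_dnbhs.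
Qed.

Lemma generic_near n (A : 'M[R]_n) : A^T = A ->
  exists2 C : 'M[R]_n, C^T = C & \forall t \near (0 : R)^', generic (segment_mx A C t).
Proof.
move=> At; have [C Ct [gC _]] := generic_exists n.
have [p p0 pg] := generic_segment At Ct gC.
by exists C => //; apply: filterS (poly_neq0_near 0 p0) => t; exact: pg.
Qed.

Lemma generic_disjoint n (A : 'M[R]_(n + 1)) : generic A -> disjoint_roots A.
Proof. by move/generic_ind => []. Qed.

End Genericity.

(** * Q(A) belongs to SO for every symmetric A *)

Section SymCalculus.
Variable R : realType.

Lemma Ck_on_id k (E : normedModType R) (V U : set E) : open_along V U ->
  Ck_on k V U (fun x => x).
Proof.
move=> oU; have C0 : Ck_on 0 V U (fun x => x) by apply: Ck_on0 => x _; exact: cvg_within.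
case: k => [//|k]; apply: (Ck_onS oU) => // v Vv; exists (fun=> v).
by split=> [x _|]; [exact: is_derive_id | exact: Ck_on_cst].
Qed.

Lemma open_along_Sym n : open_along (@Sym R n) (@Sym R n).
Proof.
move=> A B /SymE At /SymE Bt; near=> h; apply/SymE.
by rewrite linearD linearZ /= At Bt.
Unshelve. all: by end_near. Qed.

Lemma open_along_SymPos n : open_along (@Sym R n) (@SymPos R n).
Proof.
move=> A B Apos /SymE Bt; have [/SymE At _] := Apos.
have cl : (fun h : R => h *: B + A) @ (0 : R) --> A.
  rewrite -[X in _ --> X]add0r -(scale0r B); apply: cvgD; last exact: cvg_cst.
  by apply: cvgZr_tmp.
have : \forall h \near (0 : R), (h *: B + A)^T = h *: B + A -> SymPos (h *: B + A).
  exact: (cl _ (SymPos_open Apos)).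
apply: filterS => h; apply.
by rewrite linearD linearZ /= At Bt.
Qed.

Lemma Ck_on_cvg (E F : normedModType R) (V U : set E) (f : E -> F) x
    (T : Type) (G : set_system T) {FG : Filter G} (g : T -> E) :
  Ck_on 0 V U f -> U x -> g @ G --> x -> (\forall t \near G, U (g t)) ->
  (fun t => f (g t)) @ G --> f x.
Proof.
move=> fC Ux gx Ug.
have gw : g @ G --> within U (nbhs x).
  move=> A xA; suff : \forall t \near G, A (g t) by [].
  near=> t.
  suff h : U (g t) -> A (g t) by apply: h; near: t.
  by near: t; exact: (gx _ xA).
exact: (@cvg_comp _ _ _ g f _ _ _ gw (Ck_on_continuous fC Ux)).
Unshelve. all: by end_near. Qed.

Lemma cvg_Qmx (T : Type) (F : set_system T) {FF : Filter F} n
    (f : T -> 'M[R]_(n + 1)) (A : 'M[R]_(n + 1)) :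
  A^T = A -> f @ F --> A -> (\forall x \near F, (f x)^T = f x) ->
  (fun x => Qmx (f x)) @ F --> Qmx A.
Proof.
move=> At fA ft; have oS := @open_along_Sym (n + 1).
have QC : Ck_on 0 (@Sym R (n + 1)) (@Sym R (n + 1)) (@Qmx R n).
  by apply: (Ck_on_Qmx oS (Ck_on_id 0 oS)) => B /SymE.
apply: (Ck_on_cvg QC) fA _; first exact/SymE.
by apply: filterS ft => x /SymE.
Qed.

(** The generic case and continuity. *)
Lemma Qmx_orth n (A : 'M[R]_(n + 1)) : A^T = A -> Qmx A *m (Qmx A)^T = 1%:M.
Proof.
move=> At; have [C Ct gC] := generic_near At.
have st t : (segment_mx A C t)^T = segment_mx A C t by exact: segment_mx_sym.
have cQ : (fun t => Qmx (segment_mx A C t)) @ (0 : R)^' --> Qmx A.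
  by apply: cvg_Qmx; [exact: At | exact: cvg_segment | near=> t].
have l1 : (fun t => Qmx (segment_mx A C t) *m (Qmx (segment_mx A C t))^T) @ (0 : R)^'
    --> Qmx A *m (Qmx A)^T by apply: cvg_mulmx => //; exact: cvg_trmx.
have l2 : (fun t => Qmx (segment_mx A C t) *m (Qmx (segment_mx A C t))^T) @ (0 : R)^'
    --> (1%:M : 'M[R]_(n + 1)).
  apply: cvg_near_cst; apply: filterS gC => t gt.
  by apply: Qmx_orth_generic => //; exact: generic_disjoint.
exact: (cvg_unique _ l1 l2).
Unshelve. all: by end_near. Qed.

Lemma spmx_zero n : (0 : 'M[R]_n) = spmx 1%:M 0.
Proof. by rewrite /spmx raddf0 mulmx0 mul0mx. Qed.

Lemma Qmx0 n : Qmx (0 : 'M[R]_(n + 1)) = 1%:M.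
Proof.
have O k : (1%:M : 'M[R]_k) *m 1%:M^T = 1%:M by rewrite trmx1 mulmx1.
have z k : \sum_(j < k) ln (expdd 0 ((0 : 'rV[R]_k) 0 j)) = 0.
  by rewrite big1 // => j _; rewrite mxE expddxx expR0 ln1.
have e0 p q : expR (hval (0 : 'rV[R]_p) (0 : 'rV[R]_q) 0) = 1.
  by rewrite /hval !z addr0 subr0 mulr0 expR0.
have U0 : ulsubmx (0 : 'M[R]_(n + 1)) = spmx 1%:M 0.
  by rewrite -spmx_zero; apply/matrixP => i j; rewrite !mxE.
have -> : Qmx (0 : 'M[R]_(n + 1)) = block_mx 1%:M 0 0 1%:M *m Qmx 0 *m 1%:M^T.
  by rewrite -scalar_mx_block mul1mx trmx1 mulmx1.
rewrite (Qmx_spmx (O n) (O (n + 1)%N) U0 (spmx_zero _)).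
apply: (etrans _ (esym (scalar_mx_block n 1 (1 : R)))).
rewrite -[RHS]/(col_mx (incl R n) (last_row R n)).
congr col_mx.
  apply/matrixP => i j; rewrite [LHS]mxE trmx1 mul1mx mulmx1.
  by rewrite ![(0 : 'rV[R]__) 0 _]mxE !e0 expddxx expR0 !mul1r invr1 mul1r.
apply/rowP => j; rewrite [LHS]mxE trmx1 mulmx1.
by rewrite ![(0 : 'rV[R]__) 0 _]mxE e0 mul1r.
Qed.

Lemma continuous_path_pm1 (f : R -> R) : continuous f -> f 0 = 1 ->
  (forall t, f t ^+ 2 = 1) -> f 1 = 1.
Proof.
move=> fc f0 f2; have := f2 1 => /eqP; rewrite sqrf_eq1 => /orP[/eqP//|/eqP f1].
have [] := @IVT R f 0 1 0 ler01 (continuous_subspaceT fc).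
  by rewrite f0 f1 ge_min le_max lerN10 ler01 !orbT.
move=> c _ fc0; have := f2 c; rewrite fc0 expr0n => /eqP.
by rewrite eq_sym oner_eq0.
Qed.

Lemma cvg_ray n (A : 'M[R]_n) (s : R) : (fun t : R => t *: A) @ s --> s *: A.
Proof. by apply: cvgZr_tmp. Qed.

(** The determinant is 1 or -1, and it is 1 at the end 0 of the ray through A. *)
Lemma Qmx_det n (A : 'M[R]_(n + 1)) : A^T = A -> \det (Qmx A) = 1.
Proof.
move=> At; have st (t : R) : (t *: A)^T = t *: A by rewrite linearZ /= At.
rewrite -[A]scale1r.
apply: (@continuous_path_pm1 (fun t => \det (Qmx (t *: A)))) => [s||t].
- apply: cvg_det; apply: cvg_Qmx; [exact: st | exact: cvg_ray |].
  by near=> t.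
- by rewrite scale0r Qmx0 det1.
- have := congr1 determinant (Qmx_orth (st t)).
  by rewrite det_mulmx det_tr det1 expr2.
Unshelve. all: by end_near. Qed.

Lemma Qmx_corner n (A : 'M[R]_(n + 1)) : A^T = A ->
  let B := Qmx A *m expmx A *m (Qmx A)^T in
  ulsubmx B = expmx (ulsubmx A) /\ ursubmx B = hmx (ulsubmx A) A *m ursubmx A.
Proof. by move=> At; apply: Qmx_conj => //; exact: Qmx_orth. Qed.

End SymCalculus.

(** * Recovering a matrix from its corner, border and spectrum *)

Section Surjectivity.
Variable R : realType.

Lemma poly_ext (p q : {poly R}) : (forall x, p.[x] = q.[x]) -> p = q.
Proof.
move=> pq; apply/eqP; rewrite -subr_eq0; apply/eqP.
apply: (@roots_geq_poly_eq0 _ _ [seq i%:R | i <- iota 0 (size (p - q))]).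
- by apply/allP => x _; rewrite rootE hornerD hornerN pq subrr.
- by rewrite map_inj_uniq ?iota_uniq // => i j /eqP; rewrite eqr_nat => /eqP.
- by rewrite size_map size_iota.
Qed.

Lemma horner_char_poly n (M : 'M[R]_n) x : (char_poly M).[x] = \det (x%:M - M).
Proof.
rewrite /char_poly -horner_evalE -det_map_mx; congr (\det _).
apply/matrixP => i j; rewrite !mxE.
by rewrite -[LHS]/(('X *+ (i == j) - (M i j)%:P).[x]) hornerD hornerN hornerMn hornerX hornerC.
Qed.

Lemma mxtrace_spmx n (V : 'M[R]_n) d : V *m V^T = 1%:M ->
  \tr (spmx V d) = \sum_i d 0 i.
Proof.
move=> VV; rewrite /spmx -mulmxA mxtrace_mulC -mulmxA VV mulmx1 mxtrace_diag //.
Qed.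

Lemma SymPos_ulsubmx n (B : 'M[R]_(n + 1)) : SymPos B -> SymPos (ulsubmx B).
Proof.
move=> [/SymE Bt Bpos]; split; first exact/SymE/sym_ulsubmx.
move=> x x0; have y0 : row_mx x (0 : 'M[R]_1) != 0.
  apply: contra x0 => /eqP/(congr1 (@lsubmx _ _ _ _)).
  by rewrite row_mxKl => ->; apply/eqP/rowP => i; rewrite !mxE.
have := Bpos _ y0; rewrite -{1}[B]submxK mul_row_block tr_row_mx mul_row_col.
by rewrite !(mul0mx, addr0) trmx0 mulmx0 addr0.
Qed.

Lemma expmx_logmx_spmx n (M : 'M[R]_n) V d : SymPos M -> V *m V^T = 1%:M ->
  logmx M = spmx V d -> M = spmx V (map_mx (@expR R) d).
Proof. by move=> /logmxK[_ {2}<-] VV ->; rewrite expmx_spmx. Qed.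

Lemma invhmx_spmx m n (V : 'M[R]_m) (W : 'M[R]_n) (d : 'rV[R]_m) (e : 'rV[R]_n) :
  V *m V^T = 1%:M -> W *m W^T = 1%:M ->
  invhmx (spmx V d) (spmx W e) = spmx V (\row_i (expR (hval d e (d 0 i)))^-1).
Proof.
move=> VV WW; rewrite /invhmx (hexp_spmx _ _ VV WW) spmxN (expmx_spmx _ VV).
apply: (congr1 (spmx V)); apply/rowP => i.
by rewrite [LHS]mxE [X in expR X]mxE [X in - X]mxE [RHS]mxE expRN.
Qed.

Section InvBorder.
Variable n : nat.
Implicit Type B : 'M[R]_(n + 1).

(** The factor hmx of Qmx_corner is divided out, for a matrix with corner A' and
    the spectrum of logmx B. *)
Definition border_col (A' : 'M[R]_n) (B : 'M[R]_(n + 1)) : 'cV[R]_n :=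
  invhmx A' (logmx B) *m ursubmx B.

(** The only candidate for a matrix A with corner A' for which Q(A) exp(A) Q(A)^T
    is B; its last entry is forced by the trace. *)
Definition inv_border (A' : 'M[R]_n) (B : 'M[R]_(n + 1)) : 'M[R]_(n + 1) :=
  block_mx A' (border_col A' B) (border_col A' B)^T
    (\tr (logmx B) - \tr A')%:M.

(** The orthogonal Cauchy matrix diagonalizes the bordered diagonal matrix. *)
Lemma cauchymx_conj (a : 'rV[R]_n) (l : 'rV[R]_(n + 1)) b w :
  (forall i j, l 0 j != a 0 i) ->
  cauchymx a l b w *m (cauchymx a l b w)^T = 1%:M ->
  cauchymx a l b w *m diag_mx l *m (cauchymx a l b w)^T =
  block_mx (diag_mx a) (\col_i b i) (\col_i b i)^T (\sum_j l 0 j - \sum_i a 0 i)%:M.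
Proof.
move=> dis KK; set K := cauchymx a l b w in KK *.
have [T [v [KE TE vE]]] : exists (T : 'M[R]_(n, n + 1)) (v : 'rV[R]_(n + 1)),
    [/\ K = col_mx T v, forall i j, T i j * (l 0 j - a 0 i) = b i * w j
      & forall j, v 0 j = w j].
  exists (\matrix_(i, j) (b i * w j / (l 0 j - a 0 i))), (\row_j w j).
  split=> // [i j|j]; last by rewrite mxE.
  by rewrite mxE divfK // subr_eq0.
have Tl : T *m diag_mx l = diag_mx a *m T + (\col_i b i) *m v.
  apply/matrixP => i j; rewrite mul_mx_diag mul_diag_mx !mxE big_ord1 !mxE vE.
  by rewrite -TE; ring.
have := KK; rewrite KE tr_col_mx mul_col_row (scalar_mx_block n 1 (1 : R)).
move=> /eq_block_mx[TT Tv vT vv].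
have -> : col_mx T v *m diag_mx l *m row_mx T^T v^T
    = block_mx (T *m diag_mx l *m T^T) (T *m diag_mx l *m v^T)
       (v *m diag_mx l *m T^T) (v *m diag_mx l *m v^T).
  by rewrite mul_col_mx mul_col_row.
have e11 : T *m diag_mx l *m T^T = diag_mx a.
  by rewrite Tl mulmxDl -!mulmxA TT mulmx1 vT mulmx0 addr0.
have e12 : T *m diag_mx l *m v^T = \col_i b i.
  by rewrite Tl mulmxDl -!mulmxA Tv vv mulmx0 add0r mulmx1.
have e21 : v *m diag_mx l *m T^T = (\col_i b i)^T.
  by rewrite -e12 !trmx_mul trmxK tr_diag_mx mulmxA.
rewrite e11 e12 e21; congr block_mx.
have : \tr (K *m diag_mx l *m K^T) = \sum_j l 0 j.
  by rewrite mxtrace_mulC mulmxA (mulmx1C KK) mul1mx mxtrace_diag.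
rewrite KE tr_col_mx mul_col_mx mul_col_row mxtrace_block e11 mxtrace_diag => e.
rewrite [LHS]mx11_scalar; congr (_%:M).
by rewrite -e addrAC subrr add0r trace_mx11.
Qed.

(** Read backwards, cauchy_transfer turns the Cauchy matrix of B and its corner
    into one at the logarithms, which conjugates diag_mx l to inv_border. *)
Lemma inv_border_generic B : SymPos B -> disjoint_roots B ->
  char_poly (inv_border (logmx (ulsubmx B)) B) = char_poly (logmx B).
Proof.
move=> Bpos dB; have [/SymE Bt _] := Bpos.
have Upos := SymPos_ulsubmx Bpos.
have [Lt Le] := logmxK Bpos; have [Kt Ke] := logmxK Upos.
have [V [a [VV aE]]] := sym_spmxP Kt; have [W [l [WW lE]]] := sym_spmxP Lt.
have Uul := expmx_logmx_spmx Upos VV aE; have BE := expmx_logmx_spmx Bpos WW lE.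
set ea := map_mx _ a in Uul; set el := map_mx _ l in BE.
have edis := (disjoint_roots_dis VV WW Uul BE).1 dB.
have CC := border_orth VV WW; rewrite (border_cauchymx VV WW Uul BE edis) in CC.
have [eainj elinj] := cauchymx_inj CC.
have sq := cauchy_orthonormal_squares eainj elinj edis ((cauchymx_orthP _ _ _ _).1 CC).
have eaE : ea 0 = (fun i => expR (a 0 i)) by apply/funext => i; rewrite /ea mxE.
have elE : el 0 = (fun i => expR (l 0 i)) by apply/funext => i; rewrite /el mxE.
have dis i j : l 0 j != a 0 i.
  by apply: contra (edis i j) => /eqP e; rewrite eaE elE e.
have ainj : injective (a 0) by move=> i j e; apply: eainj; rewrite eaE e.
have linj : injective (l 0) by move=> i j e; apply: elinj; rewrite elE e.
rewrite eaE elE in sq.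
(* Border coordinates at the logarithms, with the factors of cauchy_transfer
   divided out. *)
pose b i := (V *m ursubmx B) i 0 / expR (hval a l (a 0 i)).
pose w j := (last_row R n *m W^T) 0 j / expR (hval l a (l 0 j)).
have h0 x : expR x != 0 by rewrite gt_eqF ?expR_gt0.
have {}sq : cauchy_squares (a 0) (l 0) b w.
  apply/(cauchy_transfer _ _ ainj linj).
  have -> : (fun i => b i * expR (hval a l (a 0 i))) = (fun i => (V *m ursubmx B) i 0).
    by apply/funext => i; rewrite /b divfK ?h0.
  by have -> : (fun j => w j * expR (hval l a (l 0 j)))
      = (fun j => (last_row R n *m W^T) 0 j) by apply/funext => j; rewrite /w divfK ?h0.
have := cauchy_squares_orthonormal ainj linj dis sq.
move=> /(cauchymx_orthP a l) KK.
have conjK := cauchymx_conj dis KK.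
set K := cauchymx a l b w in KK conjK.
set B1 := block_mx V 0 0 1%:M : 'M[R]_(n + 1).
have BB : B1 *m B1^T = 1%:M by exact: block1_orth.
have bE : V *m border_col (logmx (ulsubmx B)) B = \col_i b i.
  rewrite /border_col aE lE (invhmx_spmx _ _ VV WW) mulmxA mul_spmx // -mulmxA.
  rewrite mul_diag_mx; apply/colP => i.
  by rewrite [LHS]mxE [X in X * _]mxE [RHS]mxE mulrC.
have AE : inv_border (logmx (ulsubmx B)) B = spmx (K^T *m B1) l.
  rewrite /spmx trmx_mul trmxK.
  have -> : B1^T *m K *m diag_mx l *m (K^T *m B1)
     = B1^T *m (K *m diag_mx l *m K^T) *m B1 by rewrite !mulmxA.
  rewrite conjK /B1 tr_block_mx !mulmx_block.
  rewrite !(trmx0, trmx1, mul0mx, mulmx0, addr0, add0r, mulmx1, mul1mx).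
  rewrite -bE trmx_mul !mulmxA (mulmx1C VV) mul1mx.
  rewrite -[X in block_mx _ _ X _]mulmxA (mulmx1C VV) mulmx1.
  rewrite /inv_border; congr block_mx; first exact: aE.
  by rewrite aE lE !mxtrace_spmx.
rewrite AE lE (char_poly_spmx WW); apply: char_poly_spmx.
rewrite trmx_mul trmxK mulmxA -[_ *m B1 *m _]mulmxA BB mulmx1.
exact: mulmx1C.
Qed.

End InvBorder.
End Surjectivity.

(** * Spectra of exponentials *)

Section SpectrumExp.
Variable R : realType.

(** A common list of roots for both polynomials accounts for multiplicities. *)
Definition exp_roots (p q : {poly R}) : Prop :=
  exists s : seq R, p = \prod_(x <- s) ('X - x%:P) /\
                    q = \prod_(x <- s) ('X - (expR x)%:P).

Lemma orth_spmx n (P W : 'M[R]_n) d :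
  P *m spmx W d *m P^T = spmx (W *m P^T) d.
Proof. by rewrite /spmx trmx_mul trmxK !mulmxA. Qed.

Lemma orth_mul n (P W : 'M[R]_n) : P *m P^T = 1%:M -> W *m W^T = 1%:M ->
  (W *m P^T) *m (W *m P^T)^T = 1%:M.
Proof.
move=> PP WW; rewrite trmx_mul trmxK mulmxA -[_ *m P^T *m P]mulmxA.
by rewrite (mulmx1C PP) mulmx1.
Qed.

Lemma char_poly_orth n (P A : 'M[R]_n) : P *m P^T = 1%:M -> A^T = A ->
  char_poly (P *m A *m P^T) = char_poly A.
Proof.
move=> PP /sym_spmxP[W [l [WW ->]]].
by rewrite orth_spmx !char_poly_spmx //; exact: orth_mul.
Qed.

Lemma expmx_orth n (P A : 'M[R]_n) : P *m P^T = 1%:M ->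
  expmx (P *m A *m P^T) = P *m expmx A *m P^T.
Proof.
move=> PP; have := @expmx_intertwine R _ _ (P *m A *m P^T) A P.
rewrite -mulmxA (mulmx1C PP) mulmx1 => /(_ erefl) <-.
by rewrite -[RHS]mulmxA PP mulmx1.
Qed.

Lemma sym_orth n (P A : 'M[R]_n) : A^T = A -> (P *m A *m P^T)^T = P *m A *m P^T.
Proof. by move=> At; rewrite !trmx_mul trmxK At mulmxA. Qed.

Lemma exp_roots_expmx n (A : 'M[R]_n) : A^T = A ->
  exp_roots (char_poly A) (char_poly (expmx A)).
Proof.
move=> /sym_spmxP[W [l [WW ->]]]; rewrite expmx_spmx // !char_poly_spmx //.
exists [seq l 0 i | i : 'I_n]; rewrite !big_image; split=> //.
by apply: eq_bigr => i _; rewrite mxE.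
Qed.

Lemma exp_roots_disjoint p q p' q' : exp_roots p q -> exp_roots p' q' ->
  (forall x, root p x -> root p' x -> False) ->
  forall y, root q y -> root q' y -> False.
Proof.
move=> [s [pE qE]] [s' [p'E q'E]] dis y; rewrite qE q'E.
rewrite -(big_map expR xpredT (fun z => 'X - z%:P)) root_prod_XsubC.
rewrite -(big_map expR xpredT (fun z => 'X - z%:P)) root_prod_XsubC.
move=> /mapP[x xs ->] /mapP[x' x's /(@expR_inj R) xx'].
by apply: (dis x); rewrite ?pE ?p'E root_prod_XsubC // xx'.
Qed.

Lemma trace_expmx_char_poly n (X Y : 'M[R]_n) : X^T = X -> Y^T = Y ->
  char_poly X = char_poly Y -> \tr (expmx X) = \tr (expmx Y).
Proof.
move=> /sym_spmxP[V [d [VV ->]]] /sym_spmxP[W [e [WW ->]]].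
rewrite (char_poly_spmx VV) (char_poly_spmx WW) => de.
have pe : perm_eq [seq d 0 i | i : 'I_n] [seq e 0 i | i : 'I_n].
  by apply: prod_XsubC_eq; rewrite !big_image.
rewrite (expmx_spmx _ VV) (expmx_spmx _ WW) (mxtrace_spmx _ VV) (mxtrace_spmx _ WW).
transitivity (\sum_(y <- [seq d 0 i | i : 'I_n]) expR y).
  by rewrite big_image; apply: eq_bigr => i _; rewrite mxE.
rewrite (perm_big _ pe) big_image; apply: eq_bigr => i _; by rewrite mxE.
Qed.

End SpectrumExp.

(** * The spectrum of the recovered matrix *)

Section InvBorderDensity.
Variable R : realType.

(** The exponential of a generic matrix, rotated by Q. *)
Lemma disjoint_roots_SymPos n : exists2 C : 'M[R]_(n + 1),
  SymPos C & disjoint_roots C.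
Proof.
have [J Jt [/generic_disjoint dJ _]] := generic_exists R (n + 1).
have QQ := Qmx_orth Jt; have [ulE _] := Qmx_corner Jt.
exists (Qmx J *m expmx J *m (Qmx J)^T).
  by rewrite -expmx_orth //; apply: SymPos_expmx; exact: sym_orth.
have eU : exp_roots (char_poly (ulsubmx J))
    (char_poly (ulsubmx (Qmx J *m expmx J *m (Qmx J)^T))).
  by rewrite ulE; apply: exp_roots_expmx; exact: sym_ulsubmx.
have eJ : exp_roots (char_poly J) (char_poly (Qmx J *m expmx J *m (Qmx J)^T)).
  by rewrite char_poly_orth ?expmx_sym //; exact: exp_roots_expmx.
exact: exp_roots_disjoint eU eJ dJ.
Qed.

Lemma Ck_on_inv_border (E : normedModType R) (V U : set E) k n
    (f : E -> 'M[R]_n) (g : E -> 'M[R]_(n + 1)) : open_along V U ->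
  Ck_on k V U f -> Ck_on k V U g ->
  (forall x, U x -> (f x)^T = f x) -> (forall x, U x -> SymPos (g x)) ->
  Ck_on k V U (fun x => inv_border (f x) (g x)).
Proof.
move=> oU fC gC ft gp.
have lC : Ck_on k V U (fun x => logmx (g x)) by exact: (Ck_on_logmx oU).
have lt x : U x -> (logmx (g x))^T = logmx (g x) by move=> /gp/logmxK[].
have bC : Ck_on k V U (fun x => border_col (f x) (g x)).
  apply: (Ck_on_mulmx oU); first exact: (Ck_on_invhmx oU).
  exact: (Ck_on_ursubmx oU).
apply: (Ck_on_block_mx oU) => //; first exact: (Ck_on_trmx oU).
under eq_fun do rewrite raddfB /=.
apply: (Ck_onD oU); first exact: (Ck_on_trace oU).
by apply: (Ck_on_oppmx oU); exact: (Ck_on_trace oU).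
Qed.

Lemma SymPos_segment n (B C : 'M[R]_n) t : SymPos B -> SymPos C ->
  0 < t -> t < 1 -> SymPos (segment_mx B C t).
Proof.
move=> [/SymE Bt Bp] [/SymE Ct Cp] t0 t1; split; first exact/SymE/segment_mx_sym.
move=> x x0; have -> : segment_mx B C t = (1 - t) *: B + t *: C.
  by rewrite /segment_mx scalerBr scalerBl scale1r addrCA addrC.
rewrite mulmxDr mulmxDl -!scalemxAr -!scalemxAl [X in 0 < X]mxE.
rewrite [X in X + _]mxE [X in _ + X]mxE addr_gt0 // mulr_gt0 ?subr_gt0 //.
  exact: Bp.
exact: Cp.
Qed.

(** The generic case, and continuity of both sides along a segment that starts
    at B. *)
Lemma inv_border_char_poly n (B : 'M[R]_(n + 1)) : SymPos B ->
  char_poly (inv_border (logmx (ulsubmx B)) B) = char_poly (logmx B).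
Proof.
move=> Bpos; have [C Cpos dC] := disjoint_roots_SymPos n.
have [/SymE Bt _] := Bpos; have [/SymE Ct _] := Cpos.
have [p p0 pd] := disjoint_roots_segment Bt Ct dC.
(* Only t > 0 is considered, where the segment stays in SymPos. *)
have r0 (P : R -> Prop) : (\forall t \near (0 : R)^', P t) -> \forall t \near (0 : R)^'+, P t.
  rewrite /dnbhs /at_right !near_withinE; apply: filterS => t h t0.
  by apply: h; rewrite gt_eqF.
have segp : \forall t \near (0 : R)^'+, SymPos (segment_mx B C t).
  near=> t; have t0 : 0 < t by near: t; exact: nbhs_right_gt.
  have t1 : t < 1 by near: t; exact: nbhs_right_lt.
  exact: SymPos_segment.
have eqp : \forall t \near (0 : R)^'+,
    char_poly (inv_border (logmx (ulsubmx (segment_mx B C t))) (segment_mx B C t))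
    = char_poly (logmx (segment_mx B C t)).
  near=> t; apply: inv_border_generic.
    by near: t.
  apply: pd; near: t; apply: r0; exact: poly_neq0_near.
have oS := @open_along_SymPos R (n + 1).
have idC := Ck_on_id 0 oS.
have lC : Ck_on 0 (@Sym R (n + 1)) (@SymPos R (n + 1)) (fun X => logmx X).
  by apply: (Ck_on_logmx oS).
have bC : Ck_on 0 (@Sym R (n + 1)) (@SymPos R (n + 1))
    (fun X => inv_border (logmx (ulsubmx X)) X).
  apply: (Ck_on_inv_border oS) => //.
    apply: (Ck_on_logmx oS); first exact: (Ck_on_ulsubmx oS).
    exact: SymPos_ulsubmx.
  by move=> X /SymPos_ulsubmx/logmxK[].
have segr : segment_mx B C t @[t --> (0 : R)^'+] --> B.
  move=> A BA; suff : \forall t \near (0 : R)^'+, A (segment_mx B C t) by [].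
  apply: (r0 (fun t => A (segment_mx B C t))).
  have h := @cvg_segment R _ B C; exact: (h A BA).
have c1 := Ck_on_cvg lC Bpos segr segp.
have c2 := Ck_on_cvg bC Bpos segr segp.
apply: poly_ext => x; rewrite !horner_char_poly.
have d1 : (fun t => \det (x%:M - logmx (segment_mx B C t))) @ (0 : R)^'+
    --> \det (x%:M - logmx B).
  by apply: cvg_det; apply: cvgB; [exact: cvg_cst | exact: c1].
have d2 : (fun t => \det (x%:M - logmx (segment_mx B C t))) @ (0 : R)^'+
    --> \det (x%:M - inv_border (logmx (ulsubmx B)) B).
  have d2' : (fun t => \det (x%:M - inv_border (logmx (ulsubmx (segment_mx B C t)))
      (segment_mx B C t))) @ (0 : R)^'+ --> \det (x%:M - inv_border (logmx (ulsubmx B)) B).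
    by apply: cvg_det; apply: cvgB; [exact: cvg_cst | exact: c2].
  apply: cvg_trans d2'; apply: near_eq_cvg; apply: filterS eqp => t et.
  by rewrite -!horner_char_poly et.
exact: (cvg_unique _ d2 d1).
Unshelve. all: by end_near. Qed.

End InvBorderDensity.

(** * Existence of the twist, by induction on the size *)

Section Induction.
Variable R : realType.

(** Testing on all smooth families of matrices in D makes the notion stable under
    composition. *)
Definition smooth_operation n (D : set 'M[R]_n) (F : 'M[R]_n -> 'M[R]_n) : Prop :=
  forall (E : normedModType R) (V U : set E), open_along V U ->
  forall k (f : E -> 'M[R]_n), Ck_on k V U f -> (forall x, U x -> D (f x)) ->
    Ck_on k V U (fun x => F (f x)).

(** The map gamma, with the inverse of an orthogonal matrix written as transpose. *)
Definition twisted_exp n (psi : 'M[R]_n -> 'M[R]_n) (A : 'M[R]_n) : 'M[R]_n :=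
  expmx (psi A *m A *m (psi A)^T).

(** The induction hypothesis. The inverse g of the twisted exponential is carried
    along because the inverse of the next size is computed from it. *)
Definition good_twist n (psi g : 'M[R]_n -> 'M[R]_n) : Prop :=
  [/\ forall A, Sym A -> SO (psi A),
      psi 0 = 1%:M,
      forall A, Sym A -> forall k,
        exp_roots (corner_char_poly A k) (corner_char_poly (twisted_exp psi A) k),
      [/\ forall A, Sym A -> g (twisted_exp psi A) = A,
          forall B, SymPos B -> Sym (g B) &
          forall B, SymPos B -> twisted_exp psi (g B) = B] &
      smooth_operation (@Sym R n) psi /\ smooth_operation (@SymPos R n) g].

Lemma SO_orth n (P : 'M[R]_n) : SO P -> P *m P^T = 1%:M.
Proof. by case. Qed.

Lemma good_twist0 : @good_twist 0 (fun=> 1%:M) (fun=> 0).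
Proof.
have all0 (M N : 'M[R]_0) : M = N by apply/matrixP => -[].
split=> //.
- by move=> A _; split; [exact: all0 | exact: det1].
- by move=> A _ [].
- split=> [A _|B _|B _]; [exact: all0 | exact/SymE/all0 | exact: all0].
- by split=> E V U oU k f _ _; exact: (Ck_on_cst oU).
Qed.

Section Step.
Variables (n : nat) (psi g : 'M[R]_n -> 'M[R]_n).
Hypothesis gt : good_twist psi g.

(** The corner of Q(A) exp(A) Q(A)^T is exp (ulsubmx A), which the block
    psi (ulsubmx A) then twists. *)
Definition psi_step (A : 'M[R]_(n + 1)) : 'M[R]_(n + 1) :=
  block_mx (psi (ulsubmx A)) 0 0 1%:M *m Qmx A.

(** The matrix A' is the corner of the matrix to be found; conjugating by the
    transpose of P undoes its twist. *)
Definition g_step (B : 'M[R]_(n + 1)) : 'M[R]_(n + 1) :=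
  let A' := g (ulsubmx B) in
  let P := block_mx (psi A') 0 0 1%:M in
  inv_border A' (P^T *m B *m P).

Let psiSO : forall A, Sym A -> SO (psi A). Proof. by case: gt. Qed.
Let psi0 : psi 0 = 1%:M. Proof. by case: gt. Qed.
Let psiGZ : forall A, Sym A -> forall k,
  exp_roots (corner_char_poly A k) (corner_char_poly (twisted_exp psi A) k).
Proof. by case: gt. Qed.
Let gK : forall A, Sym A -> g (twisted_exp psi A) = A.
Proof. by case: gt => _ _ _ []. Qed.
Let gSym : forall B, SymPos B -> Sym (g B).
Proof. by case: gt => _ _ _ []. Qed.
Let psiK : forall B, SymPos B -> twisted_exp psi (g B) = B.
Proof. by case: gt => _ _ _ []. Qed.
Let psiC : smooth_operation (@Sym R n) psi.
Proof. by case: gt => _ _ _ _ []. Qed.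
Let gC : smooth_operation (@SymPos R n) g.
Proof. by case: gt => _ _ _ _ []. Qed.

Lemma block1_conj (P : 'M[R]_n) (B : 'M[R]_(n + 1)) :
  block_mx P 0 0 1%:M *m B *m (block_mx P 0 0 1%:M)^T =
  block_mx (P *m ulsubmx B *m P^T) (P *m ursubmx B) (dlsubmx B *m P^T) (drsubmx B).
Proof.
rewrite -{1}[B]submxK tr_block_mx !mulmx_block.
by rewrite !(trmx0, trmx1, mul0mx, mulmx0, addr0, add0r, mulmx1, mul1mx).
Qed.

Let sym_ul (A : 'M[R]_(n + 1)) : Sym A -> Sym (ulsubmx A).
Proof. by move=> /SymE At; apply/SymE/sym_ulsubmx. Qed.

Lemma psi_step_SO A : Sym A -> SO (psi_step A).
Proof.
move=> sA; have At := (SymE A).1 sA; have [PP Pd] := psiSO (sym_ul sA); split.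
  rewrite /psi_step trmx_mul mulmxA -[_ *m Qmx A *m _]mulmxA (Qmx_orth At) mulmx1.
  exact: block1_orth.
by rewrite /psi_step det_mulmx det_lblock Pd det1 (Qmx_det At) !mulr1.
Qed.

Lemma twisted_exp_step A : Sym A ->
  twisted_exp psi_step A =
  block_mx (psi (ulsubmx A)) 0 0 1%:M *m (Qmx A *m expmx A *m (Qmx A)^T) *m
    (block_mx (psi (ulsubmx A)) 0 0 1%:M)^T.
Proof.
move=> sA; rewrite /twisted_exp expmx_orth; last by case: (psi_step_SO sA).
by rewrite /psi_step trmx_mul !mulmxA.
Qed.

Lemma ulsubmx_twisted_exp_step A : Sym A ->
  ulsubmx (twisted_exp psi_step A) = twisted_exp psi (ulsubmx A).
Proof.
move=> sA; have At := (SymE A).1 sA; have [ulE _] := Qmx_corner At.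
rewrite twisted_exp_step // block1_conj block_mxKul ulE /twisted_exp expmx_orth //.
exact: SO_orth (psiSO (sym_ul sA)).
Qed.

Lemma sym_block_eq (M N : 'M[R]_(n + 1)) : M^T = M -> N^T = N ->
  ulsubmx M = ulsubmx N -> ursubmx M = ursubmx N -> \tr M = \tr N -> M = N.
Proof.
move=> Mt Nt ul ur tr; rewrite -[M]submxK -[N]submxK !sym_dlsubmx // ul ur.
congr block_mx; rewrite [LHS]mx11_scalar [RHS]mx11_scalar; congr (_%:M).
move: tr; rewrite -{1}[M]submxK -{1}[N]submxK !mxtrace_block ul => /addrI.
by rewrite !trace_mx11.
Qed.

Lemma psi_step_GZ A : Sym A -> forall k,
  exp_roots (corner_char_poly A k) (corner_char_poly (twisted_exp psi_step A) k).
Proof.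
move=> sA k; have At := (SymE A).1 sA; have [kn|kn] := ltnP k n.
  rewrite (@corner_char_poly_ul _ _ A k (Ordinal kn)) //.
  rewrite (@corner_char_poly_ul _ _ (twisted_exp _ A) k (Ordinal kn)) //.
  by rewrite ulsubmx_twisted_exp_step //; apply: psiGZ; exact: sym_ul.
have kE : k.+1 = (n + 1)%N by have := ltn_ord k; lia.
rewrite !corner_char_poly_last // /twisted_exp expmx_orth; last first.
  by case: (psi_step_SO sA).
rewrite char_poly_orth ?expmx_sym //; last by case: (psi_step_SO sA).
exact: exp_roots_expmx.
Qed.

(** The untwisted matrix has logarithm Q(A) A Q(A)^T, with the spectrum of A, so
    border_col divides by the right hmx. *)
Lemma g_stepK A : Sym A -> g_step (twisted_exp psi_step A) = A.
Proof.
move=> sA; have At := (SymE A).1 sA; have QQ := Qmx_orth At.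
have [_ urE] := Qmx_corner At; have Ut := sym_ulsubmx At.
rewrite /g_step ulsubmx_twisted_exp_step // gK; last exact: sym_ul.
rewrite twisted_exp_step //; set P := block_mx _ _ _ _.
have PP : P^T *m P = 1%:M.
  by apply/mulmx1C/block1_orth; exact: SO_orth (psiSO (sym_ul sA)).
have -> : P^T *m (P *m (Qmx A *m expmx A *m (Qmx A)^T) *m P^T) *m P
    = Qmx A *m expmx A *m (Qmx A)^T.
  by rewrite !mulmxA PP mul1mx -mulmxA PP mulmx1.
have LE : logmx (Qmx A *m expmx A *m (Qmx A)^T) = Qmx A *m A *m (Qmx A)^T.
  by rewrite -expmx_orth // expmxK // sym_orth.
have trE : \tr (Qmx A *m A *m (Qmx A)^T) = \tr A.
  by rewrite mxtrace_mulC mulmxA (mulmx1C QQ) mul1mx.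
have bE : border_col (ulsubmx A) (Qmx A *m expmx A *m (Qmx A)^T) = ursubmx A.
  rewrite /border_col LE urE /invhmx.
  rewrite (@hexp_char_poly _ _ _ (ulsubmx A) (Qmx A *m A *m (Qmx A)^T) A) //;
    [|exact: sym_orth | exact: char_poly_orth].
  by rewrite mulmxA -/(invhmx _ _) (mulmx1C (hmxV Ut At)) mul1mx.
rewrite /inv_border bE LE trE; apply: sym_block_eq => //.
- exact: block_mx_sym.
- by rewrite block_mxKul.
- by rewrite block_mxKur.
by rewrite mxtrace_block trace_mx11 mxE eqxx mulr1n addrC subrK.
Qed.

Section Inverse.
Variable B : 'M[R]_(n + 1).
Hypothesis Bpos : SymPos B.

Let A' := g (ulsubmx B).
Let P := block_mx (psi A') 0 0 1%:M : 'M[R]_(n + 1).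
Let B' := P^T *m B *m P.

Let sA' : Sym A'. Proof. exact: gSym (SymPos_ulsubmx Bpos). Qed.

Let PP : P *m P^T = 1%:M.
Proof. by apply: block1_orth; exact: SO_orth (psiSO sA'). Qed.

Lemma SymPos_untwist : SymPos B'.
Proof.
have [/SymE Bt Bp] := Bpos; split; first by apply/SymE; rewrite /B' !trmx_mul trmxK Bt mulmxA.
move=> x x0; have -> : x *m B' *m x^T = (x *m P^T) *m B *m (x *m P^T)^T.
  by rewrite /B' trmx_mul trmxK !mulmxA.
apply: Bp; apply: contra x0 => /eqP e.
by rewrite -[x]mulmx1 -(mulmx1C PP) mulmxA e mul0mx.
Qed.

Let B'ul : ulsubmx B' = expmx A'.
Proof.
have PtE : P^T = block_mx (psi A')^T 0 0 1%:M.
  by rewrite /P tr_block_mx !trmx0 trmx1.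
have -> : B' = P^T *m B *m P^T^T by rewrite trmxK.
rewrite PtE block1_conj block_mxKul trmxK.
have Po := SO_orth (psiSO sA').
rewrite -{1}(psiK (SymPos_ulsubmx Bpos)) -/A' /twisted_exp expmx_orth //.
by rewrite !mulmxA (mulmx1C Po) mul1mx -mulmxA (mulmx1C Po) mulmx1.
Qed.

Let gE : g_step B = inv_border (logmx (ulsubmx B')) B'.
Proof. by rewrite B'ul expmxK //; exact/SymE. Qed.

Lemma g_step_Sym : Sym (g_step B).
Proof. by apply/SymE; apply: block_mx_sym; exact/SymE. Qed.

Lemma ulsubmx_g_step : ulsubmx (g_step B) = A'.
Proof. by rewrite /g_step /inv_border block_mxKul. Qed.

(** The untwisted B and Q(G) exp(G) Q(G)^T, for G the recovered matrix, agree in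
    corner and border by construction, and in trace by inv_border_char_poly. *)
Lemma twisted_exp_g_step : twisted_exp psi_step (g_step B) = B.
Proof.
have sG := g_step_Sym; have Gt := (SymE _).1 sG.
have [Lt Le] := logmxK SymPos_untwist.
have cG : char_poly (g_step B) = char_poly (logmx B').
  by rewrite gE; exact: (inv_border_char_poly SymPos_untwist).
have QQ := Qmx_orth Gt; have [ulE urE] := Qmx_corner Gt.
have [/SymE B't _] := SymPos_untwist.
suff e : Qmx (g_step B) *m expmx (g_step B) *m (Qmx (g_step B))^T = B'.
  rewrite twisted_exp_step // e ulsubmx_g_step -/P /B' !mulmxA PP mul1mx.
  by rewrite -mulmxA PP mulmx1.
have At : A'^T = A' by exact/SymE.
apply: sym_block_eq => //.
- by apply: sym_orth; exact: expmx_sym.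
- by rewrite ulE ulsubmx_g_step B'ul.
- rewrite urE ulsubmx_g_step.
  have -> : ursubmx (g_step B) = border_col A' B' by rewrite /g_step /inv_border block_mxKur.
  rewrite /border_col /hmx (@hexp_char_poly _ _ _ A' (g_step B) (logmx B')) //.
  by rewrite mulmxA -/(hmx _ _) (hmxV At Lt) mul1mx.
rewrite mxtrace_mulC mulmxA (mulmx1C QQ) mul1mx -[in RHS]Le.
exact: trace_expmx_char_poly.
Qed.

End Inverse.

Lemma psi_step_smooth : smooth_operation (@Sym R (n + 1)) psi_step.
Proof.
move=> E V U oU k f fC fS.
have cC m p (M : 'M[R]_(m, p)) : Ck_on k V U (fun=> M) by exact: (Ck_on_cst oU).
apply: (Ck_on_mulmx oU); last by apply: (Ck_on_Qmx oU) => // x /fS/SymE.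
apply: (Ck_on_block_mx oU) => //; apply: (psiC oU); first exact: (Ck_on_ulsubmx oU).
by move=> x /fS/sym_ul.
Qed.

Lemma g_step_smooth : smooth_operation (@SymPos R (n + 1)) g_step.
Proof.
move=> E V U oU k f fC fS.
have cC m p (M : 'M[R]_(m, p)) : Ck_on k V U (fun=> M) by exact: (Ck_on_cst oU).
have ulC : Ck_on k V U (fun x => ulsubmx (f x)) by exact: (Ck_on_ulsubmx oU).
have aC : Ck_on k V U (fun x => g (ulsubmx (f x))).
  by apply: (gC oU) => // x /fS/SymPos_ulsubmx.
have aS x : U x -> Sym (g (ulsubmx (f x))) by move=> /fS/SymPos_ulsubmx/gSym.
have PC : Ck_on k V U (fun x => block_mx (psi (g (ulsubmx (f x)))) 0 0 1%:M : 'M[R]_(n + 1)).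
  by apply: (Ck_on_block_mx oU) => //; exact: (psiC oU).
apply: (Ck_on_inv_border oU) => //.
- apply: (Ck_on_mulmx oU) => //; apply: (Ck_on_mulmx oU) => //.
  exact: (Ck_on_trmx oU).
- by move=> x /aS/SymE.
by move=> x /fS fx; exact: SymPos_untwist.
Qed.

Lemma good_twist_step : good_twist psi_step g_step.
Proof.
split.
- exact: psi_step_SO.
- rewrite /psi_step Qmx0 mulmx1; have -> : ulsubmx (0 : 'M[R]_(n + 1)) = 0.
    by apply/matrixP => i j; rewrite !mxE.
  by rewrite psi0 -scalar_mx_block.
- exact: psi_step_GZ.
- by split; [exact: g_stepK | exact: g_step_Sym | exact: twisted_exp_g_step].
- by split; [exact: psi_step_smooth | exact: g_step_smooth].
Qed.

End Step.

Theorem good_twist_exists n : exists psi g : 'M[R]_n -> 'M[R]_n, good_twist psi g.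
Proof.
elim: n => [|n [psi [g gt]]]; first by exists (fun=> 1%:M), (fun=> 0); exact: good_twist0.
by rewrite -addn1; exists (psi_step psi), (g_step psi g); exact: good_twist_step.
Qed.

End Induction.

(** * Ordered eigenvalues *)

Section OrderedEigenvalues.
Variable R : realType.

Lemma ordered_eigenvalues_eq n (M : 'M[R]_n) (s : seq R) : sorted <=%R s ->
  char_poly M = \prod_(x <- s) ('X - x%:P) -> ordered_eigenvalues M = s.
Proof.
move=> ss sE; have [] := @xgetPex _ [::] [set s : seq R | sorted <=%R s /\
  char_poly M = \prod_(x <- s) ('X - x%:P)] (ex_intro _ s (conj ss sE)).
rewrite -/(ordered_eigenvalues M) => ts tE.
apply: (le_sorted_eq ts ss); apply: prod_XsubC_eq.
by rewrite -tE -sE.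
Qed.

Lemma ordered_eigenvaluesP n (M : 'M[R]_n) : M^T = M ->
  exists s : seq R, [/\ ordered_eigenvalues M = s, size s = n &
    char_poly M = \prod_(x <- s) ('X - x%:P)].
Proof.
move=> /sym_spmxP[V [d [VV ->]]].
pose s := sort <=%R [seq d 0 i | i : 'I_n].
have sE : char_poly (spmx V d) = \prod_(x <- s) ('X - x%:P).
  rewrite (char_poly_spmx VV); transitivity (\prod_(y <- [seq d 0 i | i : 'I_n]) ('X - y%:P)).
    by rewrite big_image.
  by apply: perm_big; rewrite perm_sym; exact/permPl/perm_sort.
exists s; split=> //; last by rewrite /s size_sort size_map -cardE card_ord.
by apply: ordered_eigenvalues_eq sE; exact: sort_le_sorted.
Qed.

Lemma exp_roots_ordered m n (M : 'M[R]_m) (N : 'M[R]_n) :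
  exp_roots (char_poly M) (char_poly N) ->
  ordered_eigenvalues N = [seq expR x | x <- ordered_eigenvalues M].
Proof.
move=> [s [sM sN]].
have tM : char_poly M = \prod_(x <- sort <=%R s) ('X - x%:P).
  by rewrite sM; apply: perm_big; rewrite perm_sym; exact/permPl/perm_sort.
rewrite (ordered_eigenvalues_eq (sort_le_sorted s) tM).
apply: ordered_eigenvalues_eq.
  apply: (@homo_sorted _ _ (@expR R) <=%R <=%R); last exact: sort_le_sorted.
  by move=> x y; rewrite ler_expR.
rewrite big_map sN; apply: perm_big; rewrite perm_sym; exact/permPl/perm_sort.
Qed.

Lemma principal_submx_sym n (A : 'M[R]_n) k : A^T = A ->
  (principal_submx k A)^T = principal_submx k A.
Proof.
move=> At; apply/matrixP => i j; rewrite !mxE.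
by have /matrixP/(_ (widen_ord (ltn_ord k) i) (widen_ord (ltn_ord k) j)) := At; rewrite mxE.
Qed.

Lemma SymPos_principal_submx n (B : 'M[R]_n) k : SymPos B ->
  SymPos (principal_submx k B).
Proof.
move=> [/SymE Bt Bp]; split; first exact/SymE/principal_submx_sym.
set f := widen_ord (ltn_ord k).
(* The principal submatrix is S B S^T for the selection matrix S. *)
pose S : 'M[R]_(k.+1, n) := \matrix_(i, j) (f i == j)%:R.
have finj : injective f by move=> i j /(congr1 val) /= ij; exact/val_inj.
have mulS p (X : 'M[R]_(p, n)) i j : (X *m S^T) i j = X i (f j).
  rewrite mulmx_trE (bigD1 (f j)) //= mxE eqxx mulr1 big1 ?addr0 // => l li.
  by rewrite mxE eq_sym (negbTE li) mulr0.
have SS : S *m S^T = 1%:M.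
  by apply/matrixP => i j; rewrite mulS !mxE (inj_eq finj).
have SB : principal_submx k B = S *m B *m S^T.
  apply/matrixP => i j; rewrite mulS [LHS]mxE.
  have -> : S *m B = (B *m S^T)^T by rewrite trmx_mul trmxK Bt.
  rewrite [RHS]mxE mulS.
  by have /matrixP/(_ (f i) (f j)) := Bt; rewrite mxE => ->.
move=> x x0; rewrite SB.
have -> : x *m (S *m B *m S^T) *m x^T = (x *m S) *m B *m (x *m S)^T.
  by rewrite trmx_mul !mulmxA.
apply: Bp; apply: contra x0 => /eqP e.
by rewrite -[x]mulmx1 -SS mulmxA e mul0mx.
Qed.

Lemma logGZ_exp_roots n (A B : 'M[R]_n) : A^T = A ->
  (forall k, exp_roots (corner_char_poly A k) (corner_char_poly B k)) ->
  logGZ B = GZ A.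
Proof.
move=> At AB; apply/ffunP => p; rewrite [LHS]ffunE /GZ [in LHS]ffunE [RHS]ffunE.
rewrite (exp_roots_ordered (AB (tag p))).
have [s [-> ss _]] := ordered_eigenvaluesP (principal_submx_sym (tag p) At).
by rewrite (nth_map 0) ?expRK // ss ltn_ord.
Qed.

(** The positivity of the spectra of the corners of B is needed to undo ln. *)
Lemma exp_roots_logGZ n (A B : 'M[R]_n) : A^T = A -> SymPos B ->
  logGZ B = GZ A -> forall k, exp_roots (corner_char_poly A k) (corner_char_poly B k).
Proof.
move=> At Bp BA k; have [s [sA ss sE]] := ordered_eigenvaluesP (principal_submx_sym k At).
have Bk := SymPos_principal_submx k Bp; have [/SymE Bt _] := Bk.
have [t [tB ts tE]] := ordered_eigenvaluesP Bt.
have [V [d [VV BE d0]]] := SymPos_spmxP Bk.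
have tpos i : (i < k.+1)%N -> 0 < nth 0 t i.
  move=> it; have : root (char_poly (principal_submx k B)) (nth 0 t i).
    by rewrite tE root_prod_XsubC; apply: mem_nth; rewrite ts.
  by rewrite BE => /(root_char_poly_spmx _ _ VV)[j ->].
(* The list s is that of the eigenvalues of the corner of A; those of B are
   identified with its exponentials entry by entry. *)
exists s; split; first by rewrite /corner_char_poly sE.
rewrite /corner_char_poly tE -(big_map (@expR R) predT (fun x => 'X - x%:P)).
have -> : t = [seq expR x | x <- s].
  apply: (@eq_from_nth _ 0) => [|i]; first by rewrite size_map ss ts.
  rewrite ts => ik; rewrite (nth_map 0) ?ss //.
  have := congr1 (fun f : {ffun GZ_index n -> R} =>
    f (Tagged (fun k : 'I_n => 'I_k.+1) (Ordinal ik))) BA.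
  rewrite [LHS]ffunE /GZ [in LHS]ffunE [RHS]ffunE.
  rewrite [tag _]/= [tagged _]/= sA tB [nat_of_ord _]/= => <-.
  by rewrite lnK // posrE; exact: tpos.
by [].
Qed.

Lemma exp_roots_fun (p q q' : {poly R}) : exp_roots p q -> exp_roots p q' -> q = q'.
Proof.
move=> [s [ps ->]] [s' [ps' ->]]; apply: perm_big; apply: prod_XsubC_eq.
by rewrite -ps -ps'.
Qed.

End OrderedEigenvalues.

(** * Paths of matrices with prescribed corner spectra *)

Section PathUniqueness.
Variable R : realType.

Lemma clopen_all (S : set R) : open S -> closed S -> S 0 -> forall t, S t.
Proof.
move=> oS cS S0 t.
have : connected [set: R] by apply/connected_intervalP => x y _ _ z.
move=> /(_ S) h; suff -> : S = [set: R] by [].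
apply: h; first by exists 0.
- by exists S => //; rewrite setTI.
- by exists S => //; rewrite setTI.
Qed.

(** The condition f = 0 is closed and the condition g != 0 is open. *)
Lemma clopen_continuous m n (f : R -> 'M[R]_(m, n)) (g : R -> R) :
  continuous f -> continuous g -> (forall t, f t = 0 <-> g t != 0) -> f 0 = 0 ->
  forall t, f t = 0.
Proof.
move=> fc gc fg f0; apply: clopen_all => //.
  have -> : (fun t => f t = 0) = g @^-1` [set x | x != 0].
    by apply/funext => t; apply/propext; exact: fg.
  by apply: open_comp => [t _|]; [exact: gc | exact: open_neq].
have -> : (fun t => f t = 0) = f @^-1` [set 0] by [].
apply: preimage_closed => [t _|]; first exact: fc.
apply: accessible_closed_set1; apply: hausdorff_accessible; exact: norm_hausdorff.
Qed.

(** By cauchy_orthonormal_squares, the squares of the coordinates only depend on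
    the spectra of the corner and of the matrix. *)
Lemma border_sqr n (A A' : 'M[R]_(n + 1)) V (a : 'rV[R]_n) :
  A^T = A -> A'^T = A' -> V *m V^T = 1%:M -> ulsubmx A = spmx V a ->
  ulsubmx A' = spmx V a -> disjoint_roots A -> char_poly A = char_poly A' ->
  forall i, (V *m ursubmx A) i 0 ^+ 2 = (V *m ursubmx A') i 0 ^+ 2.
Proof.
move=> At A't VV Aul A'ul dA cA i.
have dA' : disjoint_roots A'.
  by move=> x; rewrite -cA A'ul -Aul; exact: dA.
have sq (M : 'M[R]_(n + 1)) : M^T = M -> ulsubmx M = spmx V a -> disjoint_roots M ->
    (V *m ursubmx M) i 0 ^+ 2 =
    - (char_poly M).[a 0 i] / \prod_(i' | i' != i) (a 0 i - a 0 i').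
  move=> Mt Mul dM; have [W [l [WW ME]]] := sym_spmxP Mt.
  have dis := (disjoint_roots_dis VV WW Mul ME).1 dM.
  have CC := border_orth VV WW; rewrite (border_cauchymx VV WW Mul ME dis) in CC.
  have [ainj linj] := cauchymx_inj CC.
  have [_ ->] := cauchy_orthonormal_squares ainj linj dis ((cauchymx_orthP _ _ _ _).1 CC).
  rewrite ME (char_poly_spmx WW) horner_prod; congr (- _ / _).
  by apply: eq_bigr => j _; rewrite !hornerE.
by rewrite !sq // cA.
Qed.

(** In an eigenbasis of the corner the coordinates of the two borders are nonzero
    and agree up to sign. So the borders are equal if and only if their sum has no
    zero coordinate, that is, if and only if it is cyclic. This turns the closed
    condition of equality into an open one. *)
Lemma border_eq n (A A' : 'M[R]_(n + 1)) :
  A^T = A -> A'^T = A' -> ulsubmx A = ulsubmx A' -> disjoint_roots A ->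
  char_poly A = char_poly A' ->
  (ursubmx A - ursubmx A' = 0 <->
   \det (krylov (ulsubmx A) (ursubmx A + ursubmx A')) != 0).
Proof.
move=> At A't ulE dA cA; have [V [a [VV Aul]]] := sym_spmxP (sym_ulsubmx At).
have A'ul : ulsubmx A' = spmx V a by rewrite -ulE.
have sq := border_sqr At A't VV Aul A'ul dA cA.
have := (disjoint_roots_krylov At).1 dA; rewrite Aul => /(det_krylov _ _ VV)[b0 ainj].
split.
  move/eqP; rewrite subr_eq0 => /eqP <-; apply/(det_krylov _ _ VV); split=> // i.
  by rewrite mulmxDr mxE -mulr2n mulrn_eq0 /= b0.
move=> /(det_krylov _ _ VV)[s0 _].
have e : V *m (ursubmx A - ursubmx A') = 0.
  apply/matrixP => i j; rewrite ord1 [RHS]mxE; apply: (mulIf (s0 i)).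
  rewrite mul0r mulmxBr mulmxDr [X in X * _]mxE [X in _ * X]mxE [X in (_ + X) * _]mxE.
  by rewrite -subr_sqr sq subrr.
by rewrite -[LHS]mul1mx -(mulmx1C VV) -mulmxA e mulmx0.
Qed.

Lemma trace_char_poly n (A A' : 'M[R]_(n + 1)) :
  char_poly A = char_poly A' -> \tr A = \tr A'.
Proof.
have n0 : (0 < n + 1)%N by lia.
by move=> cA; apply: oppr_inj; rewrite -(char_poly_trace A n0) cA (char_poly_trace A' n0).
Qed.

Lemma cvg_krylov (T : Type) (F : set_system T) {FF : Filter F} n
    (f : T -> 'M[R]_n) (d : T -> 'cV[R]_n) (M : 'M[R]_n) (e : 'cV[R]_n) :
  f @ F --> M -> d @ F --> e -> (fun t => krylov (f t) (d t)) @ F --> krylov M e.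
Proof.
move=> fM de; have fX k : (fun t => f t ^+ k) @ F --> M ^+ k.
  elim: k => [|k IH]; first by under eq_fun do rewrite expr0; exact: cvg_cst.
  by rewrite exprS; under eq_fun do rewrite exprS; exact: cvg_mulmx.
apply/cvg_mxP => i j; rewrite mxE; under eq_fun do rewrite mxE.
by move/cvg_mxP : (cvg_mulmx (FF := FF) (fX j) de); exact.
Qed.

(** By induction the corners agree; the borders agree by clopen_continuous and
    border_eq, and the last entries by the trace. *)
Lemma path_unique n (b b' : R -> 'M[R]_n) : continuous b -> continuous b' ->
  (forall t, (b t)^T = b t) -> (forall t, (b' t)^T = b' t) ->
  (forall t, generic (b t)) ->
  (forall t k, corner_char_poly (b t) k = corner_char_poly (b' t) k) ->
  b 0 = b' 0 -> forall t, b t = b' t.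
Proof.
elim: n b b' => [|n IH] b b'; first by move=> *; apply/matrixP => -[].
move: b b'; rewrite -addn1 => b b' bc b'c bt b't bg bb' b0.
have ulc (f : R -> 'M[R]_(n + 1)) : continuous f -> continuous (fun t => ulsubmx (f t)).
  move=> fc t; have /cvg_mxP h := fc t; apply/cvg_mxP => i j; rewrite !mxE.
  by under eq_fun do rewrite !mxE; exact: h.
have urc (f : R -> 'M[R]_(n + 1)) : continuous f -> continuous (fun t => ursubmx (f t)).
  by move=> fc t; apply: cvg_ursubmx; exact: fc.
have ulE t : ulsubmx (b t) = ulsubmx (b' t).
  move: t; apply: IH; [exact: ulc | exact: ulc | | | | |].
  - by move=> t; exact: sym_ulsubmx.
  - by move=> t; exact: sym_ulsubmx.
  - by move=> t; have /generic_ind[] := bg t.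
  - move=> t k; rewrite -(@corner_char_poly_ul _ _ (b t) (lshift 1 k)) //.
    by rewrite -(@corner_char_poly_ul _ _ (b' t) (lshift 1 k)).
  by rewrite b0.
have cE t : char_poly (b t) = char_poly (b' t).
  have kE : (rshift n (0 : 'I_1)).+1 = (n + 1)%N by rewrite /= addn0 addn1.
  by rewrite -(corner_char_poly_last (b t) kE) -(corner_char_poly_last (b' t) kE).
have urE : forall t, ursubmx (b t) - ursubmx (b' t) = 0.
  apply: (clopen_continuous (g := fun t =>
    \det (krylov (ulsubmx (b t)) (ursubmx (b t) + ursubmx (b' t))))).
  - by move=> t; apply: cvgB; exact: urc.
  - move=> t; apply: cvg_det; apply: cvg_krylov; first exact: ulc.
    by apply: cvgD; exact: urc.
  - by move=> t; apply: border_eq => //; exact: generic_disjoint.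
  by rewrite b0 subrr.
move=> t; apply: sym_block_eq => //; last exact: trace_char_poly.
by apply/eqP; rewrite -subr_eq0 urE.
Qed.

End PathUniqueness.

(** * Uniqueness of the twist *)

Section Affine.
Variable R : realType.

Lemma horner_char_poly_affine n (M : 'M[R]_n) c t x :
  (char_poly (c%:M + t *: M)).[c + t * x] = t ^+ n * (char_poly M).[x].
Proof.
rewrite !horner_char_poly -detZ; congr determinant.
by rewrite scalerBr scale_scalar_mx raddfD opprD addrACA subrr add0r.
Qed.

Lemma corner_char_poly_affine n (M : 'M[R]_n) k c t x :
  (corner_char_poly (c%:M + t *: M) k).[c + t * x] =
  t ^+ k.+1 * (corner_char_poly M k).[x].
Proof.
rewrite -(horner_char_poly_affine _ c); congr (char_poly _).[_].
by apply/matrixP => i j; rewrite !mxE.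
Qed.

Lemma corner_char_poly_affine_inj n (M N : 'M[R]_n) k c t : t != 0 ->
  corner_char_poly (c%:M + t *: M) k = corner_char_poly (c%:M + t *: N) k ->
  corner_char_poly M k = corner_char_poly N k.
Proof.
move=> t0 e; apply: poly_ext => x; apply: (mulfI (expf_neq0 k.+1 t0)).
by rewrite -!(corner_char_poly_affine _ _ c) e.
Qed.

Lemma generic_affine n (M : 'M[R]_n) c t : t != 0 ->
  generic (c%:M + t *: M) <-> generic M.
Proof.
move=> t0; have rE k x : root (corner_char_poly (c%:M + t *: M) k) (c + t * x) =
    root (corner_char_poly M k) x.
  by rewrite !rootE corner_char_poly_affine mulf_eq0 expf_eq0 (negbTE t0).
split=> gM k k' kk' x; first by rewrite -!rE; exact: gM.
have -> : x = c + t * ((x - c) / t) by rewrite mulrC divfK // addrC subrK.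
by rewrite !rE; exact: gM.
Qed.

Lemma generic_exp_roots n (A B : 'M[R]_n) : generic A ->
  (forall k, exp_roots (corner_char_poly A k) (corner_char_poly B k)) -> generic B.
Proof.
by move=> gA AB k k' kk' x; apply: (exp_roots_disjoint (AB k) (AB k')) => y; exact: gA.
Qed.

Lemma generic_simple n (A W : 'M[R]_n) (l : 'rV[R]_n) : A^T = A -> generic A ->
  W *m W^T = 1%:M -> A = spmx W l -> injective (l 0).
Proof.
move: A W l; case: n => [|n]; first by move=> A W l _ _ _ _ [].
rewrite -addn1 => A W l At /generic_disjoint dA.
exact: disjoint_roots_simple At dA.
Qed.

End Affine.

Section TwistPath.
Variables (R : realType) (n : nat).

Lemma gammaE (psi : 'M[R]_n -> 'M[R]_n) (A : 'M[R]_n) : SO (psi A) ->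
  gamma psi A = twisted_exp psi A.
Proof.
move=> /SO_orth PP; rewrite /gamma /twisted_exp.
have [uP _] := mulmx1_unit PP.
by have -> : invmx (psi A) = (psi A)^T by rewrite -[LHS]mulmx1 -PP mulKmx.
Qed.

Variables (psi : 'M[R]_n -> 'M[R]_n) (A : 'M[R]_n).
Hypotheses (tw : intertwining_twist psi) (At : A^T = A) (gA : generic A).

Let psiSO B : B^T = B -> SO (psi B).
Proof. by case: tw => + _ _ _ /SymE; apply. Qed.

Let psi0 : psi 0 = 1%:M. Proof. by case: tw. Qed.

Let rayt t : (t *: A)^T = t *: A.
Proof. by rewrite linearZ /= At. Qed.

Lemma twist_exp_roots B : B^T = B -> forall k,
  exp_roots (corner_char_poly B k) (corner_char_poly (twisted_exp psi B) k).
Proof.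
move=> Bt; apply: exp_roots_logGZ => //; first exact/SymPos_expmx/sym_orth.
rewrite -gammaE; last exact: psiSO.
by case: tw => _ _ _; apply; exact/SymE.
Qed.

Lemma cvg_twist (T : Type) (F : set_system T) {FF : Filter F} (f : T -> 'M[R]_n) B :
  B^T = B -> (forall x, (f x)^T = f x) -> f @ F --> B ->
  (fun x => psi (f x)) @ F --> psi B.
Proof.
move=> Bt ft fB; have [_ psiC _ _] := tw.
apply: (@Ck_on_cvg _ _ _ (@Sym R n) (@Sym R n) psi B T F FF f _ _ fB).
- by split.
- exact/SymE.
by near=> x; exact/SymE.
Unshelve. all: by end_near. Qed.

Lemma continuous_twist : continuous (fun t : R => psi (t *: A)).
Proof. by move=> s; apply: cvg_twist => //; exact: cvg_ray. Qed.

(** Its t-multiple is the argument of exp in twisted_exp psi (t *: A), with the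
    factor t split off so that the path starts at A. *)
Definition twist_path t : 'M[R]_n := psi (t *: A) *m A *m (psi (t *: A))^T.

(** The quotient (exp (t *: twist_path t) - 1) / t, in a form that extends to
    t = 0, where it is A. *)
Definition twist_quotient t : 'M[R]_n := phimx (t *: twist_path t) *m twist_path t.

Lemma twist_path_sym t : (twist_path t)^T = twist_path t.
Proof. exact: sym_orth. Qed.

Lemma twist_path0 : twist_path 0 = A.
Proof. by rewrite /twist_path scale0r psi0 trmx1 mul1mx mulmx1. Qed.

Lemma twisted_exp_path t : twisted_exp psi (t *: A) = expmx (t *: twist_path t).
Proof. by rewrite /twisted_exp /twist_path -scalemxAr -scalemxAl. Qed.

Lemma expmx_twist_path t :
  expmx (t *: twist_path t) = 1%:M + t *: twist_quotient t.
Proof.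
have e := phimxM (t *: twist_path t); rewrite -scalemxAr in e.
by rewrite /twist_quotient e addrC subrK.
Qed.

Lemma twist_quotient_spmx V (z : 'rV[R]_n) t : V *m V^T = 1%:M ->
  twist_path t = spmx V z ->
  twist_quotient t = spmx V (\row_i (phi (t * z 0 i) * z 0 i)).
Proof.
move=> VV ZE; rewrite /twist_quotient ZE spmxZ (phimx_spmx _ VV) (spmxM VV).
apply: (congr1 (spmx V)); apply/rowP => i.
by rewrite [LHS]mxE [RHS]mxE [X in X * _]mxE [X in phi X]mxE.
Qed.

Lemma twist_quotient_sym t : (twist_quotient t)^T = twist_quotient t.
Proof.
have [V [z [VV ZE]]] := sym_spmxP (twist_path_sym t).
by rewrite (twist_quotient_spmx VV ZE) spmx_tr.
Qed.

Lemma twist_quotient0 : twist_quotient 0 = A.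
Proof.
have [V [z [VV ZE]]] := sym_spmxP (twist_path_sym 0).
rewrite (twist_quotient_spmx VV ZE) -twist_path0 ZE.
by apply: (congr1 (spmx V)); apply/rowP => i; rewrite [LHS]mxE mul0r phi0 mul1r.
Qed.

Lemma continuous_twist_quotient : continuous twist_quotient.
Proof.
move=> s; have Zs : twist_path @ s --> twist_path s.
  by apply: cvg_mulmx; [apply: cvg_mulmx; [exact: continuous_twist|exact: cvg_cst]|
    apply: cvg_trmx; exact: continuous_twist].
apply: cvg_mulmx => //; apply: cvg_divdiff_exp; [|exact: cvg_cst|exact: cvg_cst].
by apply: cvgZ => //; exact: cvg_id.
Qed.

Lemma twist_quotient_generic t : generic (twist_quotient t).
Proof.
have [->|t0] := eqVneq t 0; first by rewrite twist_quotient0.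
apply: (generic_affine (twist_quotient t) 1 t0).1.
rewrite -expmx_twist_path -twisted_exp_path.
have gtA : generic (t *: A).
  by have := (generic_affine A 0 t0).2 gA; rewrite raddf0 add0r.
exact: generic_exp_roots gtA (twist_exp_roots (rayt t)).
Qed.

End TwistPath.

Section Uniqueness.
Variables (R : realType) (n : nat) (psi psi' : 'M[R]_n -> 'M[R]_n).
Hypotheses (tw : intertwining_twist psi) (tw' : intertwining_twist psi').

(** The paths of quotients have the same corner spectra because both twists
    intertwine the Gelfand-Zeitlin maps. *)
Lemma twist_path_unique (A : 'M[R]_n) : A^T = A -> generic A ->
  forall t, twist_path psi A t = twist_path psi' A t.
Proof.
move=> At gA t; have rayt s : (s *: A)^T = s *: A by rewrite linearZ /= At.
have [->|t0] := eqVneq t 0; first by rewrite !twist_path0.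
suff bE : twist_quotient psi A t = twist_quotient psi' A t.
  apply: (scalerI t0); apply: expmx_sym_inj.
  - by rewrite linearZ /= twist_path_sym.
  - by rewrite linearZ /= twist_path_sym.
  by rewrite !expmx_twist_path bE.
apply: (path_unique (b := twist_quotient psi A) (b' := twist_quotient psi' A)).
- exact: continuous_twist_quotient.
- exact: continuous_twist_quotient.
- by move=> s; exact: twist_quotient_sym.
- by move=> s; exact: twist_quotient_sym.
- by move=> s; exact: twist_quotient_generic.
- move=> s k; have [->|s0] := eqVneq s 0; first by rewrite !twist_quotient0.
  apply: (corner_char_poly_affine_inj (c := 1) s0).
  rewrite -!expmx_twist_path -!twisted_exp_path.
  apply: exp_roots_fun (twist_exp_roots tw (rayt s) k) (twist_exp_roots tw' (rayt s) k).
by rewrite !twist_quotient0.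
Qed.

(** By twist_path_unique, psi^T psi' commutes with A along the ray through A. As A
    has simple spectrum, it is diagonal in an eigenbasis of A, with entries 1 or
    -1, which stay 1 from t = 0 on. *)
Lemma twist_unique_generic (A : 'M[R]_n) : A^T = A -> generic A -> psi' A = psi A.
Proof.
move=> At gA; have [V [a [VV AE]]] := sym_spmxP At.
have ainj := generic_simple At gA VV AE.
have rayt s : (s *: A)^T = s *: A by rewrite linearZ /= At.
have PP t : psi (t *: A) *m (psi (t *: A))^T = 1%:M.
  by apply: SO_orth; case: tw => + _ _ _; apply; exact/SymE.
have PP' t : psi' (t *: A) *m (psi' (t *: A))^T = 1%:M.
  by apply: SO_orth; case: tw' => + _ _ _; apply; exact/SymE.
have [T TE] : exists T : R -> 'M[R]_n, forall t, T t = (psi (t *: A))^T *m psi' (t *: A).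
  by exists (fun t => (psi (t *: A))^T *m psi' (t *: A)).
pose D t := V *m T t *m V^T.
have TA t : T t *m A = A *m T t.
  have := twist_path_unique At gA t; rewrite /twist_path.
  move/(congr1 (fun X => (psi (t *: A))^T *m X *m psi' (t *: A))).
  rewrite -!mulmxA (mulmx1C (PP' t)) mulmx1.
  by rewrite !mulmxA (mulmx1C (PP t)) mul1mx -TE -mulmxA -TE => ->.
have TT t : T t *m (T t)^T = 1%:M.
  rewrite TE trmx_mul trmxK mulmxA -(mulmxA (psi (t *: A))^T) PP' mulmx1.
  exact: mulmx1C.
(* Commuting with the diagonal matrix of the distinct a 0 i. *)
have Doff t i j : i != j -> D t i j = 0.
  have e1 : V *m (T t *m A) *m V^T = D t *m diag_mx a.
    by rewrite AE /spmx /D !mulmxA -(mulmxA _ V V^T) VV mulmx1.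
  have e2 : V *m (A *m T t) *m V^T = diag_mx a *m D t.
    by rewrite AE /spmx /D !mulmxA VV mul1mx.
  move=> ij; have /matrixP/(_ i j) : D t *m diag_mx a = diag_mx a *m D t.
    by rewrite -e1 -e2 TA.
  rewrite mul_mx_diag mul_diag_mx [LHS]mxE [RHS]mxE mulrC => /eqP.
  rewrite -subr_eq0 -mulrBl mulf_eq0 subr_eq0 (inj_eq ainj) eq_sym (negbTE ij).
  by move/eqP.
have DD t : D t *m (D t)^T = 1%:M.
  rewrite /D !trmx_mul trmxK !mulmxA -(mulmxA _ V^T V) (mulmx1C VV) mulmx1.
  by rewrite -(mulmxA V) TT mulmx1.
have Dc i : continuous (fun t => D t i i).
  move=> s; have : D @ s --> D s.
    apply: cvg_mulmx; last exact: cvg_cst.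
    apply: cvg_mulmx; first exact: cvg_cst.
    rewrite (funext TE).
    by apply: cvg_mulmx; [apply: cvg_trmx|]; exact: continuous_twist.
  by move/cvg_mxP => /(_ i i).
have D1 : D 1 = 1%:M.
  apply/matrixP => i j; rewrite [RHS]mxE.
  have [<-|ij] := eqVneq i j; last exact: Doff.
  apply: (@continuous_path_pm1 _ (fun t => D t i i)) => [||t]; first exact: Dc.
    have [_ _ p0 _] := tw; have [_ _ p0' _] := tw'.
    by rewrite /D TE scale0r p0 p0' trmx1 !mulmx1 VV mxE eqxx.
  have /matrixP/(_ i i) := DD t; rewrite mulmx_trE mxE eqxx (bigD1 i) //=.
  by rewrite big1 ?addr0 // => l li; rewrite Doff ?mul0r // eq_sym.
have T1 : T 1 = 1%:M.
  have : V^T *m D 1 *m V = T 1.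
    by rewrite /D !mulmxA (mulmx1C VV) mul1mx -mulmxA (mulmx1C VV) mulmx1.
  by rewrite D1 mulmx1 (mulmx1C VV) => <-.
have := PP 1; have := T1; rewrite TE scale1r => t1 pp.
by rewrite -[LHS]mul1mx -pp -mulmxA t1 mulmx1.
Qed.

Lemma intertwining_twist_unique (A : 'M[R]_n) : A^T = A -> psi' A = psi A.
Proof.
move=> At; have [C Ct gC] := generic_near At.
have st t : (segment_mx A C t)^T = segment_mx A C t by exact: segment_mx_sym.
have l1 : (fun t => psi (segment_mx A C t)) @ (0 : R)^' --> psi A.
  by apply: (cvg_twist tw At st); exact: cvg_segment.
have l2 : (fun t => psi' (segment_mx A C t)) @ (0 : R)^' --> psi' A.
  by apply: (cvg_twist tw' At st); exact: cvg_segment.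
have l3 : (fun t => psi (segment_mx A C t)) @ (0 : R)^' --> psi' A.
  have e : \forall t \near (0 : R)^',
      psi' (segment_mx A C t) = psi (segment_mx A C t).
    by apply: filterS gC => t; exact: twist_unique_generic.
  by apply: cvg_trans l2; exact: (near_eq_cvg e).
exact: (cvg_unique _ l3 l1).
Qed.

End Uniqueness.

(** * The theorem *)

Section Main.
Variables (R : realType) (n : nat).

Lemma twisted_exp_SymPos (psi : 'M[R]_n -> 'M[R]_n) A : A^T = A ->
  SymPos (twisted_exp psi A).
Proof. by move=> At; apply/SymPos_expmx/sym_orth. Qed.

Lemma good_twist_intertwining (psi g : 'M[R]_n -> 'M[R]_n) :
  good_twist psi g -> intertwining_twist psi.
Proof.
move=> [pSO p0 pr _ [ps _]]; split=> // [|A As].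
  have oS := @open_along_Sym R n.
  by have [] := ps _ _ _ oS 0%N id (Ck_on_id 0 oS) (fun _ Ax => Ax).
rewrite gammaE; last exact: pSO.
by apply: logGZ_exp_roots; [exact/SymE | exact: pr].
Qed.

Lemma good_twist_smooth (psi g : 'M[R]_n -> 'M[R]_n) : good_twist psi g ->
  smooth_on (@Sym R n) (@Sym R n) psi.
Proof.
move=> [_ _ _ _ [ps _]] k; have oS := @open_along_Sym R n.
exact: ps _ _ _ oS k id (Ck_on_id k oS) (fun _ Ax => Ax).
Qed.

Lemma good_twist_diffeomorphism (psi g : 'M[R]_n -> 'M[R]_n) : good_twist psi g ->
  diffeomorphism_on (@Sym R n) (@Sym R n) (@SymPos R n) (gamma psi).
Proof.
move=> gt; have [pSO _ _ [gK gS Kg] [_ gs]] := gt.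
have gE A : Sym A -> gamma psi A = twisted_exp psi A by move=> As; exact/gammaE/pSO.
split.
- split=> [A As|A B As Bs|B Bp].
  + by rewrite gE //; apply/twisted_exp_SymPos/SymE.
  + move: As Bs; rewrite !inE => As Bs; rewrite !gE // => e.
    by rewrite -(gK A As) -(gK B Bs) e.
  + exists (g B); first exact: gS.
    by rewrite gE ?Kg //; exact: gS.
- move=> k; have oS := @open_along_Sym R n.
  apply: (eq_Ck_on oS (f := twisted_exp psi)) => [A As|]; first by rewrite gE.
  have pC := good_twist_smooth gt k.
  apply: (Ck_on_expmx oS); apply: (Ck_on_mulmx oS); last exact: (Ck_on_trmx oS).
  by apply: (Ck_on_mulmx oS) => //; exact: Ck_on_id.
exists g => [A As|k]; first by rewrite gE ?gK.
have oP := @open_along_SymPos R n.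
exact: gs _ _ _ oP k id (Ck_on_id k oP) (fun _ Bx => Bx).
Qed.

End Main.

Theorem theorem1p1 (R : realType) (n : nat) (n_ge1 : (1 <= n)%N) :
  exists psi : 'M[R]_n -> 'M[R]_n,
    [/\ intertwining_twist psi,
        (forall psi' : 'M[R]_n -> 'M[R]_n, intertwining_twist psi' ->
           forall A, Sym A -> psi' A = psi A),
        smooth_on (@Sym R n) (@Sym R n) psi &
        diffeomorphism_on (@Sym R n) (@Sym R n) (@SymPos R n) (gamma psi)].
Proof.
have [psi [g gt]] := good_twist_exists R n; exists psi.
have tw := good_twist_intertwining gt; split=> //.
- by move=> psi' tw' A /SymE At; exact: intertwining_twist_unique tw tw' _ At.
- exact: good_twist_smooth gt.
- exact: good_twist_diffeomorphism gt.
Qed.
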